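(* Let $T>0$, fix $s>1/2$ and $\gamma\in(0,1]$. If the Cauchy problem $iu_t+u_{xx}+\frac12|u|^2u=0$ on $\mathbb T=\mathbb R/(2\pi\mathbb Z)$, $u(0)=u_0$, has a solution $u\in\mathcal C^0([0,T];H^{s+\gamma}(\mathbb T))$, then there exist $C,h_0>0$ depending on $s$, $\gamma$ and $\sup_{t\in[0,T]}\|u(t)\|_{H^{s+\gamma}}$ (with $T$ regarded as fixed) such that for any $0<h<h_0$ $$\|u^m-u(t_m)\|_{H^s}\le Ch^\gamma,\qquad\forall\,0\le m\le\lfloor T/h\rfloor,$$ where $t_m=hm$, $u^0=u_0$, and $u^m$ is computed with the implicit symmetric method $$u^{m+1}=e^{ih\partial_x^2}u^m+i\frac h4e^{ih\partial_x^2}\left[(u^m)^2\varphi_1(-ih\partial_x^2)\overline{u^m}\right]+i\frac h4\left[(u^{m+1})^2\varphi_1(ih\partial_x^2)\overline{u^{m+1}}\right].$$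
   Context: $\varphi_1(z)=(e^z-1)/z$ for $z\ne0$, $\varphi_1(0)=1$. The operators $e^{ih\partial_x^2}$, $\varphi_1(\pm ih\partial_x^2)$ are Fourier multipliers on $\mathbb T$, obtained by replacing $\partial_x^2$ by $-k^2$ on the mode $e^{ikx}$. At each step the implicit equation is solved by fixed-point iteration: $u^{m+1}$ is the $H^s$-limit of the iterates $w_0=e^{ih\partial_x^2}u^m$, $w_{j+1}=\mathcal S(w_j)$, where $\mathcal S(w)$ denotes the right-hand side of the method with $u^{m+1}$ replaced by $w$ (for $h$ small relative to $\|u^m\|_{H^s}$). *)

(* Defs.v *)
From Stdlib Require Import Reals ZArith.
From Coquelicot Require Import Coquelicot.
Open Scope R_scope.

(** * Functions on the torus [R / 2 pi Z]

    A function on the torus is a [2 PI]-periodic function on [R].  Only spaces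
    [H^s] with [s > 1/2] are needed.  By the Sobolev embedding every class in
    such a space has exactly one continuous representative, and [H^s] is
    represented here by these continuous functions; in particular products are
    pointwise products, and the Riemann integral is enough. *)

Definition periodic {V : Type} (f : R -> V) : Prop :=
  forall x, f (x + 2 * PI) = f x.

Definition Cexp (z : C) : C :=
  (exp (Re z) * cos (Im z), exp (Re z) * sin (Im z)).

Definition torus_int (f : R -> C) : C :=
  RInt (V := C_R_CompleteNormedModule) f 0 (2 * PI).

Definition fcoef (f : R -> C) (k : Z) : C :=
  (/ RtoC (2 * PI) *
   torus_int (fun x => f x * Cexp (- (Ci * RtoC (IZR k * x)))))%C.

(** A series over [Z] is summed as [a 0 + sum_(n >= 1) (a n + a (-n))].  For
    nonnegative or absolutely summable [a] the order is irrelevant. *)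
Definition Zterm (a : Z -> R) (n : nat) : R :=
  match n with
  | O => a 0%Z
  | S _ => a (Z.of_nat n) + a (- Z.of_nat n)%Z
  end.

Definition ZSeries (a : Z -> R) : R := Series (Zterm a).

Definition ZSeriesC (a : Z -> C) : C :=
  (ZSeries (fun k => Re (a k)), ZSeries (fun k => Im (a k))).

(** * Sobolev spaces *)

Definition Hs_weight (s : R) (f : R -> C) (k : Z) : R :=
  Rpower (1 + IZR k ^ 2) s * Cmod (fcoef f k) ^ 2.

Definition in_Hs (s : R) (f : R -> C) : Prop :=
  periodic f /\
  (forall x, continuous (U := C_UniformSpace) f x) /\
  ex_series (Zterm (Hs_weight s f)).

(** Meaningful only under [in_Hs s f], since [Series] is total. *)
Definition Hs_norm (s : R) (f : R -> C) : R :=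
  sqrt (ZSeries (Hs_weight s f)).

Definition fsub (f g : R -> C) : R -> C := fun x => (f x - g x)%C.

Definition Hs_lim (s : R) (w : nat -> R -> C) (v : R -> C) : Prop :=
  (forall j, in_Hs s (w j)) /\ in_Hs s v /\
  is_lim_seq (fun j => Hs_norm s (fsub (w j) v)) 0.

(** [u] is a function of time, then space. *)
Definition C0_Hs (T s : R) (u : R -> R -> C) : Prop :=
  (forall t, 0 <= t <= T -> in_Hs s (u t)) /\
  (forall t, 0 <= t <= T ->
     filterlim (fun t' => Hs_norm s (fsub (u t') (u t)))
       (within (fun t' => 0 <= t' <= T) (locally t)) (locally 0)).

Definition is_sup_Hs (T s : R) (u : R -> R -> C) (M : R) : Prop :=
  is_lub (fun r => exists t, 0 <= t <= T /\ r = Hs_norm s (u t)) M.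

(** * The Cauchy problem *)

Definition test_function (psi : R -> R) : Prop :=
  periodic psi /\ forall n x, ex_derive_n psi n x.

Definition pairing (f : R -> C) (psi : R -> R) : C :=
  torus_int (fun x => f x * RtoC (psi x))%C.

(** The equation [i u_t + u_xx + 1/2 |u|^2 u = 0] in the sense of
    distributions: for every test function [psi] the map [t |-> <u(t), psi>] is
    differentiable on [(0,T)] and
    [i d/dt <u, psi> + <u, psi''> + 1/2 <|u|^2 u, psi> = 0].
    Real-valued [psi] suffice by linearity. *)
Definition NLS_solution (T : R) (u0 : R -> C) (u : R -> R -> C) : Prop :=
  (forall x, u 0 x = u0 x) /\
  forall psi, test_function psi ->
  forall t, 0 < t < T ->
  exists l : C,
    is_derive (V := C_R_NormedModule) (fun t' => pairing (u t') psi) t l /\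
    (Ci * l + pairing (u t) (Derive_n psi 2)
     + RtoC (1 / 2) *
       pairing (fun x => RtoC (Cmod (u t x) ^ 2) * u t x) psi = 0)%C.

(** * The numerical method *)

(** [fmult sigma] is the operator [sigma(d_x^2)]. *)
Definition fmult (sigma : C -> C) (f : R -> C) : R -> C := fun x =>
  ZSeriesC (fun k =>
    sigma (RtoC (- IZR k ^ 2)) * fcoef f k * Cexp (Ci * RtoC (IZR k * x)))%C.

Definition phi1 (z : C) : C :=
  if Ceq_dec z 0%C then 1%C else ((Cexp z - 1) / z)%C.

Definition exp_op (h : R) : (R -> C) -> R -> C :=
  fmult (fun d => Cexp (Ci * RtoC h * d)%C).

Definition phi1_op (h : R) : (R -> C) -> R -> C :=
  fmult (fun d => phi1 (Ci * RtoC h * d)%C).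

Definition fconj (f : R -> C) : R -> C := fun x => Cconj (f x).

(** Right-hand side of the method, with [v] for [u^m] and [w] for [u^{m+1}]. *)
Definition method_rhs (h : R) (v w : R -> C) : R -> C := fun x =>
  (exp_op h v x
   + Ci * RtoC (h / 4) *
       exp_op h (fun y => v y * v y * phi1_op (- h) (fconj v) y) x
   + Ci * RtoC (h / 4) * (w x * w x * phi1_op h (fconj w) x))%C.

Fixpoint method_iter (h : R) (v : R -> C) (j : nat) : R -> C :=
  match j with
  | O => exp_op h v
  | S j' => method_rhs h v (method_iter h v j')
  end.

Definition method_step (s h : R) (v v' : R -> C) : Prop :=
  Hs_lim s (method_iter h v) v' /\
  forall x, v' x = method_rhs h v v' x.

(** [U 0, ..., U N] are the first iterates of the method started at [u0]. *)
Definition method_seq (s h : R) (N : Z) (u0 : R -> C) (U : nat -> R -> C)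
  : Prop :=
  (forall x, U 0%nat x = u0 x) /\
  forall m : nat, (Z.of_nat (S m) <= N)%Z -> method_step s h (U m) (U (S m)).

(* Main.v *)
Require Import Defs.
From Stdlib Require Import Reals ZArith Lra Lia FunctionalExtensionality.
From Stdlib Require Import PSeries_reg Ranalysis5.
From Coquelicot Require Import Coquelicot.
Open Scope R_scope.

(** The proof works on Fourier coefficients.  A function of order [s > 1/2] is
    determined by its coefficients, products become convolutions, and all the
    operators of the method become diagonal, so the statement turns into one
    about sequences in a weighted [l^2] space.  That space is an algebra
    (lemma [conv_dominated]), because the weights [(1 + k^2)^s] have summable
    inverses.

    The local error rests on the resonance structure.  Pulled back to the free
    flow, the interaction of the modes [j] and [k - j] oscillates with the
    phase [t (k^2 - j^2 - (k - j)^2) = 2 t j (k - j)].  This is a product, and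
    [|e^(i x) - 1| <= 2 |x|^gamma], so dropping the phase costs
    [t^gamma] and only [gamma] derivatives on each of the two factors
    (lemma [conv_rot]).  Applied twice, this replaces the cubic term by
    [u^2 (exp (-2 i t d_x^2) conj u)], up to [t^gamma] in [H^s] for data in
    [H^(s+gamma)] (lemma [cub_rot]).  The remaining phase is integrated
    exactly by [phi1].  Integrating over half a step therefore gives an error
    [O(h^(1+gamma))] (lemma [half_step_error]).  The implicit half of the
    method is the same computation for [conj u (t + h - .)], which solves the
    same equation, and the two halves meet at the middle of the step (lemma
    [local_error]).  A distributional solution solves an ordinary differential
    equation in each mode, and a mean value inequality tested against finitely
    many modes (lemma [hle_mean_value]) takes the place of vector-valued
    integration of Duhamel's formula.

    For small [h] the fixed-point map is a contraction of a ball of [H^s]; this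
    gives existence of a step, and confines every limit of the iteration to
    that ball.  The right-hand side of the method is Lipschitz in both
    arguments with constant [1 + O(h)] in the first and [O(h)] in the second,
    so local errors accumulate to [O(h^gamma)] as in the discrete Gronwall
    lemma (lemma [one_step_error]).  For small [h] this error is at most [1],
    so the numerical solution never leaves the ball on which the constants
    were fixed (lemma [method_prefix_error]). *)

(** * Symmetric partial sums over the integers *)

Fixpoint zsum (a : Z -> R) (n : nat) : R :=
  match n with
  | O => a 0%Z
  | S m => zsum a m + (a (Z.of_nat (S m)) + a (- Z.of_nat (S m))%Z)
  end.

Lemma zsum_S a n : zsum a (S n) =
  zsum a n + (a (Z.of_nat (S n)) + a (- Z.of_nat (S n))%Z).
Proof. reflexivity. Qed.

Lemma zsum_Zterm a n : sum_n (Zterm a) n = zsum a n.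
Proof.
  induction n as [|n IH].
  - now rewrite sum_O.
  - rewrite sum_Sn, IH. reflexivity.
Qed.

Lemma zsum_ext a b n : (forall k, a k = b k) -> zsum a n = zsum b n.
Proof.
  intros H; induction n as [|n IH]; [apply H|].
  rewrite !zsum_S, IH, !H. reflexivity.
Qed.

Lemma zsum_le a b n : (forall k, a k <= b k) -> zsum a n <= zsum b n.
Proof.
  intros H; induction n as [|n IH]; [apply H|].
  rewrite !zsum_S.
  generalize (H (Z.of_nat (S n))), (H (- Z.of_nat (S n))%Z); lra.
Qed.

Lemma zsum_plus a b n : zsum (fun k => a k + b k) n = zsum a n + zsum b n.
Proof.
  induction n as [|n IH]; [reflexivity|].
  rewrite !zsum_S, IH. ring.
Qed.

Lemma zsum_scal c a n : zsum (fun k => c * a k) n = c * zsum a n.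
Proof.
  induction n as [|n IH]; [reflexivity|].
  rewrite !zsum_S, IH. ring.
Qed.

Lemma zsum_zero n : zsum (fun _ => 0) n = 0.
Proof.
  induction n as [|n IH]; [reflexivity|].
  rewrite !zsum_S, IH. ring.
Qed.

Lemma zsum_nonneg a n : (forall k, 0 <= a k) -> 0 <= zsum a n.
Proof. intros H. rewrite <- (zsum_zero n). apply zsum_le, H. Qed.

Lemma zsum_incr a n p : (forall k, 0 <= a k) -> zsum a n <= zsum a (n + p).
Proof.
  intros H. induction p as [|p IH].
  - rewrite Nat.add_0_r; lra.
  - rewrite Nat.add_succ_r, zsum_S.
    generalize (H (Z.of_nat (S (n + p)))), (H (- Z.of_nat (S (n + p)))%Z); lra.
Qed.

Lemma zsum_term a k n : (forall k, 0 <= a k) -> (Z.abs_nat k <= n)%nat ->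
  a k <= zsum a n.
Proof.
  intros H Hn.
  assert (H0 : a k <= zsum a (Z.abs_nat k)).
  { destruct (Z.abs_nat k) as [|m] eqn:E.
    - replace k with 0%Z by lia. simpl. lra.
    - rewrite zsum_S. generalize (zsum_nonneg a m H).
      generalize (H (Z.of_nat (S m))), (H (- Z.of_nat (S m))%Z).
      assert (k = Z.of_nat (S m) \/ k = (- Z.of_nat (S m))%Z) as [-> | ->] by lia;
      lra. }
  replace n with (Z.abs_nat k + (n - Z.abs_nat k))%nat by lia.
  eapply Rle_trans; [apply H0 | apply zsum_incr, H].
Qed.

Lemma zsum_opp a n : zsum (fun k => a (- k)%Z) n = zsum a n.
Proof.
  induction n as [|n IH]; [reflexivity|].
  rewrite !zsum_S, IH, Z.opp_involutive. ring.
Qed.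

Lemma zsum_shift1 a n : zsum (fun k => a (k + 1)%Z) n =
  zsum a n - a (- Z.of_nat n)%Z + a (Z.of_nat (S n)).
Proof.
  induction n as [|n IH].
  - simpl. ring.
  - rewrite !zsum_S, IH.
    replace (- Z.of_nat (S n) + 1)%Z with (- Z.of_nat n)%Z by lia.
    replace (Z.of_nat (S n) + 1)%Z with (Z.of_nat (S (S n))) by lia.
    ring.
Qed.

Lemma zsum_shift_nat a p n : (forall k, 0 <= a k) ->
  zsum (fun k => a (k + Z.of_nat p)%Z) n <= zsum a (n + p).
Proof.
  revert a. induction p as [|p IH]; intros a H.
  - rewrite Nat.add_0_r. right; apply zsum_ext; intros k; f_equal; lia.
  - rewrite (zsum_ext _ (fun k => (fun i => a (i + 1)%Z) (k + Z.of_nat p)%Z))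
      by (intros k; f_equal; lia).
    eapply Rle_trans; [apply (IH (fun i => a (i + 1)%Z)); intros; apply H|].
    rewrite zsum_shift1, Nat.add_succ_r, zsum_S.
    generalize (H (- Z.of_nat (n + p))%Z), (H (- Z.of_nat (S (n + p)))%Z); lra.
Qed.

(** Translating the index moves the window of summation, which only enlarges
    a sum of nonnegative terms once the window is widened accordingly. *)
Lemma zsum_shift a k n : (forall k, 0 <= a k) ->
  zsum (fun j => a (j + k)%Z) n <= zsum a (n + Z.abs_nat k).
Proof.
  intros H.
  assert (k = Z.of_nat (Z.abs_nat k) \/ k = (- Z.of_nat (Z.abs_nat k))%Z)
    as [E | E] by lia.
  - rewrite (zsum_ext _ (fun j => a (j + Z.of_nat (Z.abs_nat k))%Z))
      by (intros j; f_equal; lia).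
    apply zsum_shift_nat, H.
  - rewrite <- zsum_opp.
    rewrite (zsum_ext _
      (fun j => (fun i => a (- i)%Z) (j + Z.of_nat (Z.abs_nat k))%Z))
      by (intros j; f_equal; lia).
    eapply Rle_trans;
      [apply (zsum_shift_nat (fun i => a (- i)%Z)); intros; apply H|].
    rewrite zsum_opp. lra.
Qed.

Lemma zsum_reflect a k n : (forall k, 0 <= a k) ->
  zsum (fun j => a (k - j)%Z) n <= zsum a (n + Z.abs_nat k).
Proof.
  intros H. rewrite <- zsum_opp.
  rewrite (zsum_ext _ (fun j => a (j + k)%Z)) by (intros j; f_equal; lia).
  apply zsum_shift, H.
Qed.

Lemma zsum_swap f n m :
  zsum (fun k => zsum (fun j => f k j) n) m =
  zsum (fun j => zsum (fun k => f k j) m) n.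
Proof.
  induction m as [|m IH].
  - reflexivity.
  - rewrite zsum_S, IH, <- !zsum_plus. apply zsum_ext. intros; reflexivity.
Qed.

(** Adding one product to both sides of the Cauchy-Schwarz inequality: the cross
    term is absorbed because [(A y^2 - B x^2)^2 >= 0]. *)
Lemma cauchy_schwarz_step S A B x y : 0 <= A -> 0 <= B -> S ^ 2 <= A * B ->
  (S + x * y) ^ 2 <= (A + x ^ 2) * (B + y ^ 2).
Proof.
  intros HA HB HS.
  assert (H : 2 * S * (x * y) <= A * y ^ 2 + B * x ^ 2).
  { apply Rle_trans with (Rabs (2 * S * (x * y))); [apply Rle_abs|].
    assert (Hq : (2 * S * (x * y)) ^ 2 <= (A * y ^ 2 + B * x ^ 2) ^ 2).
    { apply Rle_trans with (4 * (A * B) * (x * y) ^ 2).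
      - generalize (pow2_ge_0 (x * y)). nra.
      - generalize (pow2_ge_0 (A * y ^ 2 - B * x ^ 2)). nra. }
    rewrite <- (Rabs_pos_eq (A * y ^ 2 + B * x ^ 2)).
    - apply Rsqr_le_abs_0. rewrite !Rsqr_pow2. exact Hq.
    - generalize (pow2_ge_0 x), (pow2_ge_0 y). nra. }
  nra.
Qed.

Lemma zsum_cauchy_schwarz a b n :
  zsum (fun k => a k * b k) n ^ 2 <=
  zsum (fun k => a k ^ 2) n * zsum (fun k => b k ^ 2) n.
Proof.
  assert (Hp : forall c m, 0 <= zsum (fun k => c k ^ 2) m)
    by (intros; apply zsum_nonneg; intros; apply pow2_ge_0).
  induction n as [|n IH].
  - simpl. lra.
  - rewrite !zsum_S, <- !Rplus_assoc.
    apply cauchy_schwarz_step;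
      [generalize (Hp a n), (pow2_ge_0 (a (Z.of_nat (S n)))); lra
      |generalize (Hp b n), (pow2_ge_0 (b (Z.of_nat (S n)))); lra|].
    apply cauchy_schwarz_step; auto.
Qed.

Lemma zsum_series a : ex_series (Zterm a) -> is_lim_seq (zsum a) (ZSeries a).
Proof.
  intros H. apply (is_lim_seq_ext (sum_n (Zterm a)) (zsum a) (ZSeries a)).
  - apply zsum_Zterm.
  - apply (Series_correct _ H).
Qed.

Lemma zsum_ex_series a B : (forall k, 0 <= a k) ->
  (forall n, zsum a n <= B) -> ex_series (Zterm a).
Proof.
  intros H HB.
  destruct (ex_finite_lim_seq_incr (zsum a) B) as [l Hl].
  - intros n. rewrite <- (Nat.add_1_r n). apply zsum_incr, H.
  - exact HB.
  - exists l. apply (is_lim_seq_ext (zsum a) (sum_n (Zterm a)) l); [|exact Hl].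
    intros; symmetry; apply zsum_Zterm.
Qed.

Lemma zsum_le_series a n : (forall k, 0 <= a k) -> ex_series (Zterm a) ->
  zsum a n <= ZSeries a.
Proof.
  intros H He.
  apply (is_lim_seq_incr_compare (zsum a)); [apply zsum_series, He|].
  intros m. rewrite <- (Nat.add_1_r m). apply zsum_incr, H.
Qed.

Lemma ZSeries_le_bound a B : (forall k, 0 <= a k) ->
  (forall n, zsum a n <= B) -> ZSeries a <= B.
Proof.
  intros H HB.
  assert (He := zsum_ex_series a B H HB).
  apply (is_lim_seq_le (zsum a) (fun _ => B) (ZSeries a) B).
  - exact HB.
  - apply zsum_series, He.
  - apply is_lim_seq_const.
Qed.

(** * Limits and sums of complex numbers *)

Definition Clim (u : nat -> C) (l : C) : Prop :=
  is_lim_seq (fun n => Re (u n)) (Re l) /\ is_lim_seq (fun n => Im (u n)) (Im l).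

Lemma im_le_Cmod c : Rabs (Im c) <= Cmod c.
Proof.
  eapply Rle_trans; [apply Rmax_r | apply (Rmax_Cmod c)].
Qed.

Lemma Cmod_le_abs (c : C) : Cmod c <= Rabs (Re c) + Rabs (Im c).
Proof.
  rewrite <- (Rabs_pos_eq (Cmod c)) by apply Cmod_ge_0.
  rewrite <- (Rabs_pos_eq (Rabs (Re c) + Rabs (Im c)))
    by (generalize (Rabs_pos (Re c)), (Rabs_pos (Im c)); lra).
  apply Rsqr_le_abs_0. rewrite !Rsqr_pow2, Cmod2_alt.
  rewrite <- (pow2_abs (Re c)), <- (pow2_abs (Im c)).
  generalize (Rabs_pos (Re c)), (Rabs_pos (Im c)); nra.
Qed.

Lemma C_eq (a b : C) : Re a = Re b -> Im a = Im b -> a = b.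
Proof. destruct a, b; simpl; congruence. Qed.

Lemma re_minus (a b : C) : Re (a - b)%C = Re a - Re b.
Proof. unfold Cminus. rewrite re_plus, re_opp. ring. Qed.

Lemma im_minus (a b : C) : Im (a - b)%C = Im a - Im b.
Proof. unfold Cminus. rewrite im_plus, im_opp. ring. Qed.

Lemma Clim_unique u l l' : Clim u l -> Clim u l' -> l = l'.
Proof.
  intros [H1 H2] [H3 H4].
  apply C_eq.
  - apply is_lim_seq_unique in H1. apply is_lim_seq_unique in H3. congruence.
  - apply is_lim_seq_unique in H2. apply is_lim_seq_unique in H4. congruence.
Qed.

Lemma Clim_ext u v l : (forall n, u n = v n) -> Clim u l -> Clim v l.
Proof.
  intros H [H1 H2]; split; [eapply is_lim_seq_ext, H1|eapply is_lim_seq_ext, H2];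
  intros n; simpl; now rewrite H.
Qed.

Lemma Clim_const c : Clim (fun _ => c) c.
Proof. split; apply is_lim_seq_const. Qed.

Lemma Clim_plus u v a b : Clim u a -> Clim v b ->
  Clim (fun n => u n + v n)%C (a + b)%C.
Proof.
  intros [H1 H2] [H3 H4]; split.
  - rewrite re_plus. eapply is_lim_seq_ext; [intros; symmetry; apply re_plus|].
    now apply is_lim_seq_plus'.
  - rewrite im_plus. eapply is_lim_seq_ext; [intros; symmetry; apply im_plus|].
    now apply is_lim_seq_plus'.
Qed.

Lemma Clim_mult u v a b : Clim u a -> Clim v b ->
  Clim (fun n => u n * v n)%C (a * b)%C.
Proof.
  intros [H1 H2] [H3 H4]; split.
  - rewrite re_mult. eapply is_lim_seq_ext; [intros; symmetry; apply re_mult|].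
    apply is_lim_seq_minus'; now apply is_lim_seq_mult'.
  - rewrite im_mult. eapply is_lim_seq_ext; [intros; symmetry; apply im_mult|].
    apply is_lim_seq_plus'; now apply is_lim_seq_mult'.
Qed.

Lemma Clim_minus u v a b : Clim u a -> Clim v b ->
  Clim (fun n => u n - v n)%C (a - b)%C.
Proof.
  intros H1 H2.
  replace (a - b)%C with (a + (-1) * b)%C by ring.
  apply Clim_ext with (fun n => u n + (-1) * v n)%C; [intros; ring|].
  apply Clim_plus; auto. apply Clim_mult; auto. apply Clim_const.
Qed.

Lemma Clim_incr u l : Clim u l -> Clim (fun n => u (S n)) l.
Proof.
  intros [H1 H2]; split.
  - now apply (is_lim_seq_incr_1 (fun n => Re (u n))).
  - now apply (is_lim_seq_incr_1 (fun n => Im (u n))).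
Qed.

Lemma Clim_Cmod u l : Clim u l -> is_lim_seq (fun n => Cmod (u n)) (Cmod l).
Proof.
  intros [H1 H2].
  apply (is_lim_seq_continuous sqrt
    (fun n => (fst (u n)) ^ 2 + (snd (u n)) ^ 2)).
  - apply continuity_pt_sqrt.
    generalize (pow2_ge_0 (fst l)), (pow2_ge_0 (snd l)); lra.
  - apply is_lim_seq_plus'; simpl.
    + apply is_lim_seq_mult'; [exact H1|].
      apply is_lim_seq_mult'; [exact H1|apply is_lim_seq_const].
    + apply is_lim_seq_mult'; [exact H2|].
      apply is_lim_seq_mult'; [exact H2|apply is_lim_seq_const].
Qed.

Lemma Clim_squeeze u l e : (forall n, Cmod (u n - l) <= e n) ->
  is_lim_seq e 0 -> Clim u l.
Proof.
  intros H He. split.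
  - apply is_lim_seq_ext with (fun n => Re (u n - l)%C + Re l).
    { intros; rewrite re_minus; ring. }
    replace (Finite (Re l)) with (Finite (0 + Re l)) by (f_equal; ring).
    apply is_lim_seq_plus'; [|apply is_lim_seq_const].
    apply is_lim_seq_abs_0.
    apply (is_lim_seq_le_le (fun _ => 0) _ e);
      [|apply is_lim_seq_const|exact He].
    intros n; split; [apply Rabs_pos|].
    eapply Rle_trans; [apply re_le_Cmod|apply H].
  - apply is_lim_seq_ext with (fun n => Im (u n - l)%C + Im l).
    { intros; rewrite im_minus; ring. }
    replace (Finite (Im l)) with (Finite (0 + Im l)) by (f_equal; ring).
    apply is_lim_seq_plus'; [|apply is_lim_seq_const].
    apply is_lim_seq_abs_0.
    apply (is_lim_seq_le_le (fun _ => 0) _ e);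
      [|apply is_lim_seq_const|exact He].
    intros n; split; [apply Rabs_pos|].
    eapply Rle_trans; [apply im_le_Cmod|apply H].
Qed.

Lemma Clim_bound u l B : Clim u l -> (forall n, Cmod (u n) <= B) -> Cmod l <= B.
Proof.
  intros H HB.
  apply (is_lim_seq_le (fun n => Cmod (u n)) (fun _ => B) (Cmod l) B HB).
  - apply Clim_Cmod, H.
  - apply is_lim_seq_const.
Qed.

Fixpoint zsumC (a : Z -> C) (n : nat) : C :=
  match n with
  | O => a 0%Z
  | S m => (zsumC a m + (a (Z.of_nat (S m)) + a (- Z.of_nat (S m))%Z))%C
  end.

Lemma zsumC_S a n : zsumC a (S n) =
  (zsumC a n + (a (Z.of_nat (S n)) + a (- Z.of_nat (S n))%Z))%C.
Proof. reflexivity. Qed.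

Lemma re_zsumC a n : Re (zsumC a n) = zsum (fun k => Re (a k)) n.
Proof.
  induction n as [|n IH]; [reflexivity|].
  rewrite zsumC_S, zsum_S, !re_plus, IH. reflexivity.
Qed.

Lemma im_zsumC a n : Im (zsumC a n) = zsum (fun k => Im (a k)) n.
Proof.
  induction n as [|n IH]; [reflexivity|].
  rewrite zsumC_S, zsum_S, !im_plus, IH. reflexivity.
Qed.

Lemma zsumC_ext a b n : (forall k, a k = b k) -> zsumC a n = zsumC b n.
Proof.
  intros H; induction n as [|n IH]; [apply H|].
  rewrite !zsumC_S, IH, !H. reflexivity.
Qed.

Lemma zsumC_plus a b n :
  zsumC (fun k => a k + b k)%C n = (zsumC a n + zsumC b n)%C.
Proof.
  induction n as [|n IH]; [reflexivity|].
  rewrite !zsumC_S, IH. ring.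
Qed.

Lemma zsumC_scal c a n : zsumC (fun k => c * a k)%C n = (c * zsumC a n)%C.
Proof.
  induction n as [|n IH]; [reflexivity|].
  rewrite !zsumC_S, IH. ring.
Qed.

Lemma zsumC_Cmod a n : Cmod (zsumC a n) <= zsum (fun k => Cmod (a k)) n.
Proof.
  induction n as [|n IH]; [simpl; lra|].
  rewrite zsumC_S, zsum_S.
  eapply Rle_trans; [apply Cmod_triangle|].
  apply Rplus_le_compat; [exact IH|apply Cmod_triangle].
Qed.

Definition summ (a : Z -> C) : Prop :=
  exists B, forall n, zsum (fun k => Cmod (a k)) n <= B.

Lemma summ_le a b : (forall k, Cmod (a k) <= Cmod (b k)) -> summ b -> summ a.
Proof.
  intros H [B HB]. exists B. intros n.
  eapply Rle_trans; [apply zsum_le, H|apply HB].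
Qed.

Lemma summ_mult_bounded m a B : (forall k, Cmod (m k) <= B) -> summ a ->
  summ (fun k => m k * a k)%C.
Proof.
  intros Hm [A HA]. exists (B * A). intros n.
  assert (0 <= B) by (eapply Rle_trans; [apply Cmod_ge_0|apply (Hm 0%Z)]).
  eapply Rle_trans;
    [apply (zsum_le _ (fun k => B * Cmod (a k)))|].
  - intros k. rewrite Cmod_mult. apply Rmult_le_compat_r; auto using Cmod_ge_0.
  - rewrite zsum_scal. apply Rmult_le_compat_l; auto.
Qed.

Lemma summ_scal c a : summ a -> summ (fun k => c * a k)%C.
Proof. apply (summ_mult_bounded (fun _ => c) a (Cmod c)). intros; lra. Qed.

Lemma abs_ex_series a b : (forall k, Rabs (a k) <= b k) ->
  ex_series (Zterm b) -> ex_series (Zterm a).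
Proof.
  intros H Hb. apply ex_series_Rabs.
  apply (ex_series_le (V := R_CompleteNormedModule) _ (Zterm b)); [|exact Hb].
  intros [|n].
  - change (Rabs (Rabs (a 0%Z)) <= b 0%Z). rewrite Rabs_Rabsolu. apply H.
  - change (Rabs (Rabs (a (Z.of_nat (S n)) + a (- Z.of_nat (S n))%Z)) <=
      b (Z.of_nat (S n)) + b (- Z.of_nat (S n))%Z).
    rewrite Rabs_Rabsolu.
    eapply Rle_trans; [apply Rabs_triang|].
    apply Rplus_le_compat; apply H.
Qed.

Lemma summ_ex_series a : summ a -> ex_series (Zterm (fun k => Cmod (a k))).
Proof.
  intros [B HB]. apply zsum_ex_series with B; auto. intros; apply Cmod_ge_0.
Qed.

Lemma ZSC_lim a : summ a -> Clim (zsumC a) (ZSeriesC a).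
Proof.
  intros H. apply summ_ex_series in H. split.
  - eapply is_lim_seq_ext; [intros; symmetry; apply re_zsumC|].
    apply zsum_series. eapply abs_ex_series, H. intros; apply re_le_Cmod.
  - eapply is_lim_seq_ext; [intros; symmetry; apply im_zsumC|].
    apply zsum_series. eapply abs_ex_series, H. intros; apply im_le_Cmod.
Qed.

Lemma ZSC_unique a l : Clim (zsumC a) l -> ZSeriesC a = l.
Proof.
  intros [H1 H2]. apply C_eq; simpl; unfold ZSeries.
  - apply is_series_unique.
    apply (is_lim_seq_ext (fun n => Re (zsumC a n)) _ (Re l)); [|exact H1].
    intros n. rewrite re_zsumC. symmetry; apply zsum_Zterm.
  - apply is_series_unique.
    apply (is_lim_seq_ext (fun n => Im (zsumC a n)) _ (Im l)); [|exact H2].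
    intros n. rewrite im_zsumC. symmetry; apply zsum_Zterm.
Qed.

Lemma ZSC_ext a b : (forall k, a k = b k) -> ZSeriesC a = ZSeriesC b.
Proof. intros H. f_equal. now apply functional_extensionality. Qed.

Lemma ZSC_plus a b : summ a -> summ b ->
  ZSeriesC (fun k => a k + b k)%C = (ZSeriesC a + ZSeriesC b)%C.
Proof.
  intros Ha Hb. apply ZSC_unique.
  eapply Clim_ext; [intros; symmetry; apply zsumC_plus|].
  apply Clim_plus; now apply ZSC_lim.
Qed.

Lemma ZSC_scal c a : summ a ->
  ZSeriesC (fun k => c * a k)%C = (c * ZSeriesC a)%C.
Proof.
  intros Ha. apply ZSC_unique.
  eapply Clim_ext; [intros; symmetry; apply zsumC_scal|].
  apply Clim_mult; [apply Clim_const|now apply ZSC_lim].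
Qed.

Lemma ZSC_minus a b : summ a -> summ b ->
  ZSeriesC (fun k => a k - b k)%C = (ZSeriesC a - ZSeriesC b)%C.
Proof.
  intros Ha Hb.
  replace (ZSeriesC a - ZSeriesC b)%C with (ZSeriesC a + (-1) * ZSeriesC b)%C
    by ring.
  rewrite <- ZSC_scal, <- ZSC_plus; auto using summ_scal.
  apply ZSC_ext; intros; ring.
Qed.

Lemma ZSC_bound a B : (forall n, zsum (fun k => Cmod (a k)) n <= B) ->
  Cmod (ZSeriesC a) <= B.
Proof.
  intros H. apply Clim_bound with (zsumC a).
  - apply ZSC_lim. now exists B.
  - intros n. eapply Rle_trans; [apply zsumC_Cmod|apply H].
Qed.

(** The tail of an absolutely convergent series, as a single null sequence
    that dominates every series with smaller terms; this is what uniform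
    convergence of Fourier series rests on. *)
Definition ztail (a : Z -> C) (n : nat) : R :=
  ZSeries (fun k => Cmod (a k)) - zsum (fun k => Cmod (a k)) n.

Lemma ztail_lim a : summ a -> is_lim_seq (ztail a) 0.
Proof.
  intros H. unfold ztail.
  replace (Finite 0) with
    (Finite (ZSeries (fun k => Cmod (a k)) - ZSeries (fun k => Cmod (a k))))
    by (f_equal; ring).
  apply is_lim_seq_minus'; [apply is_lim_seq_const|].
  apply zsum_series, summ_ex_series, H.
Qed.

(** The Cauchy estimate behind [ZSC_tail]. *)
Lemma zsumC_diff_le a b n p : (forall k, Cmod (a k) <= b k) ->
  Cmod (zsumC a (n + p) - zsumC a n) <= zsum b (n + p) - zsum b n.
Proof.
  intros H. induction p as [|p IH].
  - rewrite Nat.add_0_r. replace (_ - _)%C with (RtoC 0) by ring.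
    rewrite Cmod_0. lra.
  - rewrite Nat.add_succ_r, zsumC_S, zsum_S.
    set (x := a (Z.of_nat (S (n + p)))). set (y := a (- Z.of_nat (S (n + p)))%Z).
    replace (zsumC a (n + p) + (x + y) - zsumC a n)%C with
      ((zsumC a (n + p) - zsumC a n) + (x + y))%C by ring.
    eapply Rle_trans; [apply Cmod_triangle|].
    assert (Cmod (x + y) <= b (Z.of_nat (S (n + p))) + b (- Z.of_nat (S (n + p)))%Z).
    { eapply Rle_trans; [apply Cmod_triangle|].
      apply Rplus_le_compat; apply H. }
    lra.
Qed.

Lemma ZSC_tail a b n : (forall k, Cmod (b k) <= Cmod (a k)) -> summ a ->
  Cmod (zsumC b n - ZSeriesC b) <= ztail a n.
Proof.
  intros H Ha.
  apply Clim_bound with (fun p => zsumC b n - zsumC b (n + p)%nat)%C.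
  - apply Clim_minus; [apply Clim_const|].
    destruct (ZSC_lim b (summ_le _ _ H Ha)) as [H1 H2].
    split.
    + apply (is_lim_seq_ext (fun p => Re (zsumC b (p + n)))).
      { intros; now rewrite Nat.add_comm. }
      apply (is_lim_seq_incr_n (fun p => Re (zsumC b p))), H1.
    + apply (is_lim_seq_ext (fun p => Im (zsumC b (p + n)))).
      { intros; now rewrite Nat.add_comm. }
      apply (is_lim_seq_incr_n (fun p => Im (zsumC b p))), H2.
  - intros p.
    replace (zsumC b n - zsumC b (n + p))%C with
      (- (zsumC b (n + p) - zsumC b n))%C by ring.
    rewrite Cmod_opp.
    eapply Rle_trans; [apply zsumC_diff_le with (b := fun k => Cmod (a k)), H|].
    unfold ztail.
    generalize (zsum_le_series (fun k => Cmod (a k)) (n + p)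
      (fun k => Cmod_ge_0 _) (summ_ex_series _ Ha)). lra.
Qed.

Lemma summ_shift a k : summ a -> summ (fun j => a (k - j)%Z).
Proof.
  intros [B HB]. exists B. intros n.
  eapply Rle_trans; [apply (zsum_reflect (fun j => Cmod (a j)))|apply HB].
  intros; apply Cmod_ge_0.
Qed.

(** * Weighted sequence spaces *)

Definition wt (s : R) (k : Z) : R := Rpower (1 + IZR k ^ 2) s.

Lemma one_plus_sq_pos k : 0 < 1 + IZR k ^ 2.
Proof. generalize (pow2_ge_0 (IZR k)); lra. Qed.

Lemma wt_pos s k : 0 < wt s k.
Proof. apply exp_pos. Qed.

Lemma wt_mono s s' k : s <= s' -> wt s k <= wt s' k.
Proof.
  intros H. unfold wt. apply Rle_Rpower; [|exact H].
  generalize (pow2_ge_0 (IZR k)); lra.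
Qed.

Lemma wt_plus s s' k : wt (s + s') k = wt s k * wt s' k.
Proof. apply Rpower_plus. Qed.

Lemma wt_opp s k : wt s (- k) = wt s k.
Proof. unfold wt. rewrite opp_IZR. f_equal. ring. Qed.

(** The larger of the two squares dominates: [1 + (i + m)^2 <= 4 (1 + m^2)] when
    [i^2 <= m^2].  The sum on the right symmetrizes the two cases. *)
Lemma wt_peetre s j l : 0 <= s ->
  wt s (j + l) <= Rpower 4 s * (wt s j + wt s l).
Proof.
  intros Hs.
  assert (H : forall i m, IZR i ^ 2 <= IZR m ^ 2 ->
    wt s (i + m) <= Rpower 4 s * wt s m).
  { intros i m Him. unfold wt.
    rewrite Rpower_mult_distr by (lra || apply one_plus_sq_pos).
    apply Rle_Rpower_l; [exact Hs|split; [apply one_plus_sq_pos|]].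
    rewrite plus_IZR. generalize (pow2_ge_0 (IZR i - IZR m)). lra. }
  assert (H4 : 0 < Rpower 4 s) by apply exp_pos.
  generalize (wt_pos s j), (wt_pos s l); intros Hj Hl.
  destruct (Rle_lt_dec (IZR j ^ 2) (IZR l ^ 2)) as [L | L].
  - specialize (H j l L). nra.
  - specialize (H l j (Rlt_le _ _ L)). rewrite Z.add_comm. nra.
Qed.

(** A discrete integral comparison, by the mean value theorem for [y^(1 - p)]. *)
Lemma Rpower_telescope p x : 1 < p -> 0 < x ->
  Rpower (x + 1) (- p) <=
  / (p - 1) * (Rpower x (1 - p) - Rpower (x + 1) (1 - p)).
Proof.
  intros Hp Hx.
  destruct (MVT_cor2 (fun y => Rpower y (1 - p))
    (fun y => (1 - p) * Rpower y (1 - p - 1)) x (x + 1)) as [c [Hc Hcx]].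
  - lra.
  - intros c Hc. apply derivable_pt_lim_power. lra.
  - replace (1 - p - 1) with (- p) in Hc by ring.
    replace (Rpower x (1 - p) - Rpower (x + 1) (1 - p))
      with ((p - 1) * Rpower c (- p)) by lra.
    rewrite <- Rmult_assoc, Rinv_l, Rmult_1_l by lra.
    rewrite !Rpower_Ropp.
    apply Rinv_le_contravar; [apply exp_pos|].
    apply Rle_Rpower_l; lra.
Qed.

(** This is where [s > 1 / 2] enters: the terms are at most [k ^ (- 2 s)], which
    telescopes against [k ^ (1 - 2 s)]. *)
Lemma wt_inv_bounded s : 1 / 2 < s ->
  exists B, forall n, zsum (fun k => / wt s k) n <= B.
Proof.
  intros Hs. set (p := 2 * s). assert (Hp : 1 < p) by (unfold p; lra).
  assert (Hk : forall k x, x = Rabs (IZR k) -> 0 < x ->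
    / wt s k <= Rpower x (- p)).
  { intros k x -> Hx. rewrite Rpower_Ropp.
    apply Rinv_le_contravar; [apply exp_pos|].
    unfold p, wt.
    rewrite <- Rpower_mult.
    replace (Rpower (Rabs (IZR k)) 2) with (IZR k ^ 2).
    - apply Rle_Rpower_l; [lra|]. rewrite <- pow2_abs. nra.
    - rewrite <- pow2_abs. symmetry.
      replace 2 with (INR 2) at 1 by (simpl; ring). now rewrite Rpower_pow. }
  assert (Hn : forall n, / wt s (Z.of_nat (S n)) <= Rpower (INR (S n)) (- p) /\
                         / wt s (- Z.of_nat (S n)) <= Rpower (INR (S n)) (- p)).
  { intros n. rewrite wt_opp. split; apply Hk;
    try (rewrite <- INR_IZR_INZ, Rabs_pos_eq; auto using pos_INR);
    apply lt_0_INR; lia. }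
  exists (3 + 2 * / (p - 1)).
  assert (Hi : 0 < / (p - 1)) by (apply Rinv_0_lt_compat; lra).
  assert (H : forall n, zsum (fun k => / wt s k) (S n) <=
    3 + 2 * / (p - 1) * (1 - Rpower (INR (S n)) (1 - p))).
  { induction n as [|n IH].
    - rewrite zsum_S. destruct (Hn 0%nat) as [H1 H2].
      assert (E1 : forall y, Rpower (INR 1) y = 1).
      { intros y. simpl. unfold Rpower. rewrite ln_1, Rmult_0_r. apply exp_0. }
      rewrite E1 in *.
      assert (H0 : / wt s 0 = 1).
      { unfold wt, Rpower. replace (1 + IZR 0 ^ 2) with 1 by (simpl; ring).
        rewrite ln_1, Rmult_0_r, exp_0. apply Rinv_1. }
      change (zsum (fun k => / wt s k) 0) with (/ wt s 0). rewrite H0. lra.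
    - rewrite zsum_S. destruct (Hn (S n)) as [H1 H2].
      assert (T := Rpower_telescope p (INR (S n)) Hp (lt_0_INR _ (Nat.lt_0_succ n))).
      rewrite <- S_INR in T. lra. }
  intros n.
  apply Rle_trans with (zsum (fun k => / wt s k) (S n)).
  - rewrite <- Nat.add_1_r. apply zsum_incr.
    intros k. left. apply Rinv_0_lt_compat, wt_pos.
  - eapply Rle_trans; [apply H|].
    assert (0 < Rpower (INR (S n)) (1 - p)) by apply exp_pos. nra.
Qed.

Definition wt_inv_sum (s : R) : R := ZSeries (fun k => / wt s k).

Lemma wt_inv_pos s k : 0 <= / wt s k.
Proof. left. apply Rinv_0_lt_compat, wt_pos. Qed.

Lemma wt_inv_sum_le s n : 1 / 2 < s ->
  zsum (fun k => / wt s k) n <= wt_inv_sum s.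
Proof.
  intros Hs. destruct (wt_inv_bounded s Hs) as [B HB].
  apply zsum_le_series; [apply wt_inv_pos|].
  apply zsum_ex_series with B; [apply wt_inv_pos|exact HB].
Qed.

Lemma wt_inv_sum_pos s : 1 / 2 < s -> 0 <= wt_inv_sum s.
Proof.
  intros Hs. eapply Rle_trans; [|apply (wt_inv_sum_le s 0 Hs)].
  apply (wt_inv_pos s 0).
Qed.

Definition hsq (s : R) (a : Z -> C) (k : Z) : R := wt s k * Cmod (a k) ^ 2.

Lemma hsq_pos s a k : 0 <= hsq s a k.
Proof.
  apply Rmult_le_pos; [left; apply wt_pos|apply pow2_ge_0].
Qed.

(** The norm of the weighted [l^2] space of order [s] is handled through its
    bounds [B].  Bounding every partial sum keeps convergence and the bound in
    one statement, which passes to limits. *)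
Definition hle (s : R) (a : Z -> C) (B : R) : Prop :=
  0 <= B /\ forall n, zsum (hsq s a) n <= B ^ 2.

Lemma hle_le s a B B' : hle s a B -> B <= B' -> hle s a B'.
Proof.
  intros [H0 H] HB. split; [lra|]. intros n.
  eapply Rle_trans; [apply H|]. apply pow_incr; lra.
Qed.

Lemma hle_ext s a b B : (forall k, a k = b k) -> hle s a B -> hle s b B.
Proof.
  intros E [H0 H]; split; [exact H0|]. intros n.
  rewrite (zsum_ext _ (hsq s a)); [apply H|].
  intros k. unfold hsq. now rewrite E.
Qed.

Lemma hle_dom s a b c B : 0 <= c -> (forall k, Cmod (a k) <= c * Cmod (b k)) ->
  hle s b B -> hle s a (c * B).
Proof.
  intros Hc H [H0 HB]; split; [now apply Rmult_le_pos|]. intros n.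
  eapply Rle_trans; [apply (zsum_le _ (fun k => c ^ 2 * hsq s b k))|].
  - intros k. unfold hsq.
    apply Rle_trans with (wt s k * (c * Cmod (b k)) ^ 2).
    + apply Rmult_le_compat_l; [left; apply wt_pos|].
      apply pow_incr. split; [apply Cmod_ge_0|apply H].
    + right; ring.
  - rewrite zsum_scal, Rpow_mult_distr.
    apply Rmult_le_compat_l; [apply pow2_ge_0|apply HB].
Qed.

Lemma hle_zero s a : (forall k, a k = RtoC 0) -> hle s a 0.
Proof.
  intros H. split; [lra|]. intros n.
  rewrite (zsum_ext _ (fun _ => 0)); [rewrite zsum_zero; lra|].
  intros k. unfold hsq. rewrite H, Cmod_0. ring.
Qed.

Lemma hle_scal s a c B : hle s a B -> hle s (fun k => c * a k)%C (Cmod c * B).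
Proof.
  intros H. apply hle_dom with a; auto using Cmod_ge_0.
  intros k. rewrite Cmod_mult. lra.
Qed.

Lemma hle_mult s m a B : (forall k, Cmod (m k) <= 1) -> hle s a B ->
  hle s (fun k => m k * a k)%C B.
Proof.
  intros Hm H. rewrite <- (Rmult_1_l B). apply hle_dom with a; auto; [lra|].
  intros k. rewrite Cmod_mult.
  apply Rmult_le_compat_r; [apply Cmod_ge_0|apply Hm].
Qed.

Lemma hle_weak s s' a B : s <= s' -> hle s' a B -> hle s a B.
Proof.
  intros Hs [H0 H]; split; [exact H0|]. intros n.
  eapply Rle_trans; [apply zsum_le|apply H].
  intros k. apply Rmult_le_compat_r; [apply pow2_ge_0|now apply wt_mono].
Qed.

Lemma hle_opp s a B : hle s a B -> hle s (fun k => a (- k)%Z) B.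
Proof.
  intros [H0 H]; split; [exact H0|]. intros n.
  rewrite <- zsum_opp. rewrite (zsum_ext _ (hsq s a)); [apply H|].
  intros k. unfold hsq. now rewrite wt_opp, Z.opp_involutive.
Qed.

Lemma hsq_sqrt s a k : hsq s a k = (sqrt (wt s k) * Cmod (a k)) ^ 2.
Proof.
  unfold hsq. rewrite Rpow_mult_distr, pow2_sqrt; [reflexivity|].
  left; apply wt_pos.
Qed.

Lemma hle_cauchy_schwarz s a b A B n : hle s a A -> hle s b B ->
  zsum (fun k => wt s k * (Cmod (a k) * Cmod (b k))) n <= A * B.
Proof.
  intros [HA0 HA] [HB0 HB].
  assert (H := zsum_cauchy_schwarz (fun k => sqrt (wt s k) * Cmod (a k))
    (fun k => sqrt (wt s k) * Cmod (b k)) n).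
  rewrite (zsum_ext (fun k => (sqrt (wt s k) * Cmod (a k)) ^ 2) (hsq s a)) in H
    by (intros; symmetry; apply hsq_sqrt).
  rewrite (zsum_ext (fun k => (sqrt (wt s k) * Cmod (b k)) ^ 2) (hsq s b)) in H
    by (intros; symmetry; apply hsq_sqrt).
  rewrite (zsum_ext _ (fun k => wt s k * (Cmod (a k) * Cmod (b k)))) in H.
  - set (S := zsum _ n) in *.
    apply Rnot_lt_le. intros HS.
    assert (H1 : zsum (hsq s a) n * zsum (hsq s b) n <= A ^ 2 * B ^ 2).
    { apply Rmult_le_compat; auto; apply zsum_nonneg, hsq_pos. }
    assert (0 <= A * B) by now apply Rmult_le_pos.
    nra.
  - intros k. rewrite <- (sqrt_sqrt (wt s k)) at 3 by (left; apply wt_pos).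
    ring.
Qed.

Lemma hle_plus s a b A B : hle s a A -> hle s b B ->
  hle s (fun k => a k + b k)%C (A + B).
Proof.
  intros HA HB. split; [destruct HA, HB; lra|]. intros n.
  apply Rle_trans with (zsum (fun k => hsq s a k + (hsq s b k +
    2 * (wt s k * (Cmod (a k) * Cmod (b k))))) n).
  - apply zsum_le. intros k. unfold hsq.
    apply Rle_trans with (wt s k * (Cmod (a k) + Cmod (b k)) ^ 2).
    + apply Rmult_le_compat_l; [left; apply wt_pos|].
      apply pow_incr. split; [apply Cmod_ge_0|apply Cmod_triangle].
    + right; ring.
  - rewrite !zsum_plus, zsum_scal.
    generalize (hle_cauchy_schwarz s a b A B n HA HB).
    destruct HA as [_ HA], HB as [_ HB]. specialize (HA n). specialize (HB n).
    nra.
Qed.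

Lemma hle_minus s a b A B : hle s a A -> hle s b B ->
  hle s (fun k => a k - b k)%C (A + B).
Proof.
  intros HA HB. apply hle_plus; [exact HA|].
  rewrite <- (Rmult_1_l B). apply hle_dom with b; auto; [lra|].
  intros k. rewrite Cmod_opp. lra.
Qed.

Lemma Clim_zsum_hsq s u a m : (forall k, Clim (fun n => u n k) (a k)) ->
  is_lim_seq (fun n => zsum (hsq s (u n)) m) (zsum (hsq s a) m).
Proof.
  intros H.
  assert (Hk : forall k, is_lim_seq (fun n => hsq s (u n) k) (hsq s a k)).
  { intros k. unfold hsq.
    apply is_lim_seq_mult'; [apply is_lim_seq_const|].
    simpl. assert (Hc := Clim_Cmod _ _ (H k)).
    apply is_lim_seq_mult'; [exact Hc|].
    apply is_lim_seq_mult'; [exact Hc|apply is_lim_seq_const]. }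
  induction m as [|m IH].
  - apply Hk.
  - rewrite zsum_S.
    apply is_lim_seq_plus'; [exact IH|].
    apply is_lim_seq_plus'; apply Hk.
Qed.

(** Fatou for weighted norms: only coefficientwise convergence is needed, since
    each partial sum sees finitely many coefficients. *)
Lemma hle_lim s u a (B : nat -> R) (b : R) : (forall n, hle s (u n) (B n)) ->
  is_lim_seq B b -> (forall k, Clim (fun n => u n k) (a k)) -> hle s a b.
Proof.
  intros H HB Hu. split.
  - apply (is_lim_seq_le (fun _ => 0) B 0 b); auto.
    + intros n. apply (H n).
    + apply is_lim_seq_const.
  - intros m.
    apply (is_lim_seq_le (fun n => zsum (hsq s (u n)) m) (fun n => B n ^ 2)
      (zsum (hsq s a) m) (b ^ 2)).
    + intros n. apply (H n).
    + now apply Clim_zsum_hsq.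
    + simpl. apply is_lim_seq_mult'; [exact HB|].
      apply is_lim_seq_mult'; [exact HB|apply is_lim_seq_const].
Qed.

Lemma hle_coef s a B k : 0 <= s -> hle s a B -> Cmod (a k) <= B.
Proof.
  intros Hs [H0 H].
  assert (H1 : hsq s a k <= B ^ 2).
  { eapply Rle_trans; [apply (zsum_term _ k (Z.abs_nat k)); [apply hsq_pos|lia]|].
    apply H. }
  assert (H2 : 1 <= wt s k).
  { unfold wt. rewrite <- (Rpower_O (1 + IZR k ^ 2)) at 1 by apply one_plus_sq_pos.
    apply Rle_Rpower; [generalize (pow2_ge_0 (IZR k)); lra|exact Hs]. }
  unfold hsq in H1.
  assert (Cmod (a k) ^ 2 <= B ^ 2) by (generalize (pow2_ge_0 (Cmod (a k))); nra).
  generalize (Cmod_ge_0 (a k)). nra.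
Qed.

(** The Sobolev embedding on the side of the coefficients: the Fourier series
    converges absolutely. *)
Lemma hle_l1 s a A n : 1 / 2 < s -> hle s a A ->
  zsum (fun k => Cmod (a k)) n <= sqrt (wt_inv_sum s) * A.
Proof.
  intros Hs [HA0 HA].
  assert (H := zsum_cauchy_schwarz (fun k => sqrt (/ wt s k))
    (fun k => sqrt (wt s k) * Cmod (a k)) n).
  rewrite (zsum_ext (fun k => (sqrt (wt s k) * Cmod (a k)) ^ 2) (hsq s a)) in H
    by (intros; symmetry; apply hsq_sqrt).
  rewrite (zsum_ext (fun k => sqrt (/ wt s k) ^ 2) (fun k => / wt s k)) in H
    by (intros; apply pow2_sqrt, wt_inv_pos).
  rewrite (zsum_ext _ (fun k => Cmod (a k))) in H.
  - apply Rnot_lt_le. intros HS.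
    assert (Hq : 0 <= sqrt (wt_inv_sum s)) by apply sqrt_pos.
    assert (H1 : zsum (fun k => / wt s k) n * zsum (hsq s a) n <=
                 sqrt (wt_inv_sum s) ^ 2 * A ^ 2).
    { rewrite pow2_sqrt by now apply wt_inv_sum_pos.
      apply Rmult_le_compat; auto.
      - apply zsum_nonneg, wt_inv_pos.
      - apply zsum_nonneg, hsq_pos.
      - now apply wt_inv_sum_le. }
    assert (0 <= sqrt (wt_inv_sum s) * A) by now apply Rmult_le_pos.
    nra.
  - intros k. rewrite <- Rmult_assoc, <- sqrt_mult.
    + rewrite Rinv_l by apply Rgt_not_eq, wt_pos. rewrite sqrt_1. ring.
    + apply wt_inv_pos.
    + left; apply wt_pos.
Qed.

Lemma hle_summ s a A : 1 / 2 < s -> hle s a A -> summ a.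
Proof. intros Hs H. exists (sqrt (wt_inv_sum s) * A). intros; now apply hle_l1. Qed.

(** * Convolutions *)

Definition conv (a b : Z -> C) (k : Z) : C :=
  ZSeriesC (fun j => a j * b (k - j)%Z)%C.

Definition convK (s : R) : R := sqrt (2 * Rpower 4 s * wt_inv_sum s).

Lemma convK_pos s : 0 <= convK s.
Proof. apply sqrt_pos. Qed.

(** By [wt_peetre] the kernel is at most [4^s (1 / w_j + 1 / w_(k-j)) / w_k], and
    both terms are summable in [j]. *)
Lemma conv_kernel_bound s k n : 1 / 2 < s ->
  wt s k * zsum (fun j => / (wt s j * wt s (k - j))) n <= convK s ^ 2.
Proof.
  intros Hs.
  assert (H4 : 0 < Rpower 4 s) by apply exp_pos.
  unfold convK. rewrite pow2_sqrt.
  2:{ apply Rmult_le_pos; [lra|now apply wt_inv_sum_pos]. }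
  rewrite <- zsum_scal.
  apply Rle_trans with
    (zsum (fun j => Rpower 4 s * (/ wt s (k - j) + / wt s j)) n).
  - apply zsum_le. intros j.
    assert (P := wt_peetre s j (k - j)).
    replace (j + (k - j))%Z with k in P by lia.
    generalize (wt_pos s j), (wt_pos s (k - j)); intros Hj Hkj.
    replace (/ wt s (k - j) + / wt s j) with
      ((wt s j + wt s (k - j)) * / (wt s j * wt s (k - j))) by (field; lra).
    rewrite <- Rmult_assoc.
    apply Rmult_le_compat_r; [|apply P; lra].
    left. apply Rinv_0_lt_compat. now apply Rmult_lt_0_compat.
  - rewrite zsum_scal, zsum_plus.
    assert (zsum (fun j => / wt s (k - j)) n <= wt_inv_sum s).
    { eapply Rle_trans; [apply (zsum_reflect (fun i => / wt s i))|].
      - apply wt_inv_pos.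
      - now apply wt_inv_sum_le. }
    assert (H0 := wt_inv_sum_le s n Hs).
    rewrite (Rmult_comm 2), Rmult_assoc.
    apply Rmult_le_compat_l; lra.
Qed.

(** By Cauchy-Schwarz against the kernel [1 / (w_j w_(k-j))], whose sum is
    [O(1 / w_k)], a convolution is controlled by the convolution of the two
    sequences of weighted squares, and that one has mass at most the product
    of the masses.  The terms [t k j] are only assumed to be dominated, so
    that oscillating factors may depend on both indices. *)
Lemma conv_dominated s c (t : Z -> Z -> C) a b A B : 1 / 2 < s ->
  (forall k, c k = ZSeriesC (t k)) ->
  (forall k j, Cmod (t k j) <= Cmod (a j) * Cmod (b (k - j)%Z)) ->
  hle s a A -> hle s b B -> hle s c (convK s * (A * B)).
Proof.
  intros Hs Hc Ht HA HB.
  assert (Hsum : forall k, summ (t k)).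
  { intros k.
    apply summ_le with (fun j => b (k - j)%Z * a j)%C.
    - intros j. rewrite Cmod_mult, Rmult_comm. apply Ht.
    - apply summ_mult_bounded with B.
      + intros j. apply hle_coef with s; auto. lra.
      + eapply hle_summ; eauto. }
  apply (hle_lim s (fun n k => zsumC (t k) n) c
    (fun _ => convK s * (A * B)) (convK s * (A * B))).
  2: apply is_lim_seq_const.
  2:{ intros k. rewrite Hc. apply ZSC_lim, Hsum. }
  intros n. destruct HA as [HA0 HA], HB as [HB0 HB].
  split; [apply Rmult_le_pos; [apply convK_pos|now apply Rmult_le_pos]|].
  intros m.
  apply Rle_trans with (zsum (fun k => convK s ^ 2 *
    zsum (fun j => hsq s a j * hsq s b (k - j)) n) m).
  - apply zsum_le. intros k. unfold hsq at 1.
    set (T := zsum (fun j => hsq s a j * hsq s b (k - j)) n).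
    assert (HT : 0 <= T).
    { apply zsum_nonneg. intros; apply Rmult_le_pos; apply hsq_pos. }
    set (x := fun j => sqrt (/ (wt s j * wt s (k - j)))).
    set (y := fun j => sqrt (wt s j) * Cmod (a j) *
                       (sqrt (wt s (k - j)) * Cmod (b (k - j)%Z))).
    assert (CS := zsum_cauchy_schwarz x y n).
    rewrite (zsum_ext (fun j => y j ^ 2)
      (fun j => hsq s a j * hsq s b (k - j))) in CS.
    2:{ intros j. unfold y. rewrite Rpow_mult_distr, <- !hsq_sqrt. reflexivity. }
    rewrite (zsum_ext (fun j => x j ^ 2)
      (fun j => / (wt s j * wt s (k - j)))) in CS.
    2:{ intros j. apply pow2_sqrt. left.
        apply Rinv_0_lt_compat, Rmult_lt_0_compat; apply wt_pos. }
    assert (H1 : Cmod (zsumC (t k) n) <= zsum (fun j => x j * y j) n).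
    { eapply Rle_trans; [apply zsumC_Cmod|]. apply zsum_le. intros j.
      eapply Rle_trans; [apply Ht|]. right. unfold x, y.
      generalize (wt_pos s j), (wt_pos s (k - j)); intros Hj Hkj.
      rewrite sqrt_inv, sqrt_mult by lra.
      field. split; apply Rgt_not_eq, sqrt_lt_R0; assumption. }
    apply Rle_trans with (wt s k * zsum (fun j => x j * y j) n ^ 2).
    { apply Rmult_le_compat_l; [left; apply wt_pos|].
      apply pow_incr. split; [apply Cmod_ge_0|exact H1]. }
    apply Rle_trans with
      (wt s k * (zsum (fun j => / (wt s j * wt s (k - j))) n * T)).
    { apply Rmult_le_compat_l; [left; apply wt_pos|exact CS]. }
    rewrite <- Rmult_assoc.
    apply Rmult_le_compat_r; [exact HT|now apply conv_kernel_bound].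
  - rewrite zsum_scal, !Rpow_mult_distr.
    apply Rmult_le_compat_l; [apply pow2_ge_0|].
    rewrite zsum_swap.
    apply Rle_trans with (zsum (fun j => B ^ 2 * hsq s a j) n).
    + apply zsum_le. intros j. rewrite zsum_scal, Rmult_comm.
      apply Rmult_le_compat_r; [apply hsq_pos|].
      eapply Rle_trans; [apply (zsum_shift (hsq s b) (- j) m), hsq_pos|apply HB].
    + rewrite zsum_scal, Rmult_comm.
      apply Rmult_le_compat_r; [apply pow2_ge_0|apply HA].
Qed.

Lemma hle_conv s a b A B : 1 / 2 < s -> hle s a A -> hle s b B ->
  hle s (conv a b) (convK s * (A * B)).
Proof.
  intros Hs HA HB.
  apply conv_dominated with (t := fun k j => (a j * b (k - j)%Z)%C) (a := a) (b := b);
    auto.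
  intros. rewrite Cmod_mult. lra.
Qed.

Lemma summ_conv_term s a b A B k : 1 / 2 < s -> hle s a A -> hle s b B ->
  summ (fun j => a j * b (k - j)%Z)%C.
Proof.
  intros Hs HA HB. apply summ_mult_bounded with A.
  - intros j. apply hle_coef with s; auto. lra.
  - apply summ_shift. eapply hle_summ; eauto.
Qed.

Lemma conv_minus_l s a a' b A A' B k : 1 / 2 < s ->
  hle s a A -> hle s a' A' -> hle s b B ->
  (conv a b k - conv a' b k)%C = conv (fun j => a j - a' j)%C b k.
Proof.
  intros Hs HA HA' HB. unfold conv. rewrite <- ZSC_minus.
  - apply ZSC_ext; intros; ring.
  - eapply summ_conv_term; eauto.
  - eapply summ_conv_term; eauto.
Qed.

Lemma conv_minus_r s a b b' A B B' k : 1 / 2 < s ->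
  hle s a A -> hle s b B -> hle s b' B' ->
  (conv a b k - conv a b' k)%C = conv a (fun j => b j - b' j)%C k.
Proof.
  intros Hs HA HB HB'. unfold conv. rewrite <- ZSC_minus.
  - apply ZSC_ext; intros; ring.
  - eapply summ_conv_term; eauto.
  - eapply summ_conv_term; eauto.
Qed.

(** [a b - a' b' = (a - a') b + a' (b - b')] for convolutions. *)
Lemma hle_conv_diff s a a' b b' A B dA dB : 1 / 2 < s ->
  hle s a A -> hle s a' A -> hle s b B -> hle s b' B ->
  hle s (fun k => a k - a' k)%C dA -> hle s (fun k => b k - b' k)%C dB ->
  hle s (fun k => conv a b k - conv a' b' k)%C (convK s * (dA * B + A * dB)).
Proof.
  intros Hs HA HA' HB HB' HdA HdB.
  apply hle_ext with (fun k =>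
    conv (fun j => a j - a' j)%C b k + conv a' (fun j => b j - b' j)%C k)%C.
  - intros k.
    rewrite <- (conv_minus_l s a a' b A A B k), <- (conv_minus_r s a' b b' A B B k);
      auto. ring.
  - rewrite Rmult_plus_distr_l. apply hle_plus; now apply hle_conv.
Qed.

Lemma conv_ext a a' b b' k : (forall j, a j = a' j) -> (forall j, b j = b' j) ->
  conv a b k = conv a' b' k.
Proof. intros Ha Hb. apply ZSC_ext. intros j. now rewrite Ha, Hb. Qed.

Definition nrm (s : R) (a : Z -> C) : R := sqrt (ZSeries (hsq s a)).

Lemma hle_ex_series s a B : hle s a B -> ex_series (Zterm (hsq s a)).
Proof.
  intros [_ H]. apply zsum_ex_series with (B ^ 2); [apply hsq_pos|exact H].
Qed.

Lemma hle_of_ex_series s a : ex_series (Zterm (hsq s a)) -> hle s a (nrm s a).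
Proof.
  intros H. split; [apply sqrt_pos|]. intros n. unfold nrm.
  assert (H1 := zsum_le_series (hsq s a) n (hsq_pos s a) H).
  rewrite pow2_sqrt; [exact H1|].
  eapply Rle_trans; [apply zsum_nonneg, hsq_pos|exact H1].
Qed.

Lemma hle_nrm s a B : hle s a B -> hle s a (nrm s a).
Proof. intros H. eapply hle_of_ex_series, hle_ex_series, H. Qed.

Lemma nrm_le s a B : hle s a B -> nrm s a <= B.
Proof.
  intros [H0 H]. unfold nrm. rewrite <- (sqrt_pow2 B) by exact H0.
  apply sqrt_le_1_alt, ZSeries_le_bound; [apply hsq_pos|exact H].
Qed.

(** * Integration and Fourier coefficients on the torus *)

Definition ccont (f : R -> C) : Prop :=
  (forall x, continuous (fun y => Re (f y)) x) /\
  (forall x, continuous (fun y => Im (f y)) x).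

Lemma ccont_iff f :
  (forall x, continuous (U := C_UniformSpace) f x) <-> ccont f.
Proof.
  split.
  - intros H; split; intros x.
    + apply (continuous_comp f (fun z : C => fst z)); [apply H|].
      apply continuous_fst.
    + apply (continuous_comp f (fun z : C => snd z)); [apply H|].
      apply continuous_snd.
  - intros [H1 H2] x.
    apply filterlim_ext with (fun y => (Re (f y), Im (f y)));
      [intros y; now destruct (f y)|].
    apply (filterlim_filter_le_2 (G := filter_prod (locally (Re (f x))) (locally (Im (f x))))).
    + intros P [eps HP]. destruct eps as [e He].
      exists (fun u => ball (Re (f x)) e u) (fun v => ball (Im (f x)) e v).
      * exists (mkposreal e He). auto.
      * exists (mkposreal e He). auto.
      * intros u v Hu Hv. apply HP. split; assumption.
    + apply filterlim_pair; [apply H1|apply H2].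
Qed.

Lemma ccont_ext f g : (forall x, f x = g x) -> ccont f -> ccont g.
Proof. intros H. replace g with f; auto. now apply functional_extensionality. Qed.

Lemma ccont_const c : ccont (fun _ => c).
Proof. split; intros; apply continuous_const. Qed.

Lemma ccont_plus f g : ccont f -> ccont g -> ccont (fun x => f x + g x)%C.
Proof.
  intros [H1 H2] [H3 H4]; split; intros x.
  - apply (continuous_plus (fun y => Re (f y)) (fun y => Re (g y))); auto.
  - apply (continuous_plus (fun y => Im (f y)) (fun y => Im (g y))); auto.
Qed.

Lemma ccont_mult f g : ccont f -> ccont g -> ccont (fun x => f x * g x)%C.
Proof.
  intros [H1 H2] [H3 H4]; split; intros x.
  - apply (continuous_minus (fun y => Re (f y) * Re (g y))
      (fun y => Im (f y) * Im (g y))).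
    + apply (continuous_mult (fun y => Re (f y)) (fun y => Re (g y))); auto.
    + apply (continuous_mult (fun y => Im (f y)) (fun y => Im (g y))); auto.
  - apply (continuous_plus (fun y => Re (f y) * Im (g y))
      (fun y => Im (f y) * Re (g y))).
    + apply (continuous_mult (fun y => Re (f y)) (fun y => Im (g y))); auto.
    + apply (continuous_mult (fun y => Im (f y)) (fun y => Re (g y))); auto.
Qed.

Lemma ccont_conj f : ccont f -> ccont (fun x => Cconj (f x)).
Proof.
  intros [H1 H2]; split; intros x; [apply H1|].
  apply (continuous_opp (fun y => Im (f y))); auto.
Qed.

Lemma ccont_scal c f : ccont f -> ccont (fun x => c * f x)%C.
Proof. apply ccont_mult, ccont_const. Qed.

Lemma ccont_minus f g : ccont f -> ccont g -> ccont (fun x => f x - g x)%C.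
Proof.
  intros Hf Hg. apply ccont_ext with (fun x => f x + (-1) * g x)%C.
  - intros; ring.
  - apply ccont_plus; auto. now apply ccont_scal.
Qed.

Definition cis (t : R) : C := (cos t, sin t).

Lemma Cexp_Ci t : Cexp (Ci * RtoC t) = cis t.
Proof.
  unfold Cexp, cis. rewrite re_scal_r, im_scal_r. simpl.
  rewrite Rmult_0_l, exp_0, !Rmult_1_l. reflexivity.
Qed.

Lemma Cexp_Ci_opp t : Cexp (- (Ci * RtoC t)) = cis (- t).
Proof.
  replace (- (Ci * RtoC t))%C with (Ci * RtoC (- t))%C.
  - apply Cexp_Ci.
  - rewrite RtoC_opp. ring.
Qed.

Lemma cis_plus a b : cis (a + b) = (cis a * cis b)%C.
Proof.
  unfold cis, Cmult; simpl. rewrite cos_plus, sin_plus. f_equal; ring.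
Qed.

Lemma Cmod_cis t : Cmod (cis t) = 1.
Proof.
  unfold Cmod, cis; simpl. rewrite !Rmult_1_r.
  generalize (sin2_cos2 t). unfold Rsqr. intros H.
  rewrite Rplus_comm, H. apply sqrt_1.
Qed.

Lemma cis_0 : cis 0 = RtoC 1.
Proof. unfold cis. rewrite cos_0, sin_0. reflexivity. Qed.

Lemma cis_conj t : Cconj (cis t) = cis (- t).
Proof. unfold cis, Cconj; simpl. now rewrite cos_neg, sin_neg. Qed.

Lemma ccont_cis a : ccont (fun x => cis (a * x)).
Proof.
  split; intros x; simpl.
  - apply (continuous_comp (fun y => a * y) cos); [|apply continuous_cos].
    apply (continuous_mult (fun _ => a) (fun y => y));
      [apply continuous_const|apply continuous_id].
  - apply (continuous_comp (fun y => a * y) sin); [|apply continuous_sin].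
    apply (continuous_mult (fun _ => a) (fun y => y));
      [apply continuous_const|apply continuous_id].
Qed.

Lemma twopi_pos : 0 < 2 * PI.
Proof. generalize PI_RGT_0; lra. Qed.

Lemma tint_pair f : ccont f -> torus_int f =
  (RInt (fun x => Re (f x)) 0 (2 * PI), RInt (fun x => Im (f x)) 0 (2 * PI)).
Proof.
  intros [H1 H2]. unfold torus_int.
  apply (is_RInt_unique (V := C_R_CompleteNormedModule)).
  apply (is_RInt_fct_extend_pair (U := R_NormedModule) (V := R_NormedModule)).
  - apply (RInt_correct (V := R_CompleteNormedModule)).
    apply (ex_RInt_continuous (V := R_CompleteNormedModule)).
    intros x _. apply H1.
  - apply (RInt_correct (V := R_CompleteNormedModule)).
    apply (ex_RInt_continuous (V := R_CompleteNormedModule)).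
    intros x _. apply H2.
Qed.

Lemma ex_RInt_cont (f : R -> R) a b : (forall x, continuous f x) -> ex_RInt f a b.
Proof.
  intros H. apply (ex_RInt_continuous (V := R_CompleteNormedModule)). auto.
Qed.

Lemma tint_ext f g : (forall x, f x = g x) -> torus_int f = torus_int g.
Proof. intros H. f_equal. now apply functional_extensionality. Qed.

Lemma tint_plus f g : ccont f -> ccont g ->
  torus_int (fun x => f x + g x)%C = (torus_int f + torus_int g)%C.
Proof.
  intros Hf Hg. rewrite !tint_pair by auto using ccont_plus.
  destruct Hf as [H1 H2], Hg as [H3 H4].
  apply C_eq; simpl.
  - apply (RInt_plus (V := R_CompleteNormedModule) (fun x => Re (f x))
      (fun x => Re (g x))); now apply ex_RInt_cont.
  - apply (RInt_plus (V := R_CompleteNormedModule) (fun x => Im (f x))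
      (fun x => Im (g x))); now apply ex_RInt_cont.
Qed.

Lemma RInt_lin (f g : R -> R) a b u v : (forall x, continuous f x) ->
  (forall x, continuous g x) ->
  RInt (fun x => u * f x + v * g x) a b = u * RInt f a b + v * RInt g a b.
Proof.
  intros Hf Hg. apply is_RInt_unique.
  apply (is_RInt_plus (V := R_NormedModule) (fun x => u * f x) (fun x => v * g x)).
  - apply (is_RInt_scal (V := R_NormedModule) f).
    apply (RInt_correct (V := R_CompleteNormedModule)), ex_RInt_cont, Hf.
  - apply (is_RInt_scal (V := R_NormedModule) g).
    apply (RInt_correct (V := R_CompleteNormedModule)), ex_RInt_cont, Hg.
Qed.

Lemma tint_scal c f : ccont f ->
  torus_int (fun x => c * f x)%C = (c * torus_int f)%C.
Proof.
  intros Hf. rewrite !tint_pair by auto using ccont_scal.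
  destruct Hf as [H1 H2]. apply C_eq.
  - rewrite re_mult. simpl.
    transitivity (RInt (fun x => Re c * Re (f x) + (- Im c) * Im (f x)) 0 (2 * PI)).
    + apply RInt_ext. intros; unfold Re, Im; simpl. ring.
    + rewrite RInt_lin by auto. unfold Re, Im; simpl; ring.
  - rewrite im_mult. simpl.
    transitivity (RInt (fun x => Im c * Re (f x) + Re c * Im (f x)) 0 (2 * PI)).
    + apply RInt_ext. intros; unfold Re, Im; simpl. ring.
    + rewrite RInt_lin by auto. unfold Re, Im; simpl; ring.
Qed.

Lemma tint_conj f : ccont f ->
  torus_int (fun x => Cconj (f x)) = Cconj (torus_int f).
Proof.
  intros Hf. rewrite !tint_pair by auto using ccont_conj.
  destruct Hf as [H1 H2]. apply C_eq; [reflexivity|].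
  simpl. apply (RInt_opp (V := R_CompleteNormedModule)).
  now apply ex_RInt_cont.
Qed.

Lemma RInt_abs_bound (f : R -> R) B : (forall x, continuous f x) ->
  (forall x, Rabs (f x) <= B) -> Rabs (RInt f 0 (2 * PI)) <= 2 * PI * B.
Proof.
  intros Hf HB. assert (Hp := twopi_pos).
  eapply Rle_trans; [apply abs_RInt_le_const with (M := B)|].
  - lra.
  - now apply ex_RInt_cont.
  - intros; apply HB.
  - lra.
Qed.

Lemma tint_bound f B : ccont f -> (forall x, Cmod (f x) <= B) ->
  Cmod (torus_int f) <= 4 * PI * B.
Proof.
  intros Hf HB. rewrite tint_pair by auto. destruct Hf as [H1 H2].
  eapply Rle_trans; [apply Cmod_le_abs|]. simpl.
  assert (Rabs (RInt (fun x => Re (f x)) 0 (2 * PI)) <= 2 * PI * B).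
  { apply RInt_abs_bound; auto. intros x.
    eapply Rle_trans; [apply re_le_Cmod|apply HB]. }
  assert (Rabs (RInt (fun x => Im (f x)) 0 (2 * PI)) <= 2 * PI * B).
  { apply RInt_abs_bound; auto. intros x.
    eapply Rle_trans; [apply im_le_Cmod|apply HB]. }
  lra.
Qed.

Lemma sin_2kPI k : sin (IZR k * (2 * PI)) = 0.
Proof.
  apply sin_eq_0_1. exists (2 * k)%Z. rewrite mult_IZR. ring.
Qed.

Lemma cos_2kPI k : cos (IZR k * (2 * PI)) = 1.
Proof.
  replace (IZR k * (2 * PI)) with (2 * (IZR k * PI)) by ring.
  rewrite cos_2a_sin.
  replace (sin (IZR k * PI)) with 0; [ring|].
  symmetry. apply sin_eq_0_1. now exists k.
Qed.

Lemma cis_period k x : cis (IZR k * (x + 2 * PI)) = cis (IZR k * x).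
Proof.
  rewrite Rmult_plus_distr_l, cis_plus.
  unfold cis at 2. rewrite cos_2kPI, sin_2kPI.
  change (1, 0) with (RtoC 1). ring.
Qed.

Lemma tint_cis k : k <> 0%Z -> torus_int (fun x => cis (IZR k * x)) = RtoC 0.
Proof.
  intros Hk. assert (Hk' : IZR k <> 0) by now apply not_0_IZR.
  rewrite tint_pair by apply ccont_cis.
  apply C_eq; simpl; apply is_RInt_unique.
  - replace 0 with (minus (sin (IZR k * (2 * PI)) / IZR k) (sin (IZR k * 0) / IZR k)) at 2.
    + apply (is_RInt_derive (V := R_CompleteNormedModule) (fun x => sin (IZR k * x) / IZR k)).
      * intros x _. auto_derive; [exact I|]. field. exact Hk'.
      * intros x _. apply (proj1 (ccont_cis (IZR k))).
    + rewrite sin_2kPI, Rmult_0_r, sin_0. unfold minus, plus, opp; simpl.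
      field. exact Hk'.
  - replace 0 with (minus (- cos (IZR k * (2 * PI)) / IZR k) (- cos (IZR k * 0) / IZR k)) at 2.
    + apply (is_RInt_derive (V := R_CompleteNormedModule) (fun x => - cos (IZR k * x) / IZR k)).
      * intros x _. auto_derive; [exact I|]. field. exact Hk'.
      * intros x _. apply (proj2 (ccont_cis (IZR k))).
    + rewrite cos_2kPI, Rmult_0_r, cos_0. unfold minus, plus, opp; simpl.
      field. exact Hk'.
Qed.

Lemma fcoef_cis f k : fcoef f k =
  (/ RtoC (2 * PI) * torus_int (fun x => f x * cis (- IZR k * x)))%C.
Proof.
  unfold fcoef. f_equal. apply tint_ext. intros x.
  rewrite Cexp_Ci_opp. do 2 f_equal. ring.
Qed.

Lemma RtoC_twopi_neq : RtoC (2 * PI) <> RtoC 0.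
Proof. intros H. apply RtoC_inj in H. generalize twopi_pos. lra. Qed.

Lemma fcoef_ext f g k : (forall x, f x = g x) -> fcoef f k = fcoef g k.
Proof. intros H. f_equal. now apply functional_extensionality. Qed.

Lemma fcoef_plus f g k : ccont f -> ccont g ->
  fcoef (fun x => f x + g x)%C k = (fcoef f k + fcoef g k)%C.
Proof.
  intros Hf Hg. rewrite !fcoef_cis, <- Cmult_plus_distr_l, <- tint_plus;
    try (apply ccont_mult; auto; apply ccont_cis).
  f_equal. apply tint_ext. intros; ring.
Qed.

Lemma fcoef_scal c f k : ccont f ->
  fcoef (fun x => c * f x)%C k = (c * fcoef f k)%C.
Proof.
  intros Hf. rewrite !fcoef_cis.
  rewrite (tint_ext _ (fun x => c * (f x * cis (- IZR k * x)))%C)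
    by (intros; ring).
  rewrite tint_scal by (apply ccont_mult; auto; apply ccont_cis). ring.
Qed.

Lemma fcoef_minus f g k : ccont f -> ccont g ->
  fcoef (fun x => f x - g x)%C k = (fcoef f k - fcoef g k)%C.
Proof.
  intros Hf Hg.
  rewrite (fcoef_ext _ (fun x => f x + (-1) * g x)%C) by (intros; ring).
  rewrite fcoef_plus, fcoef_scal; auto using ccont_scal. ring.
Qed.

Lemma fcoef_conj f k : ccont f -> fcoef (fconj f) k = Cconj (fcoef f (- k)).
Proof.
  intros Hf. rewrite !fcoef_cis, Cmult_conj, Cinv_conj by apply RtoC_twopi_neq.
  rewrite <- tint_conj by (apply ccont_mult; auto; apply ccont_cis).
  f_equal.
  - f_equal. apply C_eq; simpl; ring.
  - apply tint_ext. intros x. rewrite Cmult_conj, cis_conj, opp_IZR.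
    unfold fconj. do 2 f_equal. ring.
Qed.

Lemma fcoef_bound f k B : ccont f -> (forall x, Cmod (f x) <= B) ->
  Cmod (fcoef f k) <= 2 * B.
Proof.
  intros Hf HB. rewrite fcoef_cis, Cmod_mult, Cmod_inv by apply RtoC_twopi_neq.
  rewrite Cmod_R, Rabs_pos_eq by (generalize twopi_pos; lra).
  assert (H : Cmod (torus_int (fun x => f x * cis (- IZR k * x))%C) <= 4 * PI * B).
  { apply tint_bound.
    - apply ccont_mult; auto; apply ccont_cis.
    - intros x. rewrite Cmod_mult, Cmod_cis, Rmult_1_r. apply HB. }
  assert (Hp := PI_RGT_0).
  replace (2 * B) with (/ (2 * PI) * (4 * PI * B)) by (field; lra).
  apply Rmult_le_compat_l; [|exact H].
  left. apply Rinv_0_lt_compat, twopi_pos.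
Qed.

Lemma fcoef_lim f u e k : ccont f -> (forall n, ccont (u n)) ->
  (forall n x, Cmod (u n x - f x) <= e n) -> is_lim_seq e 0 ->
  Clim (fun n => fcoef (u n) k) (fcoef f k).
Proof.
  intros Hf Hu H He.
  apply Clim_squeeze with (fun n => 2 * e n).
  - intros n. rewrite <- fcoef_minus by auto.
    apply fcoef_bound; [now apply ccont_minus|apply H].
  - replace (Finite 0) with (Finite (2 * 0)) by (f_equal; ring).
    apply is_lim_seq_mult'; [apply is_lim_seq_const|exact He].
Qed.

Lemma fcoef_shift c f j k : ccont f ->
  fcoef (fun x => c * cis (IZR j * x) * f x)%C k = (c * fcoef f (k - j))%C.
Proof.
  intros Hf.
  rewrite (fcoef_ext _ (fun x => c * (cis (IZR j * x) * f x))%C)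
    by (intros; ring).
  rewrite fcoef_scal by (apply ccont_mult; auto; apply ccont_cis).
  f_equal. rewrite !fcoef_cis. f_equal. apply tint_ext. intros x.
  rewrite (Cmult_comm (cis _)), <- Cmult_assoc, <- cis_plus, minus_IZR.
  do 2 f_equal. ring.
Qed.

Lemma fcoef_one k : fcoef (fun _ => RtoC 1) k = if Z.eq_dec k 0 then RtoC 1 else RtoC 0.
Proof.
  rewrite fcoef_cis.
  rewrite (tint_ext _ (fun x => cis (IZR (- k) * x)))
    by (intros; rewrite opp_IZR; ring).
  destruct (Z.eq_dec k 0) as [->|Hk].
  - rewrite (tint_ext _ (fun x => RtoC 1)).
    + rewrite tint_pair by apply ccont_const.
      replace (RInt (fun x => Re (RtoC 1)) 0 (2 * PI),
               RInt (fun x => Im (RtoC 1)) 0 (2 * PI)) with (RtoC (2 * PI)).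
      * apply Cinv_l, RtoC_twopi_neq.
      * rewrite !RInt_const. unfold scal; simpl; unfold mult; simpl.
        unfold RtoC. f_equal; ring.
    + intros x. simpl. rewrite Rmult_0_l. apply cis_0.
  - rewrite tint_cis by lia. ring.
Qed.

(** * Fourier series *)

Definition synth (c : Z -> C) (x : R) : C :=
  ZSeriesC (fun k => c k * cis (IZR k * x))%C.

(** Three-epsilon argument, with the error bound given as a null sequence. *)
Lemma unif_lim_continuous (f : R -> R) u e :
  (forall n x, continuous (u n : R -> R) x) ->
  (forall n x, Rabs (u n x - f x) <= e n) -> is_lim_seq e 0 ->
  forall x, continuous f x.
Proof.
  intros Hu H He x.
  apply filterlim_locally. intros [eps Heps].
  assert (He3 : 0 < eps / 3) by lra.
  apply is_lim_seq_spec in He. destruct (He (mkposreal _ He3)) as [N HN].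
  specialize (HN N (Nat.le_refl _)). simpl in HN.
  assert (Hc := Hu N x). unfold continuous in Hc.
  rewrite filterlim_locally in Hc. specialize (Hc (mkposreal _ He3)).
  revert Hc. apply filter_imp. intros y Hy.
  unfold ball, AbsRing_ball, abs, minus, plus, opp in *; simpl in *.
  unfold AbsRing_ball, abs, minus, plus, opp in *; simpl in *.
  assert (H1 := H N x). assert (H2 := H N y).
  rewrite Rminus_0_r in HN. generalize (Rle_abs (e N)).
  replace (f y + - f x) with ((u N y + - u N x) + (u N x - f x) - (u N y - f y)) by ring.
  intros. apply Rabs_def2 in Hy.
  apply Rabs_le_between in H1. apply Rabs_le_between in H2.
  apply Rabs_def1; lra.
Qed.

Lemma synth_term_Cmod c x k : Cmod (c k * cis (IZR k * x)) <= Cmod (c k).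
Proof. rewrite Cmod_mult, Cmod_cis. lra. Qed.

Lemma synth_approx c n x : summ c ->
  Cmod (zsumC (fun k => c k * cis (IZR k * x))%C n - synth c x) <= ztail c n.
Proof. intros H. apply ZSC_tail; auto. intros; apply synth_term_Cmod. Qed.

Lemma ccont_trig c n : ccont (fun x => zsumC (fun k => c k * cis (IZR k * x))%C n).
Proof.
  induction n as [|n IH].
  - apply (ccont_scal (c 0%Z)), ccont_cis.
  - apply ccont_plus; [exact IH|].
    apply ccont_plus; apply ccont_scal, ccont_cis.
Qed.

Lemma ccont_synth c : summ c -> ccont (synth c).
Proof.
  intros H. assert (HT := ztail_lim c H). split.
  - apply unif_lim_continuous with
      (u := fun n x => Re (zsumC (fun k => c k * cis (IZR k * x))%C n)) (e := ztail c); auto.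
    + intros n. apply (proj1 (ccont_trig c n)).
    + intros n x. rewrite <- re_minus.
      eapply Rle_trans; [apply re_le_Cmod|now apply synth_approx].
  - apply unif_lim_continuous with
      (u := fun n x => Im (zsumC (fun k => c k * cis (IZR k * x))%C n)) (e := ztail c); auto.
    + intros n. apply (proj2 (ccont_trig c n)).
    + intros n x. rewrite <- im_minus.
      eapply Rle_trans; [apply im_le_Cmod|now apply synth_approx].
Qed.

Lemma synth_periodic c : periodic (synth c).
Proof. intros x. apply ZSC_ext. intros k. now rewrite cis_period. Qed.

Lemma synth_bounded c : summ c -> exists B, forall x, Cmod (synth c x) <= B.
Proof.
  intros [B HB]. exists B. intros x. apply ZSC_bound. intros n.
  eapply Rle_trans; [apply zsum_le; intros; apply synth_term_Cmod|apply HB].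
Qed.

Lemma fcoef_trig_mult c g n k : ccont g ->
  fcoef (fun x => zsumC (fun j => c j * cis (IZR j * x)) n * g x)%C k =
  zsumC (fun j => c j * fcoef g (k - j))%C n.
Proof.
  intros Hg. induction n as [|n IH].
  - apply fcoef_shift, Hg.
  - rewrite zsumC_S, <- IH, <- !fcoef_shift by exact Hg.
    rewrite <- !fcoef_plus.
    + apply fcoef_ext. intros x. rewrite zsumC_S. ring.
    + apply ccont_mult; auto. apply ccont_trig.
    + apply ccont_plus; apply ccont_mult; auto; apply ccont_scal, ccont_cis.
    + apply ccont_mult; auto. apply ccont_scal, ccont_cis.
    + apply ccont_mult; auto. apply ccont_scal, ccont_cis.
Qed.

(** Expanding one factor only: [synth c] is a uniform limit of trigonometric sums, and
    multiplication of [g] by a mode just shifts its coefficients. *)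
Lemma fcoef_synth_mult c g B k : summ c -> ccont g ->
  (forall x, Cmod (g x) <= B) ->
  fcoef (fun x => synth c x * g x)%C k = ZSeriesC (fun j => c j * fcoef g (k - j))%C.
Proof.
  intros Hc Hg HB.
  assert (HB0 : 0 <= B) by (eapply Rle_trans; [apply Cmod_ge_0|apply (HB 0)]).
  apply Clim_unique with (zsumC (fun j => c j * fcoef g (k - j))%C).
  - eapply Clim_ext; [intros n; apply (fcoef_trig_mult c g n k Hg)|].
    apply fcoef_lim with (fun n => ztail c n * B).
    + apply ccont_mult; auto using ccont_synth.
    + intros n. apply ccont_mult; auto using ccont_trig.
    + intros n x.
      replace (zsumC (fun j => c j * cis (IZR j * x)) n * g x - synth c x * g x)%C
        with ((zsumC (fun j => c j * cis (IZR j * x)) n - synth c x) * g x)%C by ring.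
      rewrite Cmod_mult.
      apply Rmult_le_compat; auto using Cmod_ge_0. now apply synth_approx.
    + replace (Finite 0) with (Finite (0 * B)) by (f_equal; ring).
      apply is_lim_seq_mult'; [now apply ztail_lim|apply is_lim_seq_const].
  - apply ZSC_lim.
    apply summ_le with (fun j => RtoC (2 * B) * c j)%C; [|now apply summ_scal].
    intros j. rewrite !Cmod_mult, Cmod_R, Rabs_pos_eq, Rmult_comm by lra.
    apply Rmult_le_compat_r; [apply Cmod_ge_0|now apply fcoef_bound].
Qed.

Lemma ZSC_single a k : (forall j, j <> k -> a j = RtoC 0) -> ZSeriesC a = a k.
Proof.
  intros H. apply ZSC_unique.
  assert (H0 : forall n, (n < Z.abs_nat k)%nat -> zsumC a n = RtoC 0).
  { induction n as [|n IH]; intros Hn.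
    - apply H. lia.
    - rewrite zsumC_S, IH, !H by lia. ring. }
  assert (H1 : forall p, zsumC a (p + Z.abs_nat k) = a k).
  { induction p as [|p IH].
    - simpl. destruct (Z.abs_nat k) as [|m] eqn:E.
      + simpl. f_equal. lia.
      + rewrite zsumC_S, H0 by lia.
        destruct (Z_le_gt_dec 0 k).
        * rewrite (H (- Z.of_nat (S m))%Z) by lia.
          replace (Z.of_nat (S m)) with k by lia. ring.
        * rewrite (H (Z.of_nat (S m))%Z) by lia.
          replace (- Z.of_nat (S m))%Z with k by lia. ring.
    - change (S p + Z.abs_nat k)%nat with (S (p + Z.abs_nat k)).
      rewrite zsumC_S, IH.
      rewrite (H (Z.of_nat (S (p + Z.abs_nat k)))) by lia.
      rewrite (H (- Z.of_nat (S (p + Z.abs_nat k)))%Z) by lia. ring. }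
  split.
  - apply (is_lim_seq_incr_n _ (Z.abs_nat k)).
    eapply is_lim_seq_ext; [intros p; rewrite H1; reflexivity|].
    apply is_lim_seq_const.
  - apply (is_lim_seq_incr_n _ (Z.abs_nat k)).
    eapply is_lim_seq_ext; [intros p; rewrite H1; reflexivity|].
    apply is_lim_seq_const.
Qed.

Lemma fcoef_synth c k : summ c -> fcoef (synth c) k = c k.
Proof.
  intros Hc.
  rewrite (fcoef_ext _ (fun x => synth c x * RtoC 1)%C) by (intros; ring).
  rewrite (fcoef_synth_mult c _ 1 k Hc (ccont_const _)).
  - rewrite (ZSC_single _ k).
    + rewrite fcoef_one, Z.sub_diag. simpl. ring.
    + intros j Hj. rewrite fcoef_one.
      destruct (Z.eq_dec (k - j) 0); [lia|ring].
  - intros. rewrite Cmod_1. lra.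
Qed.

Lemma cos_le_of_mid d y : 0 <= d <= PI -> d <= y <= 2 * PI - d -> cos y <= cos d.
Proof.
  intros Hd Hy. apply Rminus_le. rewrite form2.
  assert (0 <= sin ((y - d) / 2)) by (apply sin_ge_0; lra).
  assert (0 <= sin ((y + d) / 2)) by (apply sin_ge_0; lra).
  nra.
Qed.

Definition bump (x0 x : R) : R := (1 + cos (x - x0)) / 2.

Lemma bump_abs x0 x : bump x0 x = (1 + cos (Rabs (x - x0))) / 2.
Proof.
  unfold bump. destruct (Rcase_abs (x - x0)) as [L | L].
  - rewrite Rabs_left by exact L. now rewrite cos_neg.
  - rewrite Rabs_right by exact L. reflexivity.
Qed.

Lemma bump_ge0 x0 x : 0 <= bump x0 x.
Proof. unfold bump. generalize (COS_bound (x - x0)). lra. Qed.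

Lemma continuous_bump_pow x0 n x : continuous (fun y => bump x0 y ^ n) x.
Proof.
  apply (continuous_comp (fun y => bump x0 y) (fun z => z ^ n)).
  - apply (ex_derive_continuous (K := R_AbsRing) (V := R_NormedModule)).
    unfold bump. auto_derive. exact I.
  - apply (ex_derive_continuous (K := R_AbsRing) (V := R_NormedModule)).
    auto_derive. exact I.
Qed.

(** Powers of [bump x0] are trigonometric polynomials that concentrate at
    [x0]: near [x0] they decay like [r ^ n] and away from it like [q ^ n]
    with [q < r], so a positive value at [x0] outweighs the rest. *)
Lemma bump_orthogonal_nonpos (g : R -> R) x0 : (forall x, continuous g x) ->
  (forall n, RInt (fun x => g x * bump x0 x ^ n) 0 (2 * PI) = 0) ->
  0 < x0 < 2 * PI -> g x0 <= 0.
Proof.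
  intros Hg Hint Hx0. apply Rnot_lt_le. intros Hpos.
  set (eta := g x0 / 2). assert (Heta : 0 < eta) by (unfold eta; lra).
  assert (Hd : exists d, 0 < d /\ d <= x0 /\ d <= 2 * PI - x0 /\
    forall x, Rabs (x - x0) < d -> eta <= g x).
  { assert (Hc := Hg x0). unfold continuous in Hc.
    rewrite filterlim_locally in Hc.
    destruct (Hc (mkposreal _ Heta)) as [[d1 Hd1] H1].
    exists (Rmin d1 (Rmin x0 (2 * PI - x0))).
    repeat split.
    - repeat apply Rmin_pos; lra.
    - eapply Rle_trans; [apply Rmin_r|apply Rmin_l].
    - eapply Rle_trans; [apply Rmin_r|apply Rmin_r].
    - intros x Hx.
      assert (Hb : ball x0 d1 x).
      { eapply Rlt_le_trans; [exact Hx|apply Rmin_l]. }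
      specialize (H1 x Hb). unfold ball in H1; simpl in H1.
      unfold AbsRing_ball, abs, minus, plus, opp in H1; simpl in H1.
      apply Rabs_def2 in H1. unfold eta in *. lra. }
  destruct Hd as [d [Hd0 [Hd1 [Hd2 Hd]]]].
  assert (Hpi := PI_RGT_0).
  assert (HdPI : d <= PI) by lra.
  set (q := (1 + cos d) / 2). set (r := (1 + cos (d / 2)) / 2).
  assert (Hq0 : 0 <= q) by (unfold q; generalize (COS_bound d); lra).
  assert (Hqr : q < r).
  { unfold q, r. assert (cos d < cos (d / 2)) by (apply cos_decreasing_1; lra). lra. }
  destruct (continuity_ab_min g 0 (2 * PI)) as [xm [Hxm _]].
  { lra. }
  { intros c _. apply continuity_pt_filterlim, Hg. }
  set (B := Rabs (g xm)).
  assert (HB0 : 0 <= B) by apply Rabs_pos.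
  assert (HB : forall x, 0 <= x <= 2 * PI -> - B <= g x).
  { intros x Hx. specialize (Hxm x Hx). unfold B.
    generalize (Rle_abs (- g xm)). rewrite Rabs_Ropp. lra. }
  assert (Hin : forall n x, Rabs (x - x0) <= d / 2 -> eta * r ^ n <= g x * bump x0 x ^ n).
  { intros n x Hx. assert (Hr : r <= bump x0 x).
    { rewrite bump_abs. unfold r.
      assert (cos (d / 2) <= cos (Rabs (x - x0))).
      { generalize (Rabs_pos (x - x0)). intros. apply cos_decr_1; lra. }
      lra. }
    apply Rmult_le_compat; [lra|apply pow_le; lra|apply Hd; lra|].
    apply pow_incr; lra. }
  assert (Hout : forall n x, 0 <= x <= 2 * PI -> - B * q ^ n <= g x * bump x0 x ^ n).
  { intros n x Hx. assert (Hqn : 0 <= q ^ n) by now apply pow_le.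
    assert (Hbn : 0 <= bump x0 x ^ n) by apply pow_le, bump_ge0.
    destruct (Rlt_le_dec (Rabs (x - x0)) d) as [L | L].
    - specialize (Hd x L). apply Rle_trans with 0; [nra|].
      apply Rmult_le_pos; lra.
    - assert (Hb : bump x0 x <= q).
      { rewrite bump_abs. unfold q.
        assert (cos (Rabs (x - x0)) <= cos d).
        { apply cos_le_of_mid; [lra|]. split; [exact L|].
          unfold Rabs; destruct (Rcase_abs (x - x0)); lra. }
        lra. }
      assert (bump x0 x ^ n <= q ^ n).
      { apply pow_incr. split; [apply bump_ge0|exact Hb]. }
      specialize (HB x Hx). nra. }
  (* The integral is split at [x0 - d / 2] and [x0 + d / 2]. *)
  assert (Hlow : forall n, d * (eta * r ^ n) + (2 * PI - d) * (- B * q ^ n) <= 0).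
  { intros n. rewrite <- (Hint n).
    set (F := fun x => g x * bump x0 x ^ n).
    assert (HF : forall x, continuous F x).
    { intros x. apply (continuous_mult g); [apply Hg|apply continuous_bump_pow]. }
    assert (HC : forall c a b, a <= b -> (forall x, a <= x <= b -> c <= F x) ->
      (b - a) * c <= RInt F a b).
    { intros c a b Hab Hc.
      replace ((b - a) * c) with (RInt (fun _ => c) a b)
        by (rewrite RInt_const; reflexivity).
      apply RInt_le; auto using ex_RInt_cont.
      - apply ex_RInt_cont. intros; apply continuous_const.
      - intros x Hx. apply Hc. lra. }
    rewrite <- (RInt_Chasles F 0 (x0 - d / 2) (2 * PI)) by now apply ex_RInt_cont.
    rewrite <- (RInt_Chasles F (x0 - d / 2) (x0 + d / 2) (2 * PI))
      by now apply ex_RInt_cont.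
    assert (H1 := HC (- B * q ^ n) 0 (x0 - d / 2) ltac:(lra)
      ltac:(intros x Hx; apply Hout; lra)).
    assert (H2 := HC (eta * r ^ n) (x0 - d / 2) (x0 + d / 2) ltac:(lra)
      ltac:(intros x Hx; apply Hin; apply Rabs_le; lra)).
    assert (H3 := HC (- B * q ^ n) (x0 + d / 2) (2 * PI) ltac:(lra)
      ltac:(intros x Hx; apply Hout; lra)).
    unfold plus; simpl. lra. }
  assert (Hr0 : 0 < r) by lra.
  assert (Hy : 0 < d * eta / (2 * PI * B + 1)).
  { apply Rdiv_lt_0_compat; [now apply Rmult_lt_0_compat|].
    assert (0 <= 2 * PI * B) by (apply Rmult_le_pos; lra). lra. }
  assert (Hqr1 : Rabs (q / r) < 1).
  { rewrite Rabs_pos_eq.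
    - apply Rlt_div_l; lra.
    - apply Rdiv_le_0_compat; lra. }
  (* [n] is chosen so large that [(q / r)^n] makes the outer part negligible. *)
  destruct (pow_lt_1_zero (q / r) Hqr1 _ Hy) as [N HN].
  specialize (HN N (Nat.le_refl _)). specialize (Hlow N).
  assert (Hrn : 0 < r ^ N) by now apply pow_lt.
  assert (Eq : q ^ N = (q / r) ^ N * r ^ N).
  { rewrite <- Rpow_mult_distr. f_equal. field. lra. }
  rewrite Eq in Hlow.
  set (z := (q / r) ^ N) in *.
  assert (Hz0 : 0 <= z) by (apply pow_le, Rdiv_le_0_compat; lra).
  rewrite Rabs_pos_eq in HN by exact Hz0.
  assert (HPB : 0 <= 2 * PI * B) by (apply Rmult_le_pos; lra).
  apply Rlt_div_r in HN; [|lra].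
  assert (H1 : (2 * PI - d) * B * z <= 2 * PI * B * z).
  { apply Rmult_le_compat_r; auto. apply Rmult_le_compat_r; lra. }
  assert (0 < r ^ N * (d * eta - (2 * PI - d) * B * z)).
  { apply Rmult_lt_0_compat; lra. }
  lra.
Qed.

(** A factor [bump x0] is a combination of the modes [0], [1] and [-1], so
    multiplication by it preserves the vanishing of all coefficients. *)
Lemma fcoef_zero_bump f x0 n : ccont f -> (forall k, fcoef f k = RtoC 0) ->
  ccont (fun x => f x * RtoC (bump x0 x ^ n))%C /\
  forall k, fcoef (fun x => f x * RtoC (bump x0 x ^ n))%C k = RtoC 0.
Proof.
  intros Hf H0. induction n as [|n [IHc IH]].
  - assert (E : forall x, f x = (f x * RtoC (bump x0 x ^ 0))%C)
      by (intros; simpl; ring).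
    split; [now apply ccont_ext with f|].
    intros k. rewrite <- (fcoef_ext f); auto.
  - set (g := fun x => (f x * RtoC (bump x0 x ^ n))%C) in *.
    set (g1 := fun x => (RtoC (1 / 2) * g x)%C).
    set (g2 := fun x => (RtoC (1 / 4) * cis (- x0) * cis (IZR 1 * x) * g x)%C).
    set (g3 := fun x => (RtoC (1 / 4) * cis x0 * cis (IZR (-1) * x) * g x)%C).
    assert (E : forall x, (g1 x + (g2 x + g3 x) = f x * RtoC (bump x0 x ^ S n))%C).
    { intros x. unfold g1, g2, g3, g. simpl pow. unfold bump at 4.
      rewrite RtoC_mult.
      replace (RtoC ((1 + cos (x - x0)) / 2)) with
        (RtoC (1 / 2) + RtoC (1 / 4) * (cis (- x0 + 1 * x) + cis (x0 + -1 * x)))%C.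
      - rewrite !cis_plus. ring.
      - replace (x0 + -1 * x) with (- (x - x0)) by ring.
        replace (- x0 + 1 * x) with (x - x0) by ring.
        rewrite <- cis_conj.
        apply C_eq; simpl; field. }
    assert (C1 : ccont g1) by now apply ccont_scal.
    assert (C2 : ccont g2) by (apply ccont_mult; auto; apply ccont_scal, ccont_cis).
    assert (C3 : ccont g3) by (apply ccont_mult; auto; apply ccont_scal, ccont_cis).
    split.
    + eapply ccont_ext; [exact E|]. apply ccont_plus; auto. now apply ccont_plus.
    + intros k. rewrite <- (fcoef_ext _ _ k E).
      rewrite !fcoef_plus by auto using ccont_plus.
      unfold g1, g2, g3. rewrite !fcoef_shift, fcoef_scal, !IH by auto. ring.
Qed.

Lemma periodic_Z (f : R -> C) (m : Z) x : periodic f -> f (x + IZR m * (2 * PI)) = f x.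
Proof.
  intros H.
  assert (Hn : forall n y, f (y + INR n * (2 * PI)) = f y).
  { induction n as [|n IH]; intros y.
    - simpl. f_equal. ring.
    - rewrite S_INR. rewrite <- (IH y), <- (H (y + INR n * (2 * PI))). f_equal. ring. }
  destruct (Z_le_gt_dec 0 m) as [L | L].
  - rewrite <- (Hn (Z.to_nat m) x). f_equal. rewrite INR_IZR_INZ, Z2Nat.id; auto.
  - rewrite <- (Hn (Z.to_nat (- m)) (x + _)). f_equal.
    rewrite INR_IZR_INZ, Z2Nat.id, opp_IZR by lia. ring.
Qed.

(** A continuous function with vanishing coefficients is orthogonal to all powers
    of bumps, which forces its real and imaginary parts to be nonpositive, and
    likewise for their opposites.  Points on the boundary of the period are
    reached by continuity, all others by periodicity. *)
Lemma fcoef_zero f : ccont f -> periodic f -> (forall k, fcoef f k = RtoC 0) ->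
  forall x, f x = RtoC 0.
Proof.
  intros Hf Hp H0.
  assert (Hint : forall x0 n,
    RInt (fun x => Re (f x) * bump x0 x ^ n) 0 (2 * PI) = 0 /\
    RInt (fun x => Im (f x) * bump x0 x ^ n) 0 (2 * PI) = 0).
  { intros x0 n. destruct (fcoef_zero_bump f x0 n Hf H0) as [Hc Hz].
    specialize (Hz 0%Z). rewrite fcoef_cis in Hz.
    rewrite (tint_ext _ (fun x => f x * RtoC (bump x0 x ^ n))%C) in Hz.
    2:{ intros x. replace (- IZR 0 * x) with 0 by (simpl; ring).
        rewrite cis_0. ring. }
    assert (Hz' : torus_int (fun x => f x * RtoC (bump x0 x ^ n))%C = RtoC 0).
    { rewrite <- (Cmult_1_l (torus_int _)), <- (Cinv_r (RtoC (2 * PI))) by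
        apply RtoC_twopi_neq.
      rewrite <- Cmult_assoc, Hz. ring. }
    rewrite tint_pair in Hz' by exact Hc.
    apply (f_equal (fun z : C => (fst z, snd z))) in Hz'. simpl in Hz'.
    injection Hz' as Z1 Z2.
    split.
    - etransitivity; [|exact Z1]. apply RInt_ext.
      intros x _. unfold Re, Im; simpl. ring.
    - etransitivity; [|exact Z2]. apply RInt_ext.
      intros x _. unfold Re, Im; simpl. ring. }
  assert (Hle : forall g : R -> R, (forall x, continuous g x) ->
    (forall x0 n, RInt (fun x => g x * bump x0 x ^ n) 0 (2 * PI) = 0) ->
    forall x, 0 < x < 2 * PI -> g x = 0).
  { intros g Hg Hgi x Hx. apply Rle_antisym.
    - now apply bump_orthogonal_nonpos.
    - apply Ropp_le_cancel. rewrite Ropp_0.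
      apply (bump_orthogonal_nonpos (fun y => - g y)); auto.
      + intros y. apply (continuous_opp g), Hg.
      + intros n.
        transitivity (RInt (fun y => (-1) * (g y * bump x y ^ n) + 0 * 0) 0 (2 * PI)).
        { apply RInt_ext. intros; simpl. ring. }
        rewrite (RInt_lin (fun y => g y * bump x y ^ n) (fun _ => 0)).
        * rewrite Hgi. change (-1 * 0 + 0 * RInt (fun _ => 0) 0 (2 * PI) = 0). ring.
        * intros y. apply (continuous_mult g); [apply Hg|apply continuous_bump_pow].
        * intros; apply continuous_const. }
  assert (Hlim : forall g : R -> R, (forall x, continuous g x) ->
    (forall x, 0 < x < 2 * PI -> g x = 0) -> g 0 = 0).
  { intros g Hg Hgz. destruct (Req_dec (g 0) 0) as [|Hn]; [assumption|exfalso].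
    assert (Hn' : 0 < Rabs (g 0)) by now apply Rabs_pos_lt.
    assert (Hc := Hg 0). unfold continuous in Hc. rewrite filterlim_locally in Hc.
    destruct (Hc (mkposreal _ Hn')) as [[d Hd] H1]. simpl in H1.
    set (y := Rmin (d / 2) PI) in *.
    assert (Hy : 0 < y) by (apply Rmin_pos; [lra|apply PI_RGT_0]).
    assert (Hyd : y <= d / 2) by apply Rmin_l.
    assert (HyP : y <= PI) by apply Rmin_r.
    assert (Hb : ball 0 d y).
    { change (Rabs (y - 0) < d). rewrite Rabs_pos_eq; lra. }
    specialize (H1 y Hb). change (Rabs (g y - g 0) < Rabs (g 0)) in H1.
    rewrite Hgz in H1 by lra.
    rewrite Rminus_0_l, Rabs_Ropp in H1. lra. }
  assert (Hbase : forall x, 0 <= x < 2 * PI -> f x = RtoC 0).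
  { destruct Hf as [Hr Hi].
    assert (R1 := Hle _ Hr (fun x0 n => proj1 (Hint x0 n))).
    assert (I1 := Hle _ Hi (fun x0 n => proj2 (Hint x0 n))).
    assert (R0 := Hlim _ Hr R1). assert (I0 := Hlim _ Hi I1).
    intros x Hx. destruct (Req_dec x 0) as [-> | Hx0].
    - now apply C_eq.
    - apply C_eq; [apply R1|apply I1]; lra. }
  intros x.
  set (m := Int_part (x / (2 * PI))).
  assert (H2 := twopi_pos).
  destruct (base_Int_part (x / (2 * PI))) as [B1 B2]. fold m in B1, B2.
  replace x with ((x - IZR m * (2 * PI)) + IZR m * (2 * PI)) by ring.
  rewrite periodic_Z by exact Hp.
  assert (Ex : x = x / (2 * PI) * (2 * PI)) by (field; lra).
  apply Hbase. split; nra.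
Qed.

Lemma fcoef_inj f g : ccont f -> periodic f -> ccont g -> periodic g ->
  (forall k, fcoef f k = fcoef g k) -> forall x, f x = g x.
Proof.
  intros Hf Pf Hg Pg H x.
  assert (E : (f x - g x)%C = RtoC 0).
  { apply (fcoef_zero (fun y => f y - g y)%C).
    - now apply ccont_minus.
    - intros y. now rewrite Pf, Pg.
    - intros k. rewrite fcoef_minus, H by auto. ring. }
  replace (f x) with ((f x - g x) + g x)%C by ring. rewrite E. ring.
Qed.

(** * Functions in Sobolev spaces and their coefficients *)

Lemma in_Hs_iff s f : in_Hs s f <->
  periodic f /\ ccont f /\ exists B, hle s (fcoef f) B.
Proof.
  unfold in_Hs. rewrite ccont_iff. split; intros [H1 [H2 H3]]; repeat split; auto;
    try apply H2.
  - exists (Hs_norm s f). now apply (hle_of_ex_series s (fcoef f)).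
  - destruct H3 as [B HB]. exact (hle_ex_series _ _ _ HB).
Qed.

Lemma in_Hs_ccont s f : in_Hs s f -> ccont f.
Proof. intros H. apply in_Hs_iff in H. apply H. Qed.

Lemma in_Hs_periodic s f : in_Hs s f -> periodic f.
Proof. intros H. apply H. Qed.

Lemma in_Hs_hle s f : in_Hs s f -> hle s (fcoef f) (Hs_norm s f).
Proof.
  intros H. apply in_Hs_iff in H. destruct H as [_ [_ [B HB]]].
  exact (hle_nrm _ _ _ HB).
Qed.

Lemma Hs_norm_le s f B : hle s (fcoef f) B -> Hs_norm s f <= B.
Proof. apply nrm_le. Qed.

Lemma Hs_norm_pos s f : 0 <= Hs_norm s f.
Proof. apply sqrt_pos. Qed.

(* From here on these are used through the lemmas above only; unfolding them
   exposes integrals and series on which unification gets lost. *)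
Global Opaque in_Hs Hs_norm fcoef.

Lemma in_Hs_inj s f g : in_Hs s f -> in_Hs s g ->
  (forall k, fcoef f k = fcoef g k) -> forall x, f x = g x.
Proof.
  intros Hf Hg.
  apply (fcoef_inj f g (in_Hs_ccont s f Hf) (in_Hs_periodic s f Hf)
    (in_Hs_ccont s g Hg) (in_Hs_periodic s g Hg)).
Qed.

Lemma in_Hs_summ s f : 1 / 2 < s -> in_Hs s f -> summ (fcoef f).
Proof. intros Hs H. eapply hle_summ; eauto. now apply in_Hs_hle. Qed.

Lemma in_Hs_synth s c B : 1 / 2 < s -> hle s c B -> in_Hs s (synth c).
Proof.
  intros Hs H. assert (Hc := hle_summ _ _ _ Hs H).
  apply in_Hs_iff. repeat split.
  - apply synth_periodic.
  - apply (ccont_synth c Hc).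
  - apply (ccont_synth c Hc).
  - exists B. apply hle_ext with c; auto. intros; symmetry; now apply fcoef_synth.
Qed.

(** Fourier inversion: the function and the sum of its series have the same
    coefficients, hence agree. *)
Lemma in_Hs_synth_eq s f x : 1 / 2 < s -> in_Hs s f -> f x = synth (fcoef f) x.
Proof.
  intros Hs H.
  assert (Hc := in_Hs_summ s f Hs H).
  apply (in_Hs_inj s f _ H (in_Hs_synth s _ _ Hs (in_Hs_hle s f H))).
  intros k. symmetry. now apply fcoef_synth.
Qed.

Lemma in_Hs_bounded s f : 1 / 2 < s -> in_Hs s f -> exists B, forall x, Cmod (f x) <= B.
Proof.
  intros Hs H. destruct (synth_bounded _ (in_Hs_summ s f Hs H)) as [B HB].
  exists B. intros x. rewrite (in_Hs_synth_eq s f x Hs H). apply HB.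
Qed.

Lemma fcoef_mult s f g k : 1 / 2 < s -> in_Hs s f -> in_Hs s g ->
  fcoef (fun x => f x * g x)%C k = conv (fcoef f) (fcoef g) k.
Proof.
  intros Hs Hf Hg.
  rewrite (fcoef_ext _ (fun x => synth (fcoef f) x * g x)%C)
    by (intros; now rewrite <- (in_Hs_synth_eq s f x Hs Hf)).
  destruct (in_Hs_bounded s g Hs Hg) as [B HB].
  apply fcoef_synth_mult with B; auto.
  - now apply (in_Hs_summ s).
  - apply (in_Hs_ccont s g Hg).
Qed.

Lemma in_Hs_mult s f g : 1 / 2 < s -> in_Hs s f -> in_Hs s g ->
  in_Hs s (fun x => f x * g x)%C.
Proof.
  intros Hs Hf Hg. apply in_Hs_iff. repeat split.
  - intros x. now rewrite (in_Hs_periodic s f Hf), (in_Hs_periodic s g Hg).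
  - apply (ccont_mult f g (in_Hs_ccont s f Hf) (in_Hs_ccont s g Hg)).
  - apply (ccont_mult f g (in_Hs_ccont s f Hf) (in_Hs_ccont s g Hg)).
  - eexists.
    exact (hle_ext s _ _ _ (fun k => eq_sym (fcoef_mult s f g k Hs Hf Hg))
      (hle_conv s _ _ _ _ Hs (in_Hs_hle s f Hf) (in_Hs_hle s g Hg))).
Qed.

Lemma in_Hs_plus s f g : in_Hs s f -> in_Hs s g -> in_Hs s (fun x => f x + g x)%C.
Proof.
  intros Hf Hg. apply in_Hs_iff. repeat split.
  - intros x. now rewrite (in_Hs_periodic s f Hf), (in_Hs_periodic s g Hg).
  - apply (ccont_plus f g (in_Hs_ccont s f Hf) (in_Hs_ccont s g Hg)).
  - apply (ccont_plus f g (in_Hs_ccont s f Hf) (in_Hs_ccont s g Hg)).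
  - eexists.
    exact (hle_ext s _ _ _
      (fun k => eq_sym (fcoef_plus f g k (in_Hs_ccont s f Hf) (in_Hs_ccont s g Hg)))
      (hle_plus s _ _ _ _ (in_Hs_hle s f Hf) (in_Hs_hle s g Hg))).
Qed.

Lemma in_Hs_scal s c f : in_Hs s f -> in_Hs s (fun x => c * f x)%C.
Proof.
  intros Hf. apply in_Hs_iff. repeat split.
  - intros x. now rewrite (in_Hs_periodic s f Hf).
  - apply (ccont_scal c f (in_Hs_ccont s f Hf)).
  - apply (ccont_scal c f (in_Hs_ccont s f Hf)).
  - eexists.
    exact (hle_ext s _ _ _
      (fun k => eq_sym (fcoef_scal c f k (in_Hs_ccont s f Hf)))
      (hle_scal s _ c _ (in_Hs_hle s f Hf))).
Qed.

Lemma in_Hs_ext s f g : (forall x, f x = g x) -> in_Hs s f -> in_Hs s g.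
Proof. intros H. replace g with f; auto. now apply functional_extensionality. Qed.

Lemma in_Hs_fsub s f g : in_Hs s f -> in_Hs s g -> in_Hs s (fsub f g).
Proof.
  intros Hf Hg. apply in_Hs_ext with (fun x => f x + (-1) * g x)%C.
  - intros x. unfold fsub. ring.
  - exact (in_Hs_plus s _ _ Hf (in_Hs_scal s (-1) g Hg)).
Qed.

Lemma fcoef_fsub s f g k : in_Hs s f -> in_Hs s g ->
  fcoef (fsub f g) k = (fcoef f k - fcoef g k)%C.
Proof.
  intros Hf Hg.
  apply (fcoef_minus f g k (in_Hs_ccont s f Hf) (in_Hs_ccont s g Hg)).
Qed.

Definition cj (a : Z -> C) (k : Z) : C := Cconj (a (- k)%Z).

Lemma hle_cj s a B : hle s a B -> hle s (cj a) B.
Proof.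
  intros H. rewrite <- (Rmult_1_l B).
  apply hle_dom with (fun k => a (- k)%Z); [lra| |now apply hle_opp].
  intros k. unfold cj. rewrite Cmod_conj. lra.
Qed.

Lemma in_Hs_fconj s f : in_Hs s f -> in_Hs s (fconj f).
Proof.
  intros Hf. apply in_Hs_iff. repeat split.
  - intros x. unfold fconj. now rewrite (in_Hs_periodic s f Hf).
  - apply (ccont_conj f (in_Hs_ccont s f Hf)).
  - apply (ccont_conj f (in_Hs_ccont s f Hf)).
  - eexists.
    exact (hle_ext s _ _ _
      (fun k => eq_sym (fcoef_conj f k (in_Hs_ccont s f Hf)))
      (hle_cj s (fcoef f) _ (in_Hs_hle s f Hf))).
Qed.

Lemma fmult_synth sigma f x :
  fmult sigma f x = synth (fun k => sigma (RtoC (- IZR k ^ 2)) * fcoef f k)%C x.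
Proof. apply ZSC_ext. intros k. now rewrite Cexp_Ci. Qed.

(** * The method on Fourier coefficients *)

Lemma Cmod_cis_minus_1 t : Cmod (cis t - 1) <= 2 /\ Cmod (cis t - 1) <= Rabs t.
Proof.
  split.
  - eapply Rle_trans; [apply Cmod_triangle|].
    rewrite Cmod_opp, Cmod_cis, Cmod_1. lra.
  - assert (Hsin : forall x, Rabs (sin x) <= Rabs x).
    { assert (Hp : forall x, 0 < x -> Rabs (sin x) <= x).
      { intros x Hx. apply Rabs_le. split.
        - destruct (Rle_lt_dec x PI).
          + generalize (sin_ge_0 x). lra.
          + generalize (SIN_bound x), PI2_3_2. lra.
        - left. now apply sin_lt_x. }
      intros x. destruct (Rtotal_order x 0) as [H | [-> | H]].
      - rewrite <- Rabs_Ropp, <- sin_neg, (Rabs_left x) by exact H. apply Hp. lra.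
      - rewrite sin_0. lra.
      - rewrite (Rabs_right x) by lra. now apply Hp. }
    rewrite <- (Rabs_pos_eq (Cmod _)) by apply Cmod_ge_0.
    apply Rsqr_le_abs_0. rewrite !Rsqr_pow2, Cmod2_alt, re_minus, im_minus.
    simpl Re. simpl Im.
    replace (cos t) with (1 - 2 * sin (t / 2) * sin (t / 2)).
    + assert (H2 : sin t = 2 * sin (t / 2) * cos (t / 2)).
      { rewrite <- sin_2a. f_equal. field. }
      rewrite H2, Rminus_0_r.
      assert (H3 := Hsin (t / 2)). apply Rsqr_le_abs_1 in H3.
      rewrite !Rsqr_pow2 in H3.
      assert (H4 := sin2_cos2 (t / 2)). rewrite !Rsqr_pow2 in H4.
      set (x := sin (t / 2)) in *. set (y := cos (t / 2)) in *.
      replace ((1 - 2 * x * x - 1) ^ 2 + (2 * x * y) ^ 2) with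
        (4 * x ^ 2 * (x ^ 2 + y ^ 2)) by ring.
      rewrite H4. replace (t ^ 2) with (4 * (t / 2) ^ 2) by field. lra.
    + rewrite <- cos_2a_sin. f_equal. field.
Qed.

Lemma Ci_RtoC_RtoC h d : (Ci * RtoC h * RtoC d = Ci * RtoC (h * d))%C.
Proof. rewrite RtoC_mult. ring. Qed.

Lemma Cmod_phi1 h d : Cmod (phi1 (Ci * RtoC h * RtoC d)) <= 1.
Proof.
  unfold phi1. destruct (Ceq_dec _ _) as [E | E].
  - rewrite Cmod_1. lra.
  - rewrite Cmod_div by exact E. rewrite Ci_RtoC_RtoC in *.
    rewrite Cexp_Ci, Cmod_mult, Cmod_Ci, Rmult_1_l, Cmod_R.
    assert (Hn : h * d <> 0).
    { intros H. apply E. rewrite H. ring. }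
    assert (Hp := Rabs_pos_lt _ Hn).
    apply Rle_div_l; [exact Hp|]. rewrite Rmult_1_l. apply Cmod_cis_minus_1.
Qed.

Definition rot (t : R) (a : Z -> C) (k : Z) : C :=
  (cis (- (t * IZR k ^ 2)) * a k)%C.

Definition phim (h : R) (a : Z -> C) (k : Z) : C :=
  (phi1 (Ci * RtoC h * RtoC (- IZR k ^ 2)) * a k)%C.

(** The trilinear term of the method; [cub 0] is the nonlinearity [|u|^2 u]. *)
Definition cub (h : R) (a : Z -> C) : Z -> C :=
  conv (conv a a) (phim h (cj a)).

Definition rhs (h : R) (v w : Z -> C) (k : Z) : C :=
  (rot h v k + Ci * RtoC (h / 4) * rot h (cub (- h) v) k
   + Ci * RtoC (h / 4) * cub h w k)%C.

Lemma hle_rot s t a A : hle s a A -> hle s (rot t a) A.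
Proof. apply hle_mult. intros k. rewrite Cmod_cis. lra. Qed.

Lemma hle_phim s h a A : hle s a A -> hle s (phim h a) A.
Proof. apply hle_mult. intros k. apply Cmod_phi1. Qed.

Lemma cj_minus a b k : cj (fun j => a j - b j)%C k = (cj a k - cj b k)%C.
Proof. apply Cminus_conj. Qed.

Lemma hle_cub s h a A : 1 / 2 < s -> hle s a A ->
  hle s (cub h a) (convK s ^ 2 * A ^ 3).
Proof.
  intros Hs Ha.
  apply hle_le with (convK s * ((convK s * (A * A)) * A)); [|right; ring].
  apply hle_conv; auto.
  - now apply hle_conv.
  - now apply hle_phim, hle_cj.
Qed.

Lemma hle_cub_diff s h a a' A d : 1 / 2 < s -> hle s a A -> hle s a' A ->
  hle s (fun k => a k - a' k)%C d ->
  hle s (fun k => cub h a k - cub h a' k)%C (3 * convK s ^ 2 * A ^ 2 * d).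
Proof.
  intros Hs Ha Ha' Hd.
  apply hle_le with
    (convK s * ((convK s * (d * A + A * d)) * A + (convK s * (A * A)) * d));
    [|right; ring].
  apply hle_conv_diff; auto.
  - now apply hle_conv.
  - now apply hle_conv.
  - now apply hle_phim, hle_cj.
  - now apply hle_phim, hle_cj.
  - now apply hle_conv_diff.
  - apply hle_ext with (phim h (cj (fun k => a k - a' k)%C)).
    + intros k. unfold phim. rewrite cj_minus. ring.
    + now apply hle_phim, hle_cj.
Qed.

Lemma Cmod_Ci_R x : 0 <= x -> Cmod (Ci * RtoC x) = x.
Proof.
  intros H. rewrite Cmod_mult, Cmod_Ci, Cmod_R, Rabs_pos_eq by exact H. ring.
Qed.

Lemma hle_scal_Ci s x a A : 0 <= x -> hle s a A ->
  hle s (fun k => Ci * RtoC x * a k)%C (x * A).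
Proof.
  intros Hx Ha.
  apply hle_le with (Cmod (Ci * RtoC x) * A); [now apply hle_scal|].
  rewrite Cmod_Ci_R by exact Hx. lra.
Qed.

Lemma hle_rhs s h v w A B : 1 / 2 < s -> 0 <= h -> hle s v A -> hle s w B ->
  hle s (rhs h v w)
    (A + h / 4 * (convK s ^ 2 * A ^ 3) + h / 4 * (convK s ^ 2 * B ^ 3)).
Proof.
  intros Hs Hh Hv Hw. unfold rhs.
  apply hle_plus; [apply hle_plus|].
  - now apply hle_rot.
  - apply hle_scal_Ci; [lra|]. now apply hle_rot, hle_cub.
  - apply hle_scal_Ci; [lra|]. now apply hle_cub.
Qed.

Lemma hle_rhs_diff s h v v' w w' A B dv dw : 1 / 2 < s -> 0 <= h ->
  hle s v A -> hle s v' A -> hle s w B -> hle s w' B ->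
  hle s (fun k => v k - v' k)%C dv -> hle s (fun k => w k - w' k)%C dw ->
  hle s (fun k => rhs h v w k - rhs h v' w' k)%C
    (dv + h / 4 * (3 * convK s ^ 2 * A ^ 2 * dv)
     + h / 4 * (3 * convK s ^ 2 * B ^ 2 * dw)).
Proof.
  intros Hs Hh Hv Hv' Hw Hw' Hdv Hdw.
  apply hle_ext with (fun k => rot h (fun j => v j - v' j)%C k +
    Ci * RtoC (h / 4) * rot h (fun j => cub (- h) v j - cub (- h) v' j)%C k +
    Ci * RtoC (h / 4) * (cub h w k - cub h w' k))%C.
  { intros k. unfold rhs, rot. ring. }
  apply hle_plus; [apply hle_plus|].
  - now apply hle_rot.
  - apply hle_scal_Ci; [lra|]. now apply hle_rot, hle_cub_diff.
  - apply (hle_scal_Ci s _ (fun k => cub h w k - cub h w' k)%C); [lra|].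
    now apply hle_cub_diff.
Qed.

Lemma exp_op_rot h f x : exp_op h f x = synth (rot h (fcoef f)) x.
Proof.
  unfold exp_op. rewrite fmult_synth. apply ZSC_ext. intros k.
  unfold rot. rewrite Ci_RtoC_RtoC, Cexp_Ci. do 3 f_equal. ring.
Qed.

Lemma in_Hs_exp_op s h f : 1 / 2 < s -> in_Hs s f ->
  in_Hs s (exp_op h f) /\ forall k, fcoef (exp_op h f) k = rot h (fcoef f) k.
Proof.
  intros Hs Hf.
  assert (H := hle_rot s h _ _ (in_Hs_hle s f Hf)).
  assert (E : forall x, synth (rot h (fcoef f)) x = exp_op h f x)
    by (intros; symmetry; apply exp_op_rot).
  split.
  - eapply in_Hs_ext; [exact E|]. eapply in_Hs_synth; eauto.
  - intros k. rewrite <- (fcoef_ext _ _ k E). apply fcoef_synth.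
    eapply hle_summ; eauto.
Qed.

Lemma in_Hs_phi1_op s h f : 1 / 2 < s -> in_Hs s f ->
  in_Hs s (phi1_op h f) /\ forall k, fcoef (phi1_op h f) k = phim h (fcoef f) k.
Proof.
  intros Hs Hf.
  assert (H := hle_phim s h _ _ (in_Hs_hle s f Hf)).
  assert (E : forall x, synth (phim h (fcoef f)) x = phi1_op h f x)
    by (intros; symmetry; apply fmult_synth).
  split.
  - eapply in_Hs_ext; [exact E|]. eapply in_Hs_synth; eauto.
  - intros k. rewrite <- (fcoef_ext _ _ k E). apply fcoef_synth.
    eapply hle_summ; eauto.
Qed.

Lemma in_Hs_cubic s h v : 1 / 2 < s -> in_Hs s v ->
  in_Hs s (fun y => v y * v y * phi1_op h (fconj v) y)%C /\
  forall k, fcoef (fun y => v y * v y * phi1_op h (fconj v) y)%C k =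
            cub h (fcoef v) k.
Proof.
  intros Hs Hv.
  assert (Hc := in_Hs_fconj s v Hv).
  destruct (in_Hs_phi1_op s h (fconj v) Hs Hc) as [Hp Ep].
  assert (Hvv := in_Hs_mult s v v Hs Hv Hv).
  split.
  - now apply (in_Hs_mult s (fun y => v y * v y)%C).
  - intros k. rewrite (fcoef_mult s (fun y => v y * v y)%C); auto.
    apply conv_ext.
    + intros j. now apply (fcoef_mult s).
    + intros j. rewrite Ep. unfold phim. f_equal.
      apply fcoef_conj, (in_Hs_ccont s v Hv).
Qed.

Lemma in_Hs_method_rhs s h v w : 1 / 2 < s -> in_Hs s v -> in_Hs s w ->
  in_Hs s (method_rhs h v w) /\
  forall k, fcoef (method_rhs h v w) k = rhs h (fcoef v) (fcoef w) k.
Proof.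
  intros Hs Hv Hw.
  destruct (in_Hs_exp_op s h v Hs Hv) as [H1 E1].
  destruct (in_Hs_cubic s (- h) v Hs Hv) as [H2 E2].
  destruct (in_Hs_exp_op s h _ Hs H2) as [H3 E3].
  destruct (in_Hs_cubic s h w Hs Hw) as [H4 E4].
  assert (H5 := in_Hs_scal s (Ci * RtoC (h / 4))%C _ H3).
  assert (H6 := in_Hs_scal s (Ci * RtoC (h / 4))%C _ H4).
  assert (H7 := in_Hs_plus s _ _ H1 H5).
  split.
  - exact (in_Hs_plus s _ _ H7 H6).
  - intros k. unfold method_rhs.
    rewrite (fcoef_plus _ _ k (in_Hs_ccont _ _ H7) (in_Hs_ccont _ _ H6)).
    rewrite (fcoef_plus _ _ k (in_Hs_ccont _ _ H1) (in_Hs_ccont _ _ H5)).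
    rewrite (fcoef_scal _ _ k (in_Hs_ccont _ _ H3)).
    rewrite (fcoef_scal _ _ k (in_Hs_ccont _ _ H4)).
    rewrite E1, E3, E4. unfold rhs, rot. now rewrite E2.
Qed.

(** * Solvability of one step *)

Lemma hle_nonneg s a A : hle s a A -> 0 <= A.
Proof. intros H; apply H. Qed.


(** The constant [6] serves both uses: it keeps the ball of radius [2 R] invariant
    and makes the fixed-point map contract there by [1 / 2]. *)
Definition small_step (s h R : R) : Prop :=
  0 < h /\ 6 * h * convK s ^ 2 * R ^ 2 <= 1.

Lemma rhs_ball s h v w R : 1 / 2 < s -> small_step s h R ->
  hle s v R -> hle s w (2 * R) -> hle s (rhs h v w) (2 * R).
Proof.
  intros Hs [Hh HR] Hv Hw. assert (HR0 := hle_nonneg _ _ _ Hv).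
  eapply hle_le; [apply hle_rhs; eauto; lra|].
  assert (H : 6 * h * convK s ^ 2 * R ^ 2 * R <= 1 * R)
    by now apply Rmult_le_compat_r.
  assert (0 <= h * convK s ^ 2 * R ^ 2 * R).
  { repeat apply Rmult_le_pos; try lra; apply convK_pos. }
  lra.
Qed.

Lemma rhs_contraction s h v w w' R d : 1 / 2 < s -> small_step s h R ->
  hle s v R -> hle s w (2 * R) -> hle s w' (2 * R) ->
  hle s (fun k => w k - w' k)%C d ->
  hle s (fun k => rhs h v w k - rhs h v w' k)%C (d / 2).
Proof.
  intros Hs [Hh HR] Hv Hw Hw' Hd. assert (Hd0 := hle_nonneg _ _ _ Hd).
  assert (H0 : hle s (fun k => v k - v k)%C 0).
  { apply hle_zero. intros; ring. }
  eapply hle_le; [apply hle_rhs_diff; eauto; lra|].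
  assert (H : 6 * h * convK s ^ 2 * R ^ 2 * d <= 1 * d)
    by now apply Rmult_le_compat_r.
  lra.
Qed.

Lemma geometric_Clim (u : nat -> C) M :
  (forall n p, Cmod (u (n + p)%nat - u n) <= M * (1 / 2) ^ n) ->
  exists l, Clim u l.
Proof.
  intros H.
  assert (HM : 0 <= M).
  { specialize (H 0%nat 0%nat). simpl in H. generalize (Cmod_ge_0 (u 0%nat - u 0%nat)). lra. }
  assert (Hr : forall v : nat -> R,
    (forall n p, Rabs (v (n + p)%nat - v n) <= M * (1 / 2) ^ n) ->
    ex_finite_lim_seq v).
  { intros v Hv. apply ex_lim_seq_cauchy_corr. intros eps.
    assert (He : 0 < eps / (2 * M + 1)).
    { apply Rdiv_lt_0_compat; [apply cond_pos|lra]. }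
    destruct (pow_lt_1_zero (1 / 2) ltac:(rewrite Rabs_pos_eq; lra) _ He) as [N HN].
    specialize (HN N (Nat.le_refl _)).
    assert (H2 : 0 < (1 / 2) ^ N) by (apply pow_lt; lra).
    rewrite Rabs_pos_eq in HN by lra. apply Rlt_div_r in HN; [|lra].
    exists N. intros n m Hn Hm.
    assert (A1 := Hv N (n - N)%nat). assert (A2 := Hv N (m - N)%nat).
    replace (N + (n - N))%nat with n in A1 by lia.
    replace (N + (m - N))%nat with m in A2 by lia.
    replace (v n - v m) with ((v n - v N) - (v m - v N)) by ring.
    apply Rabs_le_between in A1. apply Rabs_le_between in A2.
    apply Rabs_def1; lra. }
  destruct (Hr (fun n => Re (u n))) as [a Ha].
  { intros n p. rewrite <- re_minus. eapply Rle_trans; [apply re_le_Cmod|apply H]. }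
  destruct (Hr (fun n => Im (u n))) as [b Hb].
  { intros n p. rewrite <- im_minus. eapply Rle_trans; [apply im_le_Cmod|apply H]. }
  exists (a, b). split; [exact Ha|exact Hb].
Qed.

Fixpoint iter_coef (h : R) (v : Z -> C) (j : nat) : Z -> C :=
  match j with
  | O => rot h v
  | S j' => rhs h v (iter_coef h v j')
  end.

Lemma in_Hs_method_iter s h v j : 1 / 2 < s -> in_Hs s v ->
  in_Hs s (method_iter h v j) /\
  forall k, fcoef (method_iter h v j) k = iter_coef h (fcoef v) j k.
Proof.
  intros Hs Hv. induction j as [|j [IH IE]].
  - now apply in_Hs_exp_op.
  - destruct (in_Hs_method_rhs s h v _ Hs Hv IH) as [H1 H2].
    split; [exact H1|]. intros k. simpl. rewrite H2.
    f_equal. now apply functional_extensionality.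
Qed.

Lemma iter_coef_ball s h v R j : 1 / 2 < s -> small_step s h R -> hle s v R ->
  hle s (iter_coef h v j) (2 * R).
Proof.
  intros Hs Hh Hv. assert (HR0 := hle_nonneg _ _ _ Hv).
  induction j as [|j IH].
  - apply hle_le with R; [now apply hle_rot|lra].
  - now apply rhs_ball.
Qed.

Lemma iter_coef_step s h v R j : 1 / 2 < s -> small_step s h R -> hle s v R ->
  hle s (fun k => iter_coef h v (S j) k - iter_coef h v j k)%C
    (4 * R * (1 / 2) ^ j).
Proof.
  intros Hs Hh Hv. induction j as [|j IH].
  - apply hle_le with (2 * R + 2 * R); [|simpl; lra].
    apply hle_minus; now apply iter_coef_ball.
  - replace (4 * R * (1 / 2) ^ S j) with (4 * R * (1 / 2) ^ j / 2) by (simpl; field).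
    apply (rhs_contraction s h v (iter_coef h v (S j)) (iter_coef h v j) R); auto;
      now apply iter_coef_ball.
Qed.

Lemma iter_coef_cauchy s h v R n p : 1 / 2 < s -> small_step s h R -> hle s v R ->
  hle s (fun k => iter_coef h v (n + p) k - iter_coef h v n k)%C
    (8 * R * (1 / 2) ^ n).
Proof.
  intros Hs Hh Hv. assert (HR0 := hle_nonneg _ _ _ Hv).
  assert (H2 : forall m, 0 < (1 / 2) ^ m) by (intros; apply pow_lt; lra).
  apply hle_le with (8 * R * ((1 / 2) ^ n - (1 / 2) ^ (n + p))).
  2:{ apply Rmult_le_compat_l; [lra|]. generalize (H2 (n + p)%nat). lra. }
  induction p as [|p IH].
  - rewrite Nat.add_0_r, Rminus_diag, Rmult_0_r.
    apply hle_zero. intros; ring.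
  - rewrite Nat.add_succ_r.
    apply hle_ext with (fun k =>
      (iter_coef h v (S (n + p)) k - iter_coef h v (n + p) k) +
      (iter_coef h v (n + p) k - iter_coef h v n k))%C; [intros; ring|].
    eapply hle_le; [apply hle_plus; [now apply (iter_coef_step s h v R)|exact IH]|].
    simpl. lra.
Qed.

Lemma geom_lim_0 M : is_lim_seq (fun n => M * (1 / 2) ^ n) 0.
Proof.
  replace (Finite 0) with (Finite (M * 0)) by (f_equal; ring).
  apply is_lim_seq_mult'; [apply is_lim_seq_const|].
  apply is_lim_seq_geom. rewrite Rabs_pos_eq; lra.
Qed.

(** The limit is taken coefficient by coefficient; [hle_lim] turns the Cauchy
    estimate into a rate of convergence in norm. *)
Lemma iter_coef_limit s h v R : 1 / 2 < s -> small_step s h R -> hle s v R ->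
  exists c, hle s c (2 * R) /\
    forall n, hle s (fun k => iter_coef h v n k - c k)%C (8 * R * (1 / 2) ^ n).
Proof.
  intros Hs Hh Hv.
  assert (Hk : forall k, exists l, Clim (fun n => iter_coef h v n k) l).
  { intros k. apply geometric_Clim with (8 * R). intros n p.
    apply (hle_coef s (fun k => iter_coef h v (n + p) k - iter_coef h v n k)%C);
      [lra|]. now apply iter_coef_cauchy. }
  set (c := fun k => (real (Lim_seq (fun n => Re (iter_coef h v n k))),
                      real (Lim_seq (fun n => Im (iter_coef h v n k)))) : C).
  assert (Hc : forall k, Clim (fun n => iter_coef h v n k) (c k)).
  { intros k. destruct (Hk k) as [l Hl].
    replace (c k) with l; [exact Hl|].
    destruct Hl as [H1 H2]. apply C_eq; simpl.
    - apply is_lim_seq_unique in H1. now rewrite H1.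
    - apply is_lim_seq_unique in H2. now rewrite H2. }
  exists c. split.
  - apply (hle_lim s (fun n => iter_coef h v n) c (fun _ => 2 * R)); auto.
    + intros n. now apply iter_coef_ball.
    + apply is_lim_seq_const.
  - intros n.
    apply hle_ext with (fun k => (-1) * (c k - iter_coef h v n k))%C;
      [intros; ring|].
    replace (8 * R * (1 / 2) ^ n) with (Cmod (-1) * (8 * R * (1 / 2) ^ n)).
    2:{ rewrite Cmod_R, Rabs_left by lra. ring. }
    apply (hle_scal s (fun k => c k - iter_coef h v n k)%C).
    apply (hle_lim s (fun p k => iter_coef h v (n + p) k - iter_coef h v n k)%C _
      (fun _ => 8 * R * (1 / 2) ^ n)).
    + intros p. now apply iter_coef_cauchy.
    + apply is_lim_seq_const.
    + intros k. apply Clim_minus; [|apply Clim_const].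
      destruct (Hc k) as [H1 H2]. split.
      * apply (is_lim_seq_ext (fun p => Re (iter_coef h v (p + n) k))).
        { intros; now rewrite Nat.add_comm. }
        apply (is_lim_seq_incr_n (fun p => Re (iter_coef h v p k))), H1.
      * apply (is_lim_seq_ext (fun p => Im (iter_coef h v (p + n) k))).
        { intros; now rewrite Nat.add_comm. }
        apply (is_lim_seq_incr_n (fun p => Im (iter_coef h v p k))), H2.
Qed.

(** The limit solves the implicit equation because the right-hand side is
    continuous: its values at the iterates are the next iterates. *)
Lemma method_step_exists s h v R : 1 / 2 < s -> small_step s h R ->
  in_Hs s v -> hle s (fcoef v) R -> exists v', method_step s h v v'.
Proof.
  intros Hs Hh Hv HR.
  destruct (iter_coef_limit s h (fcoef v) R Hs Hh HR) as [c [Hc Hlim]].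
  assert (Hcs : forall k, fcoef (synth c) k = c k).
  { intros k. apply fcoef_synth. eapply hle_summ; eauto. }
  assert (Hin : in_Hs s (synth c)) by (eapply in_Hs_synth; eauto).
  exists (synth c). split; [split; [|split; [exact Hin|]]|].
  - intros j. apply (in_Hs_method_iter s h v j Hs Hv).
  - apply (is_lim_seq_le_le (fun _ => 0) _ (fun n => 8 * R * (1 / 2) ^ n)).
    + intros n. split; [apply Hs_norm_pos|].
      apply Hs_norm_le.
      destruct (in_Hs_method_iter s h v n Hs Hv) as [H1 H2].
      eapply hle_ext; [|apply Hlim].
      intros k. simpl. now rewrite (fcoef_fsub s), H2, Hcs.
    + apply is_lim_seq_const.
    + apply geom_lim_0.
  - destruct (in_Hs_method_rhs s h v (synth c) Hs Hv Hin) as [H1 H2].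
    apply (in_Hs_inj s); auto.
    intros k. rewrite H2, Hcs.
    replace (fcoef (synth c)) with c
      by (apply functional_extensionality; intros; symmetry; apply Hcs).
    apply Clim_unique with (fun n => iter_coef h (fcoef v) (S n) k).
    + apply (Clim_incr (fun n => iter_coef h (fcoef v) n k)).
      apply Clim_squeeze with (fun n => 8 * R * (1 / 2) ^ n); [|apply geom_lim_0].
      intros n. eapply (hle_coef s (fun k => iter_coef h (fcoef v) n k - c k)%C);
        [lra|apply Hlim].
    + apply Clim_squeeze with (fun n => 4 * R * (1 / 2) ^ n); [|apply geom_lim_0].
      intros n. simpl.
      apply (hle_coef s (fun k => rhs h (fcoef v) (iter_coef h (fcoef v) n) k -
        rhs h (fcoef v) c k)%C); [lra|].
      replace (4 * R * (1 / 2) ^ n) with (8 * R * (1 / 2) ^ n / 2) by field.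
      apply rhs_contraction with R; auto. now apply iter_coef_ball.
Qed.

(** A limit of iterates inherits their bound, which selects the small solution
    of the implicit equation among possible others. *)
Lemma method_step_bound s h v v' R : 1 / 2 < s -> small_step s h R ->
  in_Hs s v -> hle s (fcoef v) R -> method_step s h v v' ->
  in_Hs s v' /\ hle s (fcoef v') (2 * R) /\
  forall k, fcoef v' k = rhs h (fcoef v) (fcoef v') k.
Proof.
  intros Hs Hh Hv HR [[Hit [Hin Hl]] Heq].
  split; [exact Hin|]. split.
  - apply (hle_lim s (fun _ => fcoef v') (fcoef v')
      (fun n => 2 * R + Hs_norm s (fsub (method_iter h v n) v')) (2 * R)).
    + intros n.
      destruct (in_Hs_method_iter s h v n Hs Hv) as [H1 H2].
      apply hle_ext with (fun k => iter_coef h (fcoef v) n k -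
        fcoef (fsub (method_iter h v n) v') k)%C.
      { intros k. rewrite (fcoef_fsub s), H2 by auto. ring. }
      apply hle_minus; [now apply iter_coef_ball|].
      now apply in_Hs_hle, in_Hs_fsub.
    + replace (Finite (2 * R)) with (Finite (2 * R + 0)) by (f_equal; ring).
      apply is_lim_seq_plus'; [apply is_lim_seq_const|exact Hl].
    + intros k. apply Clim_const.
  - intros k. rewrite (fcoef_ext v' _ k Heq) at 1.
    now apply in_Hs_method_rhs with s.
Qed.

(** * Curves in sequence space *)

Definition Cderive (f : R -> C) (t : R) (l : C) : Prop :=
  is_derive (fun y => Re (f y)) t (Re l) /\ is_derive (fun y => Im (f y)) t (Im l).

Lemma is_derive_eq (f : R -> R) t l l' : is_derive f t l -> l = l' ->
  is_derive f t l'.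
Proof. now intros H <-. Qed.

Lemma Cderive_eq f t l l' : Cderive f t l -> l = l' -> Cderive f t l'.
Proof. now intros H <-. Qed.

Lemma Cderive_ext f g t l : (forall y, f y = g y) -> Cderive f t l -> Cderive g t l.
Proof. intros H. replace g with f; auto. now apply functional_extensionality. Qed.

Lemma Cderive_const c t : Cderive (fun _ => c) t (RtoC 0).
Proof. split; apply (is_derive_const (K := R_AbsRing) (V := R_NormedModule)). Qed.

Lemma Cderive_plus f g t a b : Cderive f t a -> Cderive g t b ->
  Cderive (fun y => f y + g y)%C t (a + b)%C.
Proof.
  intros [H1 H2] [H3 H4]; split.
  - rewrite re_plus. exact (is_derive_plus (K := R_AbsRing) (V := R_NormedModule)
      _ _ t _ _ H1 H3).
  - rewrite im_plus. exact (is_derive_plus (K := R_AbsRing) (V := R_NormedModule)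
      _ _ t _ _ H2 H4).
Qed.

Lemma is_derive_mult_R (f g : R -> R) t a b : is_derive f t a -> is_derive g t b ->
  is_derive (fun y => f y * g y) t (a * g t + f t * b).
Proof.
  intros H1 H2.
  exact (is_derive_mult (K := R_AbsRing) f g t a b H1 H2 Rmult_comm).
Qed.

Lemma Cderive_mult f g t a b : Cderive f t a -> Cderive g t b ->
  Cderive (fun y => f y * g y)%C t (a * g t + f t * b)%C.
Proof.
  intros [H1 H2] [H3 H4]; split.
  - eapply is_derive_eq.
    + exact (is_derive_minus (K := R_AbsRing) (V := R_NormedModule) _ _ t _ _
        (is_derive_mult_R _ _ t _ _ H1 H3) (is_derive_mult_R _ _ t _ _ H2 H4)).
    + rewrite re_plus, !re_mult. unfold minus, plus, opp; simpl. ring.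
  - eapply is_derive_eq.
    + exact (is_derive_plus (K := R_AbsRing) (V := R_NormedModule) _ _ t _ _
        (is_derive_mult_R _ _ t _ _ H1 H4) (is_derive_mult_R _ _ t _ _ H2 H3)).
    + rewrite im_plus, !im_mult. unfold plus; simpl. ring.
Qed.

Lemma Cderive_scal c f t a : Cderive f t a ->
  Cderive (fun y => c * f y)%C t (c * a)%C.
Proof.
  intros H. eapply Cderive_eq; [apply Cderive_mult; [apply Cderive_const|exact H]|].
  cbv beta; ring.
Qed.

Lemma Cderive_minus f g t a b : Cderive f t a -> Cderive g t b ->
  Cderive (fun y => f y - g y)%C t (a - b)%C.
Proof.
  intros H1 H2. apply Cderive_ext with (fun y => f y + (-1) * g y)%C.
  - intros; ring.
  - eapply Cderive_eq; [apply Cderive_plus; [exact H1|apply Cderive_scal, H2]|].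
    cbv beta; ring.
Qed.

Lemma Cderive_conj f t a : Cderive f t a ->
  Cderive (fun y => Cconj (f y)) t (Cconj a).
Proof.
  intros [H1 H2]; split; [exact H1|].
  exact (is_derive_opp (K := R_AbsRing) (V := R_NormedModule) _ t _ H2).
Qed.

Lemma Cderive_cis c t : Cderive (fun y => cis (y * c)) t (Ci * RtoC c * cis (t * c))%C.
Proof.
  split.
  - eapply is_derive_eq.
    + unfold Re, cis; simpl. auto_derive; [exact I|reflexivity].
    + simpl. ring.
  - eapply is_derive_eq.
    + unfold Im, cis; simpl. auto_derive; [exact I|reflexivity].
    + simpl. ring.
Qed.

Lemma Cderive_reverse f c t a : Cderive f (c - t) a ->
  Cderive (fun y => f (c - y)) t (- a)%C.
Proof.
  intros [H1 H2].
  assert (Hd : is_derive (fun y => c - y) t (-1)) by (auto_derive; [exact I|ring]).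
  split.
  - eapply is_derive_eq.
    + exact (is_derive_comp (K := R_AbsRing) (V := R_NormedModule)
        (fun y => Re (f y)) (fun y => c - y) t _ _ H1 Hd).
    + rewrite re_opp. unfold scal; simpl; unfold mult; simpl. ring.
  - eapply is_derive_eq.
    + exact (is_derive_comp (K := R_AbsRing) (V := R_NormedModule)
        (fun y => Im (f y)) (fun y => c - y) t _ _ H2 Hd).
    + rewrite im_opp. unfold scal; simpl; unfold mult; simpl. ring.
Qed.

Lemma Cderive_ccont f f' : (forall t, Cderive f t (f' t)) -> ccont f.
Proof.
  intros H; split; intros t;
    apply (ex_derive_continuous (K := R_AbsRing) (V := R_NormedModule));
    destruct (H t) as [H1 H2]; eexists; eassumption.
Qed.

Lemma Cderive_zsumC f f' t n : (forall k, Cderive (f k) t (f' k)) ->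
  Cderive (fun y => zsumC (fun k => f k y) n) t (zsumC f' n).
Proof.
  intros H. induction n as [|n IH].
  - apply H.
  - apply Cderive_plus; [exact IH|]. apply Cderive_plus; apply H.
Qed.

Lemma unif_lim_derive (fn fn' : nat -> R -> R) (f g : R -> R) e :
  (forall n t, is_derive (fn n) t (fn' n t)) ->
  (forall n t, continuous (fn' n) t) ->
  (forall t, is_lim_seq (fun n => fn n t) (f t)) ->
  (forall n t, Rabs (fn' n t - g t) <= e n) -> is_lim_seq e 0 ->
  forall t, is_derive f t (g t).
Proof.
  intros Hd Hc Hf Hg He t. apply is_derive_Reals.
  apply (derivable_pt_lim_CVU fn fn' f g t t (mkposreal 1 Rlt_0_1)).
  - unfold Boule. simpl. rewrite Rminus_diag, Rabs_R0. lra.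
  - intros y n _. apply is_derive_Reals, Hd.
  - intros y _. apply is_lim_seq_Reals, Hf.
  - intros eps Heps. apply is_lim_seq_spec in He.
    destruct (He (mkposreal _ Heps)) as [N HN]. exists N.
    intros n y Hn _. specialize (HN n Hn). simpl in HN.
    rewrite Rabs_minus_sym. eapply Rle_lt_trans; [apply Hg|].
    generalize (Rle_abs (e n)). rewrite Rminus_0_r in HN. lra.
  - intros y _. apply continuity_pt_filterlim.
    apply (unif_lim_continuous g fn' e Hc Hg He).
Qed.

(** Termwise differentiation: the derivatives are bounded by [1], so the
    differentiated series converges uniformly. *)
Lemma Cderive_ZSeriesC c (p p' : Z -> R -> C) t : summ c ->
  (forall j y, Cmod (p j y) <= Rabs y) ->
  (forall j y, Cmod (p' j y) <= 1) ->
  (forall j y, Cderive (p j) y (p' j y)) -> (forall j, ccont (p' j)) ->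
  Cderive (fun y => ZSeriesC (fun j => c j * p j y)%C) t
          (ZSeriesC (fun j => c j * p' j t)%C).
Proof.
  intros Hc Hp Hp' Hd Hcont.
  assert (S1 : forall y, summ (fun j => c j * p j y)%C).
  { intros y. apply summ_le with (fun j => p j y * c j)%C.
    - intros j. rewrite Cmult_comm. lra.
    - apply summ_mult_bounded with (Rabs y); auto. }
  assert (T : forall n y, Cmod (zsumC (fun j => c j * p' j y)%C n -
    ZSeriesC (fun j => c j * p' j y)%C) <= ztail c n).
  { intros n y. apply ZSC_tail; auto. intros j. rewrite Cmod_mult.
    rewrite <- (Rmult_1_r (Cmod (c j))) at 2.
    apply Rmult_le_compat_l; auto using Cmod_ge_0. }
  assert (D : forall n y, Cderive (fun z => zsumC (fun j => c j * p j z)%C n) y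
    (zsumC (fun j => c j * p' j y)%C n)).
  { intros n y.
    apply (Cderive_zsumC (fun j z => c j * p j z)%C (fun j => c j * p' j y)%C).
    intros j. apply Cderive_scal, Hd. }
  assert (K : forall n, ccont (fun y => zsumC (fun j => c j * p' j y)%C n)).
  { induction n as [|n IH].
    - apply (ccont_scal (c 0%Z)), Hcont.
    - apply ccont_plus; [exact IH|]. apply ccont_plus; apply ccont_scal, Hcont. }
  split.
  - apply (unif_lim_derive (fun n y => Re (zsumC (fun j => c j * p j y)%C n))
      (fun n y => Re (zsumC (fun j => c j * p' j y)%C n)) _
      (fun y => Re (ZSeriesC (fun j => c j * p' j y)%C)) (ztail c)).
    + intros n y. apply D.
    + intros n. apply (proj1 (K n)).
    + intros y. apply (ZSC_lim _ (S1 y)).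
    + intros n y. rewrite <- re_minus. eapply Rle_trans; [apply re_le_Cmod|apply T].
    + now apply ztail_lim.
  - apply (unif_lim_derive (fun n y => Im (zsumC (fun j => c j * p j y)%C n))
      (fun n y => Im (zsumC (fun j => c j * p' j y)%C n)) _
      (fun y => Im (ZSeriesC (fun j => c j * p' j y)%C)) (ztail c)).
    + intros n y. apply D.
    + intros n. apply (proj2 (K n)).
    + intros y. apply (ZSC_lim _ (S1 y)).
    + intros n y. rewrite <- im_minus. eapply Rle_trans; [apply im_le_Cmod|apply T].
    + now apply ztail_lim.
Qed.

(** Continuity on [[0, d]] is expressed as continuity on the whole line after
    projection onto that interval, so that sums and products need no care at
    the endpoints. *)
Definition clamp (d x : R) : R := Rmax 0 (Rmin d x).

Lemma clamp_in d x : 0 <= d -> 0 <= clamp d x <= d.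
Proof.
  intros Hd. unfold clamp. split; [apply Rmax_l|].
  apply Rmax_lub; [exact Hd|apply Rmin_l].
Qed.

Lemma clamp_id d x : 0 <= x <= d -> clamp d x = x.
Proof.
  intros H. unfold clamp. rewrite Rmin_right, Rmax_right by lra. reflexivity.
Qed.

Lemma clamp_lipschitz d x y : Rabs (clamp d x - clamp d y) <= Rabs (x - y).
Proof.
  unfold clamp, Rmax, Rmin, Rabs.
  repeat destruct (Rle_dec _ _); repeat destruct (Rcase_abs _); lra.
Qed.

Lemma continuous_clamp d x : continuous (clamp d) x.
Proof.
  apply filterlim_locally. intros eps. exists eps. intros y Hy.
  eapply Rle_lt_trans; [apply (clamp_lipschitz d y x)|exact Hy].
Qed.

Lemma ccont_comp f g : ccont f -> (forall x, continuous g x) ->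
  ccont (fun x => f (g x)).
Proof.
  intros [H1 H2] Hg; split; intros x.
  - apply (continuous_comp g (fun y => Re (f y))); auto.
  - apply (continuous_comp g (fun y => Im (f y))); auto.
Qed.

Lemma mean_value_clamp (F F' : R -> R) d B : 0 < d ->
  (forall t, continuous (fun x => F (clamp d x)) t) ->
  (forall t, 0 < t < d -> is_derive F t (F' t)) ->
  (forall t, 0 < t < d -> Rabs (F' t) <= B) ->
  Rabs (F d - F 0) <= B * d.
Proof.
  intros Hd Hc Hder HB.
  assert (HB0 : 0 <= B).
  { eapply Rle_trans; [apply Rabs_pos|apply (HB (d / 2)); lra]. }
  (* [MVT_gen] may return an endpoint, where nothing is known of [F']; setting the
     derivative to [0] there keeps the bound. *)
  set (df := fun t => if Rlt_dec 0 t then if Rlt_dec t d then F' t else 0 else 0).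
  destruct (MVT_gen (fun x => F (clamp d x)) 0 d df) as [c [Hcd E]].
  - rewrite Rmin_left, Rmax_right by lra. intros x Hx.
    unfold df. destruct (Rlt_dec 0 x); [|lra]. destruct (Rlt_dec x d); [|lra].
    apply (is_derive_ext_loc (K := R_AbsRing) (V := R_NormedModule) F);
      [|now apply Hder].
    assert (Hm : 0 < Rmin x (d - x)) by (apply Rmin_pos; lra).
    exists (mkposreal _ Hm). intros y Hy.
    change (Rabs (y - x) < Rmin x (d - x)) in Hy.
    generalize (Rmin_l x (d - x)), (Rmin_r x (d - x)). intros.
    apply Rabs_def2 in Hy. rewrite clamp_id by lra. reflexivity.
  - intros x _. apply continuity_pt_filterlim, Hc.
  - rewrite !clamp_id in E by lra. rewrite E, Rminus_0_r, Rabs_mult, (Rabs_pos_eq d) by lra.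
    apply Rmult_le_compat_r; [lra|].
    unfold df. destruct (Rlt_dec 0 c); [|now rewrite Rabs_R0].
    destruct (Rlt_dec c d); [|now rewrite Rabs_R0]. apply HB. lra.
Qed.

(** Testing the increment of the curve against itself reduces a mean value
    inequality in a weighted [l^2] norm to the scalar one. *)
Lemma hle_mean_value s (D D' : R -> Z -> C) d B : 0 < d ->
  (forall k, ccont (fun t => D (clamp d t) k)) ->
  (forall k t, 0 < t < d -> Cderive (fun y => D y k) t (D' t k)) ->
  (forall t, 0 < t < d -> hle s (D' t) B) ->
  hle s (fun k => D d k - D 0 k)%C (B * d).
Proof.
  intros Hd Hc Hder HB.
  assert (HB0 : 0 <= B) by (apply (HB (d / 2)); lra).
  split; [apply Rmult_le_pos; lra|]. intros n.
  set (b := fun k => (D d k - D 0 k)%C).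
  set (G := fun (E : Z -> C) => zsum (fun k =>
    wt s k * (Re (b k) * Re (E k) + Im (b k) * Im (E k))) n).
  set (Q := zsum (hsq s b) n).
  assert (HQ : 0 <= Q) by apply zsum_nonneg, hsq_pos.
  assert (HG : Rabs (G (D d) - G (D 0)) <= sqrt Q * B * d).
  { apply (mean_value_clamp (fun t => G (D t)) (fun t => G (D' t))); auto.
    - intros t. unfold G. clear Q HQ. induction n as [|n IH].
      + simpl. apply (continuous_mult (fun _ => wt s 0)); [apply continuous_const|].
        apply (continuous_plus (fun x => Re (b 0%Z) * Re (D (clamp d x) 0%Z))
          (fun x => Im (b 0%Z) * Im (D (clamp d x) 0%Z))).
        * exact (continuous_mult _ _ t (continuous_const (Re (b 0%Z)) t) (proj1 (Hc 0%Z) t)).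
        * exact (continuous_mult _ _ t (continuous_const (Im (b 0%Z)) t) (proj2 (Hc 0%Z) t)).
      + assert (Hk : forall k, continuous (fun x => wt s k *
          (Re (b k) * Re (D (clamp d x) k) + Im (b k) * Im (D (clamp d x) k))) t).
        { intros k. apply (continuous_mult (fun _ => wt s k)); [apply continuous_const|].
          apply (continuous_plus (fun x => Re (b k) * Re (D (clamp d x) k))
            (fun x => Im (b k) * Im (D (clamp d x) k))).
          * exact (continuous_mult _ _ t (continuous_const (Re (b k)) t) (proj1 (Hc k) t)).
          * exact (continuous_mult _ _ t (continuous_const (Im (b k)) t) (proj2 (Hc k) t)). }
        eapply continuous_ext; [intros; symmetry; apply zsum_S|].
        apply (continuous_plus (V := R_NormedModule)); [exact IH|].
        apply (continuous_plus (V := R_NormedModule)); apply Hk.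
    - intros t Ht. unfold G. clear Q HQ.
      assert (Hk : forall k, is_derive (fun x => wt s k *
          (Re (b k) * Re (D x k) + Im (b k) * Im (D x k))) t
          (wt s k * (Re (b k) * Re (D' t k) + Im (b k) * Im (D' t k)))).
      { intros k. destruct (Hder k t Ht) as [H1 H2].
        apply (is_derive_scal (fun x => Re (b k) * Re (D x k) + Im (b k) * Im (D x k))).
        apply (is_derive_plus (K := R_AbsRing) (V := R_NormedModule)).
        * apply (is_derive_scal (fun x => Re (D x k))), H1.
        * apply (is_derive_scal (fun x => Im (D x k))), H2. }
      induction n as [|n IH].
      + apply Hk.
      + eapply is_derive_ext; [intros; symmetry; apply zsum_S|].
        rewrite zsum_S.
        apply (is_derive_plus (K := R_AbsRing) (V := R_NormedModule)); [exact IH|].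
        apply (is_derive_plus (K := R_AbsRing) (V := R_NormedModule)); apply Hk.
    - intros t Ht. destruct (HB t Ht) as [_ HBn]. specialize (HBn n).
      set (E := D' t) in *.
      assert (H1 : Rabs (G E) <= zsum (fun k => (sqrt (wt s k) * Cmod (b k)) *
                                       (sqrt (wt s k) * Cmod (E k))) n).
      { assert (Hk : forall k, Rabs (wt s k * (Re (b k) * Re (E k) + Im (b k) * Im (E k)))
          <= (sqrt (wt s k) * Cmod (b k)) * (sqrt (wt s k) * Cmod (E k))).
        { intros k.
          replace (sqrt (wt s k) * Cmod (b k) * (sqrt (wt s k) * Cmod (E k))) with
            (sqrt (wt s k) * sqrt (wt s k) * (Cmod (b k) * Cmod (E k))) by ring.
          rewrite sqrt_sqrt by (left; apply wt_pos).
          rewrite Rabs_mult, (Rabs_pos_eq (wt s k)) by (left; apply wt_pos).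
          apply Rmult_le_compat_l; [left; apply wt_pos|].
          replace (Re (b k) * Re (E k) + Im (b k) * Im (E k)) with
            (Re (b k * Cconj (E k))%C)
            by (rewrite re_mult, re_conj, im_conj; ring).
          eapply Rle_trans; [apply re_le_Cmod|].
          rewrite Cmod_mult, Cmod_conj. lra. }
        unfold G. clear - Hk. induction n as [|n IH].
        - apply Hk.
        - rewrite !zsum_S.
          eapply Rle_trans; [apply Rabs_triang|]. apply Rplus_le_compat; [exact IH|].
          eapply Rle_trans; [apply Rabs_triang|]. apply Rplus_le_compat; apply Hk. }
      eapply Rle_trans; [exact H1|].
      assert (CS := zsum_cauchy_schwarz (fun k => sqrt (wt s k) * Cmod (b k))
        (fun k => sqrt (wt s k) * Cmod (E k)) n).
      rewrite (zsum_ext (fun k => (sqrt (wt s k) * Cmod (b k)) ^ 2) (hsq s b)) in CS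
        by (intros; symmetry; apply hsq_sqrt).
      rewrite (zsum_ext (fun k => (sqrt (wt s k) * Cmod (E k)) ^ 2) (hsq s E)) in CS
        by (intros; symmetry; apply hsq_sqrt).
      fold Q in CS.
      apply Rnot_lt_le. intros HL.
      assert (0 <= sqrt Q * B) by (apply Rmult_le_pos; auto; apply sqrt_pos).
      assert (Q * zsum (hsq s E) n <= sqrt Q ^ 2 * B ^ 2).
      { rewrite pow2_sqrt by exact HQ. now apply Rmult_le_compat_l. }
      nra. }
  assert (EQ : G (D d) - G (D 0) = Q).
  { assert (Hk : forall k, hsq s b k =
      wt s k * (Re (b k) * Re (D d k) + Im (b k) * Im (D d k)) -
      wt s k * (Re (b k) * Re (D 0 k) + Im (b k) * Im (D 0 k))).
    { intros k. unfold hsq. rewrite Cmod2_alt.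
      replace (Re (D d k)) with (Re (b k) + Re (D 0 k))
        by (unfold b; rewrite re_minus; ring).
      replace (Im (D d k)) with (Im (b k) + Im (D 0 k))
        by (unfold b; rewrite im_minus; ring). ring. }
    unfold G, Q. rewrite (zsum_ext _ _ n Hk). unfold Rminus.
    rewrite zsum_plus. f_equal.
    rewrite (zsum_ext (fun k => - _) (fun k => (-1) *
      (wt s k * (Re (b k) * Re (D 0 k) + Im (b k) * Im (D 0 k)))))
      by (intros; ring).
    rewrite zsum_scal. ring. }
  rewrite EQ, Rabs_pos_eq in HG by exact HQ.
  assert (Hs2 : sqrt Q ^ 2 = Q) by now apply pow2_sqrt.
  assert (Hs0 := sqrt_pos Q).
  assert (HBd : 0 <= B * d) by (apply Rmult_le_pos; lra).
  destruct (Rle_lt_dec (sqrt Q) (B * d)) as [L | L].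
  - rewrite <- Hs2. apply pow_incr. lra.
  - exfalso. nra.
Qed.

(** * The local error *)

Lemma rot_rot t u a k : rot t (rot u a) k = rot (t + u) a k.
Proof.
  unfold rot. rewrite Cmult_assoc, <- cis_plus. do 2 f_equal. ring.
Qed.

Lemma rot_0 a k : rot 0 a k = a k.
Proof.
  unfold rot. replace (- (0 * IZR k ^ 2)) with 0 by ring. rewrite cis_0. ring.
Qed.

Lemma rot_opp_l t a : rot t (rot (- t) a) = a.
Proof.
  apply functional_extensionality. intros k. rewrite rot_rot, Rplus_opp_r. apply rot_0.
Qed.

Lemma cj_cj a : cj (cj a) = a.
Proof.
  apply functional_extensionality. intros k. unfold cj.
  now rewrite Z.opp_involutive, Cconj_conj.
Qed.

Lemma cj_rot t a k : cj (rot t a) k = rot (- t) (cj a) k.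
Proof.
  unfold cj, rot. rewrite Cmult_conj, cis_conj, opp_IZR. do 2 f_equal. ring.
Qed.

Lemma ZSC_conj f : Cconj (ZSeriesC f) = ZSeriesC (fun k => Cconj (f k)).
Proof.
  apply C_eq; simpl; [reflexivity|].
  unfold ZSeries. rewrite <- Series_opp. apply Series_ext. intros [|n]; unfold Zterm; rewrite ?im_conj; unfold Im, Cconj; simpl; ring.
Qed.

Lemma ZSC_opp f : ZSeriesC (fun k => f (- k)%Z) = ZSeriesC f.
Proof.
  assert (H : forall g : Z -> R, ZSeries (fun k => g (- k)%Z) = ZSeries g).
  { intros g. apply Series_ext. intros [|n]; [reflexivity|].
    unfold Zterm. rewrite Z.opp_involutive. ring. }
  apply C_eq; [apply (H (fun k => Re (f k)))|apply (H (fun k => Im (f k)))].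
Qed.

Lemma cj_conv a b k : cj (conv a b) k = conv (cj a) (cj b) k.
Proof.
  unfold cj at 1, conv. rewrite ZSC_conj, <- ZSC_opp. apply ZSC_ext. intros j.
  rewrite Cmult_conj. unfold cj. do 3 f_equal. lia.
Qed.

Lemma phi1_conj h d : Cconj (phi1 (Ci * RtoC h * RtoC d)) =
  phi1 (Ci * RtoC (- h) * RtoC d).
Proof.
  rewrite !Ci_RtoC_RtoC. set (t := h * d).
  replace (- h * d) with (- t) by (unfold t; ring).
  assert (Z : forall x, (Ci * RtoC x = 0)%C -> x = 0).
  { intros x H. apply (f_equal Im) in H. rewrite im_mult in H. simpl in H. lra. }
  unfold phi1.
  destruct (Ceq_dec (Ci * RtoC t) 0) as [E1 | E1];
    destruct (Ceq_dec (Ci * RtoC (- t)) 0) as [E2 | E2].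
  - apply C_eq; simpl; ring.
  - exfalso. apply E2. apply Z in E1. rewrite E1, Ropp_0. ring.
  - exfalso. apply E1. apply Z in E2. replace t with 0 by lra. ring.
  - rewrite Cdiv_conj by exact E1. rewrite !Cexp_Ci, Cminus_conj, cis_conj.
    f_equal.
    + f_equal. apply C_eq; simpl; ring.
    + f_equal. apply C_eq; simpl; ring.
Qed.

Lemma cj_phim h a k : cj (phim h a) k = phim (- h) (cj a) k.
Proof.
  unfold cj, phim. rewrite Cmult_conj, phi1_conj, opp_IZR. do 4 f_equal. ring.
Qed.

Lemma cj_cub h a k : cj (cub h a) k = cub (- h) (cj a) k.
Proof.
  unfold cub. rewrite cj_conv. apply conv_ext; intros j; [apply cj_conv|apply cj_phim].
Qed.

Lemma phim_0 a k : phim 0 a k = a k.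
Proof.
  unfold phim, phi1. rewrite Ci_RtoC_RtoC, Rmult_0_l.
  destruct (Ceq_dec _ _) as [E | E]; [ring|].
  exfalso. apply E. ring.
Qed.

Lemma exp_le_compat x y : x <= y -> exp x <= exp y.
Proof. intros [H | ->]; [left; now apply exp_increasing|lra]. Qed.

(** Interpolation between the two bounds [2] and [2 x]. *)
Lemma min_le_Rpower x y g : 0 < x -> 0 <= g <= 1 -> y <= 2 -> y <= 2 * x ->
  y <= 2 * Rpower x g.
Proof.
  intros Hx Hg H1 H2. destruct (Rle_lt_dec 1 x) as [L | L].
  - assert (1 <= Rpower x g); [|lra].
    rewrite <- (Rpower_O x) by exact Hx. apply Rle_Rpower; lra.
  - assert (x <= Rpower x g); [|lra].
    rewrite <- (Rpower_1 x) at 1 by exact Hx. unfold Rpower.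
    assert (Hln : ln x < 0) by (rewrite <- ln_1; now apply ln_increasing).
    apply exp_le_compat. nra.
Qed.

(** [wt (1 / 2)] is the bracket [sqrt (1 + k^2)]. *)
Lemma abs_le_wt k : Rabs (IZR k) <= wt (1 / 2) k.
Proof.
  unfold wt. replace (1 / 2) with (/ 2) by field.
  rewrite Rpower_sqrt by apply one_plus_sq_pos.
  rewrite <- sqrt_Rsqr_abs. apply sqrt_le_1_alt. rewrite Rsqr_pow2. lra.
Qed.

(** Weights move between the norm and the sequence. *)
Lemma hle_wt s g a A : hle (s + g) a A ->
  hle s (fun k => RtoC (wt (g / 2) k) * a k)%C A.
Proof.
  intros [H0 H]; split; [exact H0|]. intros n.
  rewrite (zsum_ext _ (hsq (s + g) a)); [apply H|].
  intros k. unfold hsq. rewrite Cmod_mult, Cmod_R, Rabs_pos_eq by (left; apply wt_pos).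
  rewrite wt_plus. replace g with (g / 2 + g / 2) at 2 by field. rewrite wt_plus. ring.
Qed.

(** The phase of the interaction of the modes [j] and [k - j] is
    [k^2 - j^2 - (k - j)^2 = 2 j (k - j)].  It is a product, so an error
    [t^g] costs [g] derivatives on each factor instead of [2 g] on one. *)
Lemma conv_rot s g t a b A B : 1 / 2 < s -> 0 <= g <= 1 -> 0 < t ->
  hle (s + g) a A -> hle (s + g) b B ->
  hle s (fun k => rot (- t) (conv (rot t a) (rot t b)) k - conv a b k)%C
    (2 * Rpower t g * convK s * (A * B)).
Proof.
  intros Hs Hg Ht HA HB.
  assert (Ha : hle s a A) by (apply hle_weak with (s + g); auto; lra).
  assert (Hb : hle s b B) by (apply hle_weak with (s + g); auto; lra).
  assert (Hq : 0 < Rpower t g) by apply exp_pos.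
  apply hle_le with (convK s * ((2 * Rpower t g * A) * B)); [|right; ring].
  apply conv_dominated with
    (t := fun k j => ((cis (t * (2 * IZR j * IZR (k - j))) - 1) *
                      (a j * b (k - j)%Z))%C)
    (a := fun k => (RtoC (2 * Rpower t g) * (RtoC (wt (g / 2) k) * a k))%C)
    (b := fun k => (RtoC (wt (g / 2) k) * b k)%C); auto.
  - intros k.
    assert (Hra := hle_rot s t a A Ha). assert (Hrb := hle_rot s t b B Hb).
    unfold rot at 1, conv.
    rewrite <- ZSC_scal by exact (summ_conv_term s _ _ _ _ k Hs Hra Hrb).
    rewrite <- ZSC_minus.
    + apply ZSC_ext. intros j. unfold rot.
      replace (t * (2 * IZR j * IZR (k - j))) with
        (- (- t * IZR k ^ 2) + (- (t * IZR j ^ 2) + - (t * IZR (k - j) ^ 2)))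
        by (rewrite minus_IZR; ring).
      rewrite !cis_plus. ring.
    + apply summ_scal. exact (summ_conv_term s _ _ _ _ k Hs Hra Hrb).
    + exact (summ_conv_term s _ _ _ _ k Hs Ha Hb).
  - intros k j. set (l := (k - j)%Z).
    rewrite !Cmod_mult, !Cmod_R.
    rewrite (Rabs_pos_eq (2 * Rpower t g)) by lra.
    rewrite (Rabs_pos_eq (wt (g / 2) j)) by (left; apply wt_pos).
    rewrite (Rabs_pos_eq (wt (g / 2) l)) by (left; apply wt_pos).
    replace (2 * Rpower t g * (wt (g / 2) j * Cmod (a j)) * (wt (g / 2) l * Cmod (b l)))
      with ((2 * (Rpower t g * (wt (g / 2) j * wt (g / 2) l))) * (Cmod (a j) * Cmod (b l)))
      by ring.
    apply Rmult_le_compat_r; [apply Rmult_le_pos; apply Cmod_ge_0|].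
    assert (Ew : forall i, wt (g / 2) i = Rpower (wt (1 / 2) i) g).
    { intros i. unfold wt. rewrite Rpower_mult. f_equal. field. }
    assert (Hj := wt_pos (1 / 2) j). assert (Hl := wt_pos (1 / 2) l).
    rewrite !Ew, Rpower_mult_distr by assumption.
    rewrite Rpower_mult_distr by (auto; now apply Rmult_lt_0_compat).
    destruct (Cmod_cis_minus_1 (t * (2 * IZR j * IZR l))) as [H1 H2].
    apply min_le_Rpower; auto.
    + apply Rmult_lt_0_compat; auto. now apply Rmult_lt_0_compat.
    + eapply Rle_trans; [exact H2|].
      rewrite !Rabs_mult, (Rabs_pos_eq t), (Rabs_pos_eq 2) by lra.
      assert (Rabs (IZR j) * Rabs (IZR l) <= wt (1 / 2) j * wt (1 / 2) l).
      { apply Rmult_le_compat; auto using Rabs_pos, abs_le_wt. }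
      assert (t * (Rabs (IZR j) * Rabs (IZR l)) <= t * (wt (1 / 2) j * wt (1 / 2) l))
        by (apply Rmult_le_compat_l; lra).
      lra.
  - replace (2 * Rpower t g * A) with (Cmod (RtoC (2 * Rpower t g)) * A)
      by (rewrite Cmod_R, Rabs_pos_eq; lra).
    apply (hle_scal s (fun k => RtoC (wt (g / 2) k) * a k)%C).
    now apply hle_wt.
  - now apply hle_wt.
Qed.

(** [conj (exp (i t d_x^2) U)] is the free flow at time [t] of
    [exp (-2 i t d_x^2) conj U], so every factor of the cubic term is a free
    flow at the same time [t], and the bilinear estimate applies twice: first
    to the product of [u^2] with [conj u], then to [u^2] itself. *)
Lemma cub_rot s g t U M : 1 / 2 < s -> 0 <= g <= 1 -> 0 < t -> hle (s + g) U M ->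
  hle s (fun k => rot (- t) (cub 0 (rot t U)) k -
                  conv (conv U U) (rot (- (2 * t)) (cj U)) k)%C
    (2 * Rpower t g * convK s * (convK (s + g) + convK s) * M ^ 3).
Proof.
  intros Hs Hg Ht HU.
  assert (Hsg : 1 / 2 < s + g) by lra.
  assert (Hw : forall a A, hle (s + g) a A -> hle s a A)
    by (intros; apply hle_weak with (s + g); auto; lra).
  set (f := rot t U). set (b := rot (- (2 * t)) (cj U)).
  set (a := rot (- t) (conv f f)).
  assert (Hf : hle (s + g) f M) by now apply hle_rot.
  assert (Hb : hle (s + g) b M) by now apply hle_rot, hle_cj.
  assert (Hff : hle (s + g) (conv f f) (convK (s + g) * (M * M))) by now apply hle_conv.
  assert (Ha : hle (s + g) a (convK (s + g) * (M * M))) by now apply hle_rot.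
  assert (E : cub 0 f = conv (rot t a) (rot t b)).
  { apply functional_extensionality. intros k. unfold cub. apply conv_ext; intros j.
    - unfold a. now rewrite rot_opp_l.
    - rewrite phim_0. unfold f, b. rewrite cj_rot, rot_rot. f_equal. ring. }
  rewrite E.
  assert (H1 := conv_rot s g t a b _ _ Hs Hg Ht Ha Hb).
  assert (H2 := conv_rot s g t U U _ _ Hs Hg Ht HU HU).
  fold f in H2. fold a in H2.
  assert (H3 := hle_conv s _ _ _ _ Hs H2 (Hw _ _ Hb)).
  eapply hle_le; [eapply hle_ext; [|exact (hle_plus s _ _ _ _ H1 H3)]|].
  - intros k. cbv beta.
    rewrite <- (conv_minus_l s _ _ b _ _ _ k Hs (Hw _ _ Ha)
      (Hw _ _ (hle_conv (s + g) U U M M Hsg HU HU)) (Hw _ _ Hb)).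
    ring.
  - right. ring.
Qed.

(** A solution of the Schroedinger equation seen mode by mode.  Differentiability
    is asked only inside the interval and only of single coefficients, which is
    all that a distributional solution provides. *)
Definition flow (sg d M : R) (a : R -> Z -> C) : Prop :=
  (forall t, 0 <= t <= d -> hle sg (a t) M) /\
  (forall k, ccont (fun t => a (clamp d t) k)) /\
  (forall k t, 0 < t < d -> Cderive (fun y => a y k) t
     (- (Ci * RtoC (IZR k ^ 2) * a t k) + Ci * RtoC (1 / 2) * cub 0 (a t) k)%C).

Lemma flow_weak s s' d M a : s <= s' -> flow s' d M a -> flow s d M a.
Proof.
  intros Hs [H1 H2]. split; [|exact H2].
  intros t Ht. apply hle_weak with s'; auto.
Qed.

Lemma flow_restrict s d d' M a : 0 <= d' <= d -> flow s d M a -> flow s d' M a.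
Proof.
  intros Hd [H1 [H2 H3]]. split; [|split].
  - intros t Ht. apply H1. lra.
  - intros k. apply ccont_ext with (fun t => a (clamp d (clamp d' t)) k).
    + intros t. f_equal. apply clamp_id. generalize (clamp_in d' t). lra.
    + apply (ccont_comp (fun t => a (clamp d t) k)); [apply H2|apply continuous_clamp].
  - intros k t Ht. apply H3. lra.
Qed.

(** Time reversal combined with complex conjugation maps solutions to
    solutions. *)
Lemma flow_reverse s d M a : 0 <= d -> flow s d M a ->
  flow s d M (fun t => cj (a (d - t))).
Proof.
  intros Hd [H1 [H2 H3]]. split; [|split].
  - intros t Ht. apply hle_cj, H1. lra.
  - intros k. apply (ccont_conj (fun t => a (d - clamp d t) (- k)%Z)).
    apply ccont_ext with (fun t => a (clamp d (d - t)) (- k)%Z).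
    + intros t. f_equal. unfold clamp, Rmax, Rmin.
      repeat destruct (Rle_dec _ _); lra.
    + apply (ccont_comp (fun t => a (clamp d t) (- k)%Z) (fun t => d - t)); [apply H2|].
      intros t. apply (continuous_minus (fun _ => d) (fun y => y));
        [apply continuous_const|apply continuous_id].
  - intros k t Ht.
    assert (H := H3 (- k)%Z (d - t) ltac:(lra)).
    apply (Cderive_reverse (fun y => a y (- k)%Z)) in H.
    apply Cderive_conj in H. eapply Cderive_eq; [exact H|].
    assert (E : cub 0 (cj (a (d - t))) k = cj (cub 0 (a (d - t))) k)
      by (rewrite cj_cub, Ropp_0; reflexivity).
    rewrite E. unfold cj. rewrite opp_IZR.
    rewrite Copp_conj, Cplus_conj, Copp_conj, !Cmult_conj.
    replace (Cconj Ci) with (- Ci)%C by (apply C_eq; simpl; ring).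
    replace ((- IZR k) ^ 2) with (IZR k ^ 2) by ring.
    replace (Cconj (RtoC (IZR k ^ 2))) with (RtoC (IZR k ^ 2)) by (apply C_eq; simpl; ring).
    replace (Cconj (RtoC (1 / 2))) with (RtoC (1 / 2)) by (apply C_eq; simpl; ring).
    ring.
Qed.

Lemma flow_pullback_derive s d M a k t : flow s d M a -> 0 < t < d ->
  Cderive (fun y => rot (- y) (a y) k) t
    (Ci * RtoC (1 / 2) * rot (- t) (cub 0 (a t)) k)%C.
Proof.
  intros [_ [_ H]] Ht.
  apply Cderive_ext with (fun y => cis (y * IZR k ^ 2) * a y k)%C.
  { intros y. unfold rot. do 2 f_equal. ring. }
  eapply Cderive_eq; [apply Cderive_mult; [apply Cderive_cis|now apply H]|].
  unfold rot. replace (- (- t * IZR k ^ 2)) with (t * IZR k ^ 2) by ring.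
  cbv beta. ring.
Qed.

Lemma ccont_cis_clamp d c : ccont (fun t => cis (clamp d t * c)).
Proof.
  apply (ccont_comp (fun t => cis (t * c))); [|apply continuous_clamp].
  eapply Cderive_ccont. intros t. apply Cderive_cis.
Qed.

Lemma flow_pullback_ccont s d M a k : flow s d M a ->
  ccont (fun t => rot (- clamp d t) (a (clamp d t)) k).
Proof.
  intros [_ [H _]].
  apply ccont_ext with (fun t => cis (clamp d t * IZR k ^ 2) * a (clamp d t) k)%C.
  { intros y. unfold rot. do 2 f_equal. ring. }
  apply ccont_mult; [apply ccont_cis_clamp|apply H].
Qed.

(** Away from the free flow the solution moves only through the bounded
    nonlinearity. *)
Lemma flow_lipschitz s d M a : 1 / 2 < s -> 0 < d -> flow s d M a ->
  hle s (fun k => a d k - rot d (a 0) k)%C (convK s ^ 2 * M ^ 3 / 2 * d).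
Proof.
  intros Hs Hd Ha.
  assert (H : hle s (fun k => rot (- d) (a d) k - rot (- 0) (a 0) k)%C
    (convK s ^ 2 * M ^ 3 / 2 * d)).
  { apply (hle_mean_value s (fun t => rot (- t) (a t))
      (fun t k => Ci * RtoC (1 / 2) * rot (- t) (cub 0 (a t)) k)%C); auto.
    - intros k. now apply (flow_pullback_ccont s d M).
    - intros k t Ht. now apply (flow_pullback_derive s d M).
    - intros t Ht.
      apply hle_le with (1 / 2 * (convK s ^ 2 * M ^ 3)); [|lra].
      apply hle_scal_Ci; [lra|]. apply hle_rot, hle_cub; auto. apply Ha. lra. }
  apply (hle_rot s d) in H. eapply hle_ext; [|exact H].
  intros k. unfold rot at 1.
  transitivity (rot d (rot (- d) (a d)) k - rot d (rot (- 0) (a 0)) k)%C.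
  { unfold rot. ring. }
  rewrite rot_opp_l, rot_rot. replace (d + - 0) with d by ring. reflexivity.
Qed.

(** [osc c t] is the integral of [cis (y * c)] for [y] between [0] and [t]. *)
Definition osc (c t : R) : C := (RtoC t * phi1 (Ci * RtoC (t * c)))%C.

Lemma Cmod_osc c t : Cmod (osc c t) <= Rabs t.
Proof.
  unfold osc. rewrite Cmod_mult, Cmod_R, <- Ci_RtoC_RtoC.
  generalize (Cmod_phi1 t c), (Rabs_pos t). nra.
Qed.

Lemma Cderive_osc c t : Cderive (osc c) t (cis (t * c)).
Proof.
  destruct (Req_dec c 0) as [-> | Hc].
  - apply Cderive_ext with (fun y => RtoC y).
    + intros y. unfold osc, phi1. rewrite Rmult_0_r.
      destruct (Ceq_dec _ _) as [E | E]; [ring|exfalso; apply E; ring].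
    + rewrite Rmult_0_r, cis_0. split; simpl.
      * apply (is_derive_id (K := R_AbsRing)).
      * apply (is_derive_const (K := R_AbsRing) (V := R_NormedModule)).
  - assert (HC : (Ci * RtoC c)%C <> RtoC 0).
    { intros E. apply (f_equal Im) in E. rewrite im_mult in E. simpl in E. lra. }
    apply Cderive_ext with (fun y => / (Ci * RtoC c) * (cis (y * c) - 1))%C.
    + intros y. unfold osc, phi1.
      destruct (Ceq_dec _ _) as [E | E].
      * assert (Ey : y * c = 0).
        { apply (f_equal Im) in E. rewrite im_mult in E. simpl in E. lra. }
        rewrite Ey, cis_0. apply Rmult_integral in Ey.
        destruct Ey as [-> | Ey]; [ring|contradiction].
      * rewrite Cexp_Ci, RtoC_mult in *.
        assert (HCi : Ci <> RtoC 0).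
        { intros E0. apply HC. rewrite E0. ring. }
        assert (Hcc : RtoC c <> RtoC 0).
        { intros E0. apply HC. rewrite E0. ring. }
        assert (Hyy : RtoC y <> RtoC 0).
        { intros E0. apply E. rewrite E0. ring. }
        field. auto.
    + eapply Cderive_eq.
      * apply Cderive_scal, Cderive_minus; [apply Cderive_cis|apply Cderive_const].
      * rewrite Cmult_comm. unfold Cminus.
        transitivity ((/ (Ci * RtoC c) * (Ci * RtoC c)) * cis (t * c))%C; [ring|].
        rewrite Cinv_l by exact HC. ring.
Qed.

(** The first term comes from freezing the nonlinearity along the free flow, the
    second from the two bilinear estimates. *)
Definition local_const (s g M : R) : R :=
  3 / 4 * convK s ^ 4 * M ^ 5 + convK s * (convK (s + g) + convK s) * M ^ 3.

Lemma local_const_pos s g M : 0 <= M -> 0 <= local_const s g M.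
Proof.
  intros HM. unfold local_const.
  assert (H1 := convK_pos s). assert (H2 := convK_pos (s + g)).
  assert (0 <= convK s ^ 4) by now apply pow_le.
  assert (0 <= M ^ 5) by now apply pow_le.
  assert (0 <= M ^ 3) by now apply pow_le.
  assert (0 <= convK s ^ 4 * M ^ 5) by now apply Rmult_le_pos.
  assert (0 <= convK s * (convK (s + g) + convK s) * M ^ 3).
  { repeat apply Rmult_le_pos; lra. }
  lra.
Qed.

(** Comparing derivatives in time: on the solution side the nonlinearity is
    replaced by its value along the free flow, an error [O(t)], and then its
    quadratic phases are reduced to the one that the method integrates
    exactly, an error [O(t^g)]. *)
Lemma half_step_error s g d M a : 1 / 2 < s -> 0 < g <= 1 -> 0 < d <= 1 ->
  flow (s + g) d M a ->
  hle s (fun k => rot (- d) (a d) k -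
                  (a 0 k + Ci * RtoC (d / 2) * cub (- (2 * d)) (a 0) k))%C
    (local_const s g M * Rpower d g * d).
Proof.
  intros Hs Hg Hd Ha.
  assert (Has : flow s d M a) by (apply flow_weak with (s + g); auto; lra).
  set (U := a 0).
  assert (HU : hle (s + g) U M) by (apply Ha; lra).
  assert (HUs : hle s U M) by (apply Has; lra).
  assert (HM := hle_nonneg _ _ _ HU).
  assert (HUU := hle_conv s U U M M Hs HUs HUs).
  assert (HcU := hle_cj s U M HUs).
  set (P := fun t => conv (conv U U) (fun j => osc (2 * IZR j ^ 2) t * cj U j)%C).
  set (P' := fun t => conv (conv U U) (rot (- (2 * t)) (cj U))).
  assert (HP : forall k t, Cderive (fun y => P y k) t (P' t k)).
  { intros k t.
    set (c := fun j => (conv U U j * cj U (k - j)%Z)%C).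
    apply Cderive_ext with
      (fun y => ZSeriesC (fun j => c j * osc (2 * IZR (k - j) ^ 2) y)%C).
    { intros y. apply ZSC_ext. intros j. unfold c. ring. }
    eapply Cderive_eq.
    - apply (Cderive_ZSeriesC c (fun j => osc (2 * IZR (k - j) ^ 2))
        (fun j y => cis (y * (2 * IZR (k - j) ^ 2)))).
      + exact (summ_conv_term s _ _ _ _ k Hs HUU HcU).
      + intros; apply Cmod_osc.
      + intros. rewrite Cmod_cis. lra.
      + intros; apply Cderive_osc.
      + intros j. eapply Cderive_ccont. intros; apply Cderive_cis.
    - apply ZSC_ext. intros j. unfold c, rot.
      replace (- (- (2 * t) * IZR (k - j) ^ 2)) with (t * (2 * IZR (k - j) ^ 2)) by ring.
      ring. }
  set (D := fun t k => (rot (- t) (a t) k - Ci * RtoC (1 / 2) * P t k)%C).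
  set (D' := fun t k => (Ci * RtoC (1 / 2) * (rot (- t) (cub 0 (a t)) k - P' t k))%C).
  assert (H : hle s (fun k => D d k - D 0 k)%C (local_const s g M * Rpower d g * d)).
  { apply (hle_mean_value s D D'); [lra| | |].
    - intros k. unfold D. apply ccont_minus; [now apply (flow_pullback_ccont s d M)|].
      apply ccont_scal.
      apply (ccont_comp (fun t => P t k)); [|apply continuous_clamp].
      eapply Cderive_ccont. apply HP.
    - intros k t Ht. unfold D, D'.
      eapply Cderive_eq.
      + apply Cderive_minus; [now apply (flow_pullback_derive s d M)|].
        apply Cderive_scal, HP.
      + ring.
    - intros t Ht.
      set (L := convK s ^ 2 * M ^ 3 / 2 * t).
      assert (HL : hle s (fun k => a t k - rot t U k)%C L).
      { apply flow_lipschitz; auto; [lra|]. apply (flow_restrict s d); auto. lra. }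
      assert (Hat : hle s (a t) M) by (apply Has; lra).
      assert (Hrt : hle s (rot t U) M) by now apply hle_rot.
      assert (H1 := hle_rot s (- t) _ _ (hle_cub_diff s 0 _ _ _ _ Hs Hat Hrt HL)).
      assert (H2 := cub_rot s g t U M Hs ltac:(lra) ltac:(lra) HU).
      assert (H3 := hle_scal_Ci s (1 / 2) _ _ ltac:(lra) (hle_plus s _ _ _ _ H1 H2)).
      assert (Htg : 0 < Rpower t g) by apply exp_pos.
      assert (Htd : Rpower t g <= Rpower d g) by (apply Rle_Rpower_l; lra).
      assert (Ht1 : t <= Rpower t g).
      { rewrite <- (Rpower_1 t) at 1 by lra. unfold Rpower.
        assert (ln t <= 0).
        { rewrite <- ln_1. destruct (Req_dec t 1) as [->|]; [lra|].
          left. apply ln_increasing; lra. }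
        apply exp_le_compat. nra. }
      eapply hle_le; [eapply hle_ext; [|exact H3]|].
      + intros k. unfold D', P', rot. ring.
      + apply Rle_trans with (local_const s g M * Rpower t g).
        * unfold L, local_const.
          assert (0 <= convK s ^ 4 * M ^ 5)
            by (apply Rmult_le_pos; apply pow_le; auto using convK_pos).
          replace (1 / 2 * (3 * convK s ^ 2 * M ^ 2 * (convK s ^ 2 * M ^ 3 / 2 * t) +
            2 * Rpower t g * convK s * (convK (s + g) + convK s) * M ^ 3)) with
            (3 / 4 * (convK s ^ 4 * M ^ 5) * t +
             convK s * (convK (s + g) + convK s) * M ^ 3 * Rpower t g) by field.
          rewrite Rmult_plus_distr_r. apply Rplus_le_compat_r.
          rewrite <- (Rmult_assoc (3 / 4)).
          rewrite Rmult_assoc, (Rmult_assoc (3 / 4 * convK s ^ 4)).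
          rewrite <- !Rmult_assoc.
          apply Rmult_le_compat_l; [lra|exact Ht1].
        * apply Rmult_le_compat_l; [now apply local_const_pos|exact Htd]. }
  eapply hle_ext; [|exact H].
  intros k. unfold D.
  assert (E0 : P 0 k = RtoC 0).
  { unfold P. transitivity (conv (conv U U) (fun j => 0 * cj U j)%C k).
    - apply conv_ext; auto. intros j. unfold osc. ring.
    - unfold conv at 1. apply ZSC_unique.
      eapply Clim_ext; [|apply Clim_const]. intros n.
      rewrite (zsumC_ext _ (fun j => 0 * cj U j)%C) by (intros; ring).
      rewrite zsumC_scal. ring. }
  assert (Ed : P d k = (RtoC d * cub (- (2 * d)) U k)%C).
  { unfold P, cub, conv at 1 3.
    rewrite <- ZSC_scal.
    - apply ZSC_ext. intros j. unfold osc, phim. rewrite Ci_RtoC_RtoC.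
      replace (- (2 * d) * - IZR (k - j) ^ 2) with (d * (2 * IZR (k - j) ^ 2)) by ring.
      ring.
    - exact (summ_conv_term s _ _ _ _ k Hs HUU (hle_phim s _ _ _ HcU)). }
  rewrite E0, Ed, Ropp_0, rot_0. fold U.
  replace (d / 2) with (1 / 2 * d) by field. rewrite RtoC_mult. ring.
Qed.

(** The two halves of the step meet in the middle: the second one is the
    first one for the time-reversed conjugate solution, which is what makes
    the method symmetric. *)
Lemma local_error s g h M a : 1 / 2 < s -> 0 < g <= 1 -> 0 < h <= 1 ->
  flow (s + g) h M a ->
  hle s (fun k => a h k - rhs h (a 0) (a h) k)%C (local_const s g M * Rpower h g * h).
Proof.
  intros Hs Hg Hh Ha. set (d := h / 2).
  assert (Hd : 0 < d <= 1) by (unfold d; lra).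
  assert (HM : 0 <= M) by (apply (hle_nonneg (s + g) (a 0)), Ha; lra).
  assert (H1 := half_step_error s g d M a Hs Hg Hd
    (flow_restrict _ h d M a ltac:(unfold d; lra) Ha)).
  assert (H2 := half_step_error s g d M _ Hs Hg Hd
    (flow_restrict _ h d M _ ltac:(unfold d; lra)
      (flow_reverse _ h M a ltac:(lra) Ha))).
  cbv beta in H2. rewrite Rminus_0_r in H2.
  replace (h - d) with d in H2 by (unfold d; field).
  replace (2 * d) with h in H1, H2 by (unfold d; field).
  replace (d / 2) with (h / 4) in H1, H2 by (unfold d; field).
  assert (H3 := hle_minus s _ _ _ _ (hle_rot s h _ _ H1) (hle_cj s _ _ H2)).
  assert (Hle : Rpower d g <= Rpower h g) by (apply Rle_Rpower_l; unfold d; lra).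
  eapply hle_le; [eapply hle_ext; [|exact H3]|].
  - intros k.
    cbv beta. unfold rhs.
    rewrite (cj_minus (rot (- d) (cj (a d))) (fun j => cj (a h) j +
      Ci * RtoC (h / 4) * cub (- h) (cj (a h)) j)%C).
    assert (E1 : cj (rot (- d) (cj (a d))) k = rot d (a d) k).
    { rewrite cj_rot, Ropp_involutive, cj_cj. reflexivity. }
    assert (E2 : cj (fun j => cj (a h) j + Ci * RtoC (h / 4) * cub (- h) (cj (a h)) j)%C k
      = (a h k - Ci * RtoC (h / 4) * cub h (a h) k)%C).
    { unfold cj at 1. rewrite Cplus_conj, !Cmult_conj.
      change (Cconj (cj (a h) (- k)%Z)) with (cj (cj (a h)) k).
      change (Cconj (cub (- h) (cj (a h)) (- k)%Z)) with (cj (cub (- h) (cj (a h))) k).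
      rewrite cj_cub, !cj_cj, Ropp_involutive.
      replace (Cconj Ci) with (- Ci)%C by (apply C_eq; simpl; ring).
      replace (Cconj (RtoC (h / 4))) with (RtoC (h / 4)) by (apply C_eq; simpl; ring).
      ring. }
    rewrite E1, E2.
    assert (E3 : rot d (a d) k = rot h (rot (- d) (a d)) k).
    { rewrite rot_rot. f_equal. unfold d. field. }
    rewrite E3. unfold rot. ring.
  - replace (local_const s g M * Rpower d g * d + local_const s g M * Rpower d g * d)
      with (local_const s g M * h * Rpower d g) by (unfold d; field).
    replace (local_const s g M * Rpower h g * h)
      with (local_const s g M * h * Rpower h g) by ring.
    apply Rmult_le_compat_l; [|exact Hle].
    apply Rmult_le_pos; [now apply local_const_pos|lra].
Qed.

(** * From distributional solutions to curves of coefficients *)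

Lemma in_Hs_weak s s' f : s <= s' -> in_Hs s' f -> in_Hs s f.
Proof.
  intros Hs Hf. apply in_Hs_iff. apply in_Hs_iff in Hf.
  destruct Hf as [H1 [H2 [B HB]]]. split; [exact H1|]. split; [exact H2|].
  exists B. now apply hle_weak with s'.
Qed.

Lemma Derive_n_trig c n : forall al be, exists al' be', forall x,
  Derive_n (fun y => al * cos (c * y) + be * sin (c * y)) n x =
  al' * cos (c * x) + be' * sin (c * x).
Proof.
  induction n as [|n IH]; intros al be.
  - exists al, be. reflexivity.
  - destruct (IH al be) as [al' [be' H]].
    exists (c * be'), (- (c * al')). intros x. simpl.
    rewrite (Derive_ext _ _ _ H). apply is_derive_unique.
    auto_derive; [exact I|ring].
Qed.

Lemma test_function_trig al be k :
  test_function (fun y => al * cos (IZR k * y) + be * sin (IZR k * y)).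
Proof.
  split.
  - intros x.
    assert (H := cis_period k x). unfold cis in H. injection H as H1 H2.
    now rewrite H1, H2.
  - intros [|n] x; [exact I|]. simpl.
    destruct (Derive_n_trig (IZR k) n al be) as [al' [be' H]].
    apply (ex_derive_ext (K := R_AbsRing) (V := R_NormedModule)
      (fun y => al' * cos (IZR k * y) + be' * sin (IZR k * y))).
    + intros y. now rewrite H.
    + auto_derive. exact I.
Qed.

Lemma Derive_2_trig al be c x :
  Derive_n (fun y => al * cos (c * y) + be * sin (c * y)) 2 x =
  - c ^ 2 * (al * cos (c * x) + be * sin (c * x)).
Proof.
  simpl. rewrite (Derive_ext _
    (fun y => (c * be) * cos (c * y) + (- (c * al)) * sin (c * y))).
  - apply is_derive_unique. auto_derive; [exact I|ring].
  - intros y. apply is_derive_unique. auto_derive; [exact I|ring].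
Qed.

Lemma is_derive_C (f : R -> C) t l :
  is_derive (V := C_R_NormedModule) f t l -> Cderive f t l.
Proof.
  intros H. split.
  - apply (filterdiff_comp' (V := C_R_NormedModule) (W := R_NormedModule)
      f (fun z : C => fst z) t (fun y => scal y l) (fun z : C => fst z)); [exact H|].
    apply (filterdiff_linear (U := C_R_NormedModule) (V := R_NormedModule)).
    apply (is_linear_fst (U := R_NormedModule) (V := R_NormedModule)).
  - apply (filterdiff_comp' (V := C_R_NormedModule) (W := R_NormedModule)
      f (fun z : C => snd z) t (fun y => scal y l) (fun z : C => snd z)); [exact H|].
    apply (filterdiff_linear (U := C_R_NormedModule) (V := R_NormedModule)).
    apply (is_linear_snd (U := R_NormedModule) (V := R_NormedModule)).
Qed.

Lemma Cderive_ext_loc f g t l :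
  locally t (fun y => f y = g y) -> Cderive f t l -> Cderive g t l.
Proof.
  intros H [H1 H2]; split.
  - eapply (is_derive_ext_loc (K := R_AbsRing) (V := R_NormedModule)); [|exact H1].
    revert H. apply filter_imp. intros y Hy. now rewrite Hy.
  - eapply (is_derive_ext_loc (K := R_AbsRing) (V := R_NormedModule)); [|exact H2].
    revert H. apply filter_imp. intros y Hy. now rewrite Hy.
Qed.

Lemma Cderive_translate f c t a : Cderive f (c + t) a ->
  Cderive (fun y => f (c + y)) t a.
Proof.
  intros [H1 H2].
  assert (Hd : is_derive (fun y => c + y) t 1) by (auto_derive; [exact I|ring]).
  split.
  - eapply is_derive_eq.
    + exact (is_derive_comp (K := R_AbsRing) (V := R_NormedModule)
        (fun y => Re (f y)) (fun y => c + y) t _ _ H1 Hd).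
    + unfold scal; simpl; unfold mult; simpl. ring.
  - eapply is_derive_eq.
    + exact (is_derive_comp (K := R_AbsRing) (V := R_NormedModule)
        (fun y => Im (f y)) (fun y => c + y) t _ _ H2 Hd).
    + unfold scal; simpl; unfold mult; simpl. ring.
Qed.

Definition cos_mode (k : Z) (y : R) : R := 1 * cos (IZR k * y) + 0 * sin (IZR k * y).
Definition sin_mode (k : Z) (y : R) : R := 0 * cos (IZR k * y) + 1 * sin (IZR k * y).

Lemma ccont_trig_fun al be c : 
  ccont (fun y => RtoC (al * cos (c * y) + be * sin (c * y))).
Proof.
  split; intros x; simpl; [|apply continuous_const].
  apply (ex_derive_continuous (K := R_AbsRing) (V := R_NormedModule)).
  auto_derive. exact I.
Qed.

Lemma fcoef_pairing f k : ccont f ->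
  fcoef f k = (/ RtoC (2 * PI) * (pairing f (cos_mode k) - Ci * pairing f (sin_mode k)))%C.
Proof.
  intros Hf. rewrite fcoef_cis. f_equal. unfold pairing.
  assert (H1 := ccont_mult _ _ Hf (ccont_trig_fun 1 0 (IZR k))).
  assert (H2 := ccont_mult _ _ Hf (ccont_trig_fun 0 1 (IZR k))).
  change (fun x => f x * RtoC (1 * cos (IZR k * x) + 0 * sin (IZR k * x)))%C
    with (fun x => f x * RtoC (cos_mode k x))%C in H1.
  change (fun x => f x * RtoC (0 * cos (IZR k * x) + 1 * sin (IZR k * x)))%C
    with (fun x => f x * RtoC (sin_mode k x))%C in H2.
  transitivity (torus_int (fun x => f x * RtoC (cos_mode k x))%C +
                torus_int (fun x => (- Ci) * (f x * RtoC (sin_mode k x)))%C)%C.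
  - rewrite <- tint_plus by (auto; now apply ccont_scal).
    apply tint_ext. intros x.
    replace (cis (- IZR k * x)) with (RtoC (cos_mode k x) - Ci * RtoC (sin_mode k x))%C; [ring|].
    replace (- IZR k * x) with (- (IZR k * x)) by ring.
    rewrite <- cis_conj. unfold cos_mode, sin_mode. apply C_eq; simpl; ring.
  - rewrite tint_scal by exact H2. ring.
Qed.

Lemma pairing_Derive_2 f psi k : ccont f -> psi = cos_mode k \/ psi = sin_mode k ->
  pairing f (Derive_n psi 2) = (- RtoC (IZR k ^ 2) * pairing f psi)%C.
Proof.
  intros Hf Hpsi. unfold pairing. rewrite <- tint_scal.
  - apply tint_ext. intros x.
    destruct Hpsi as [-> | ->]; unfold cos_mode, sin_mode; rewrite Derive_2_trig, !RtoC_mult, RtoC_opp;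
      ring.
  - destruct Hpsi as [-> | ->]; apply (ccont_mult f); auto; apply ccont_trig_fun.
Qed.

(** Written as [u u (conj u)], the nonlinearity is a product of functions to which
    the rule for coefficients applies twice. *)
Lemma in_Hs_cubic_term s f : 1 / 2 < s -> in_Hs s f ->
  ccont (fun x => RtoC (Cmod (f x) ^ 2) * f x)%C /\
  forall k, fcoef (fun x => RtoC (Cmod (f x) ^ 2) * f x)%C k = cub 0 (fcoef f) k.
Proof.
  intros Hs Hf.
  assert (E : forall x, (f x * f x * fconj f x = RtoC (Cmod (f x) ^ 2) * f x)%C).
  { intros x. rewrite Cmod2_conj. unfold fconj. ring. }
  assert (Hc := in_Hs_fconj s f Hf).
  assert (Hff := in_Hs_mult s f f Hs Hf Hf).
  split.
  - eapply ccont_ext; [exact E|].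
    exact (in_Hs_ccont s _ (in_Hs_mult s _ _ Hs Hff Hc)).
  - intros k. rewrite <- (fcoef_ext _ _ k E).
    rewrite (fcoef_mult s (fun x => f x * f x)%C (fconj f) k Hs Hff Hc).
    apply conv_ext; intros j.
    + exact (fcoef_mult s f f j Hs Hf Hf).
    + rewrite phim_0. exact (fcoef_conj f j (in_Hs_ccont s f Hf)).
Qed.

(** Testing the equation against [cos (k x)] and [sin (k x)] gives the
    ordinary differential equation of the [k]-th mode. *)
Lemma NLS_coef_derive T s u0 u k t : 1 / 2 < s -> NLS_solution T u0 u ->
  (forall t, 0 <= t <= T -> in_Hs s (u t)) -> 0 < t < T ->
  Cderive (fun y => fcoef (u y) k) t
    (- (Ci * RtoC (IZR k ^ 2) * fcoef (u t) k) +
     Ci * RtoC (1 / 2) * cub 0 (fcoef (u t)) k)%C.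
Proof.
  intros Hs [_ Heq] Hin Ht.
  assert (Hut := Hin t ltac:(lra)). assert (Hc := in_Hs_ccont s _ Hut).
  destruct (in_Hs_cubic_term s (u t) Hs Hut) as [Hg Eg].
  set (g := fun x => (RtoC (Cmod (u t x) ^ 2) * u t x)%C) in *.
  assert (Hl : forall psi, psi = cos_mode k \/ psi = sin_mode k ->
    Cderive (fun y => pairing (u y) psi) t
      (Ci * (- RtoC (IZR k ^ 2) * pairing (u t) psi + RtoC (1 / 2) * pairing g psi))%C).
  { intros psi Hpsi.
    assert (Htest : test_function psi)
      by (destruct Hpsi as [-> | ->]; apply test_function_trig).
    destruct (Heq psi Htest t Ht) as [l [Hd El]].
    apply is_derive_C in Hd. eapply Cderive_eq; [exact Hd|].
    fold g in El. rewrite (pairing_Derive_2 _ _ k Hc Hpsi) in El.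
    assert (HCi : (Ci * Ci = -1)%C) by (apply C_eq; simpl; ring).
    transitivity (- (Ci * Ci) * l)%C; [rewrite HCi; ring|].
    transitivity (- Ci * (Ci * l + - RtoC (IZR k ^ 2) * pairing (u t) psi +
      RtoC (1 / 2) * pairing g psi) +
      Ci * (- RtoC (IZR k ^ 2) * pairing (u t) psi + RtoC (1 / 2) * pairing g psi))%C;
      [ring|].
    rewrite El. ring. }
  apply (Cderive_ext_loc
    (fun y => / RtoC (2 * PI) * (pairing (u y) (cos_mode k) - Ci * pairing (u y) (sin_mode k)))%C).
  - assert (Hm : 0 < Rmin t (T - t)) by (apply Rmin_pos; lra).
    exists (mkposreal _ Hm). intros y Hy.
    change (Rabs (y - t) < Rmin t (T - t)) in Hy.
    generalize (Rmin_l t (T - t)), (Rmin_r t (T - t)). intros.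
    apply Rabs_def2 in Hy.
    symmetry. apply fcoef_pairing, (in_Hs_ccont s), Hin. lra.
  - eapply Cderive_eq.
    + apply Cderive_scal, Cderive_minus; [apply Hl; now left|].
      apply Cderive_scal, Hl; now right.
    + rewrite <- Eg, !fcoef_pairing by assumption. ring.
Qed.

(** One coefficient is controlled by the norm. *)
Lemma C0_Hs_coef_ccont T s u k t0 h : 1 / 2 < s -> C0_Hs T s u ->
  0 <= t0 -> 0 <= h -> t0 + h <= T ->
  ccont (fun x => fcoef (u (t0 + clamp h x)) k).
Proof.
  intros Hs [Hin Hc] Ht0 Hh HT.
  assert (H : forall x (eps : posreal), locally x (fun y =>
    Cmod (fcoef (u (t0 + clamp h y)) k - fcoef (u (t0 + clamp h x)) k) < eps)).
  { intros x eps. set (t := t0 + clamp h x).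
    assert (Hx := clamp_in h x Hh).
    assert (Ht : 0 <= t <= T) by (unfold t; lra).
    specialize (Hc t Ht). rewrite filterlim_locally in Hc.
    destruct (Hc eps) as [del Hdel]. exists del. intros y Hy.
    assert (Hy' := clamp_in h y Hh). set (t' := t0 + clamp h y).
    assert (Ht' : 0 <= t' <= T) by (unfold t'; lra).
    assert (Hb : ball t del t').
    { change (Rabs (t' - t) < del).
      replace (t' - t) with (clamp h y - clamp h x) by (unfold t, t'; ring).
      eapply Rle_lt_trans; [apply clamp_lipschitz|exact Hy]. }
    specialize (Hdel t' Hb Ht').
    change (Rabs (Hs_norm s (fsub (u t') (u t)) - 0) < eps) in Hdel.
    rewrite Rminus_0_r in Hdel.
    rewrite <- (fcoef_fsub s _ _ k (Hin t' Ht') (Hin t Ht)).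
    eapply Rle_lt_trans; [|exact Hdel].
    eapply Rle_trans; [|apply Rle_abs].
    apply (hle_coef s); [lra|].
    exact (in_Hs_hle s _ (in_Hs_fsub s _ _ (Hin t' Ht') (Hin t Ht))). }
  split; intros x; apply filterlim_locally; intros eps; specialize (H x eps);
    revert H; apply filter_imp; intros y Hy.
  - change (Rabs (Re (fcoef (u (t0 + clamp h y)) k) -
                  Re (fcoef (u (t0 + clamp h x)) k)) < eps).
    rewrite <- re_minus. eapply Rle_lt_trans; [apply re_le_Cmod|exact Hy].
  - change (Rabs (Im (fcoef (u (t0 + clamp h y)) k) -
                  Im (fcoef (u (t0 + clamp h x)) k)) < eps).
    rewrite <- im_minus. eapply Rle_lt_trans; [apply im_le_Cmod|exact Hy].
Qed.

Lemma NLS_flow T s u0 u M t0 h : 1 / 2 < s -> C0_Hs T s u -> NLS_solution T u0 u ->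
  (forall t, 0 <= t <= T -> hle s (fcoef (u t)) M) ->
  0 <= t0 -> 0 <= h -> t0 + h <= T ->
  flow s h M (fun t => fcoef (u (t0 + t))).
Proof.
  intros Hs Hc Hnls HM Ht0 Hh HT. split; [|split].
  - intros t Ht. apply HM. lra.
  - intros k. now apply (C0_Hs_coef_ccont T s).
  - intros k t Ht. apply (Cderive_translate (fun y => fcoef (u y) k)).
    apply (NLS_coef_derive T s u0 u k (t0 + t) Hs Hnls (proj1 Hc)). lra.
Qed.

(** * Accumulation of errors *)

Definition stab_const (s r : R) : R := 3 * convK s ^ 2 * r ^ 2.

(** Subtracting the exact step, which satisfies the implicit equation up to the
    local error, gives [(1 - c h) e' <= (1 + c h) e + loc], where [e] and [e'] are
    the errors before and after the step.  Then [c h <= 1 / 2] yields the factor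
    [1 + 4 c h]. *)
Lemma one_step_error s g h A R v v' a e :
  1 / 2 < s -> 0 < g <= 1 -> h <= 1 -> A <= R -> small_step s h R ->
  in_Hs s v -> hle s (fcoef v) R -> method_step s h v v' ->
  flow (s + g) h A a -> hle s (fun k => fcoef v k - a 0 k)%C e ->
  in_Hs s v' /\
  hle s (fun k => fcoef v' k - a h k)%C
    ((1 + 4 * (stab_const s R * h)) * e + 2 * (local_const s g A * Rpower h g * h)).
Proof.
  intros Hs Hg Hh1 HAR Hsm Hv HvR Hstep Ha He.
  destruct (method_step_bound s h v v' R Hs Hsm Hv HvR Hstep) as [Hv' [Hv'R Ev']].
  split; [exact Hv'|].
  assert (Hh : 0 < h) by apply Hsm.
  assert (Has : flow s h A a) by (apply flow_weak with (s + g); auto; lra).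
  assert (Ha0 : hle s (a 0) R) by (apply hle_le with A; auto; apply Has; lra).
  assert (HR0 := hle_nonneg _ _ _ HvR).
  assert (Hah : hle s (a h) (2 * R)) by (apply hle_le with A; [apply Has; lra|lra]).
  assert (Hloc := local_error s g h A a Hs Hg ltac:(lra) Ha).
  assert (Hd := hle_nrm _ _ _ (hle_minus s _ _ _ _ Hv'R Hah)).
  set (x := nrm s (fun k => fcoef v' k - a h k)%C) in *.
  assert (Hx := hle_nonneg _ _ _ Hd). assert (He0 := hle_nonneg _ _ _ He).
  assert (H := hle_minus s _ _ _ _
    (hle_rhs_diff s h _ _ _ _ R (2 * R) e x Hs ltac:(lra) HvR Ha0 Hv'R Hah He Hd) Hloc).
  assert (Hxle : x <= e + h / 4 * (3 * convK s ^ 2 * R ^ 2 * e) +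
    h / 4 * (3 * convK s ^ 2 * (2 * R) ^ 2 * x) + local_const s g A * Rpower h g * h).
  { apply nrm_le. eapply hle_ext; [|exact H]. intros k. cbv beta. rewrite Ev'. ring. }
  eapply hle_le; [exact Hd|].
  set (la := local_const s g A * Rpower h g * h) in *.
  assert (Hla : 0 <= la) by apply (hle_nonneg _ _ _ Hloc).
  set (c := stab_const s R * h).
  assert (Hc0 : 0 <= c).
  { unfold c, stab_const. repeat apply Rmult_le_pos; try lra; apply convK_pos. }
  assert (Hc1 : c <= 1 / 2).
  { destruct Hsm as [_ Hsm]. unfold c, stab_const. lra. }
  assert (Hxc : x <= (1 + c) * e + c * x + la).
  { replace (h / 4 * (3 * convK s ^ 2 * R ^ 2 * e)) with (c / 4 * e) in Hxle
      by (unfold c, stab_const; field).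
    replace (h / 4 * (3 * convK s ^ 2 * (2 * R) ^ 2 * x)) with (c * x) in Hxle
      by (unfold c, stab_const; field).
    nra. }
  assert (H1 : (1 - c) * x <= (1 - c) * ((1 + 4 * c) * e + 2 * la)).
  { apply Rle_trans with ((1 + c) * e + la); [lra|].
    assert (0 <= c * (1 / 2 - c)) by (apply Rmult_le_pos; lra). nra. }
  apply Rmult_le_reg_l in H1; lra.
Qed.

(** As [method_seq], but counting steps by a natural number, on which existence
    and error bound are proved by induction. *)
Definition method_prefix (s h : R) (n : nat) (u0 : R -> C) (U : nat -> R -> C) : Prop :=
  (forall x, U 0%nat x = u0 x) /\
  forall m, (m < n)%nat -> method_step s h (U m) (U (S m)).

(** A supersolution of the recursion of [one_step_error]: linear in the elapsed time
    [h m], as without feedback, times the exponential growth due to it. *)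
Definition error_bound (s g h A r : R) (m : nat) : R :=
  exp (4 * stab_const s r * (h * INR m)) * (h * INR m) *
  (2 * local_const s g A * Rpower h g).

Lemma error_bound_pos s g h A R m : 0 <= A -> 0 <= h -> 0 <= error_bound s g h A R m.
Proof.
  intros HA Hh. unfold error_bound. apply Rmult_le_pos.
  - apply Rmult_le_pos; [left; apply exp_pos|apply Rmult_le_pos; auto using pos_INR].
  - apply Rmult_le_pos; [|left; apply exp_pos].
    apply Rmult_le_pos; [lra|now apply local_const_pos].
Qed.

Lemma stab_const_pos s R : 0 <= stab_const s R.
Proof.
  unfold stab_const. generalize (pow2_ge_0 (convK s)), (pow2_ge_0 R).
  intros. apply Rmult_le_pos; [apply Rmult_le_pos|]; lra.
Qed.

Lemma error_bound_S s g h A R m : 0 <= A -> 0 <= h ->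
  (1 + 4 * (stab_const s R * h)) * error_bound s g h A R m +
    2 * (local_const s g A * Rpower h g * h) <= error_bound s g h A R (S m).
Proof.
  intros HA Hh. unfold error_bound. rewrite S_INR.
  set (c := stab_const s R). set (L := 2 * local_const s g A * Rpower h g).
  assert (HL : 0 <= L).
  { apply Rmult_le_pos; [|left; apply exp_pos].
    apply Rmult_le_pos; [lra|now apply local_const_pos]. }
  assert (Hc : 0 <= c * h) by (apply Rmult_le_pos; auto; apply stab_const_pos).
  set (x := h * INR m).
  assert (Hx : 0 <= x) by (apply Rmult_le_pos; auto using pos_INR).
  replace (h * (INR m + 1)) with (x + h) by (unfold x; ring).
  replace (4 * c * (x + h)) with (4 * c * x + 4 * (c * h)) by ring.
  rewrite exp_plus.
  assert (H1 : 1 + 4 * (c * h) <= exp (4 * (c * h))).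
  { destruct (Req_dec (4 * (c * h)) 0) as [-> | Hn]; [rewrite exp_0; lra|].
    left. now apply exp_ineq1. }
  assert (H0 : 1 <= exp (4 * c * x)).
  { rewrite <- exp_0. apply exp_le_compat.
    apply Rmult_le_pos; auto. generalize (stab_const_pos s R). fold c. lra. }
  set (E := exp (4 * c * x)) in *. set (F := exp (4 * (c * h))) in *.
  assert (H2 : (1 + 4 * (c * h)) * (E * x * L) <= F * (E * x * L)).
  { apply Rmult_le_compat_r; [|exact H1].
    apply Rmult_le_pos; [apply Rmult_le_pos|]; lra. }
  assert (H3 : 1 * (h * L) <= (E * F) * (h * L)).
  { apply Rmult_le_compat_r; [now apply Rmult_le_pos|]. nra. }
  replace (2 * (local_const s g A * Rpower h g * h)) with (1 * (h * L))
    by (unfold L; ring).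
  replace (E * F * (x + h) * L) with (F * (E * x * L) + (E * F) * (h * L)) by ring.
  lra.
Qed.

Lemma error_bound_le s g h A R m T : 0 <= A -> 0 <= h -> h * INR m <= T ->
  error_bound s g h A R m <=
  exp (4 * stab_const s R * T) * T * (2 * local_const s g A) * Rpower h g.
Proof.
  intros HA Hh HT. unfold error_bound. rewrite <- (Rmult_assoc _ _ (Rpower h g)).
  assert (0 <= h * INR m) by (apply Rmult_le_pos; auto using pos_INR).
  apply Rmult_le_compat_r; [left; apply exp_pos|].
  apply Rmult_le_compat_r.
  { apply Rmult_le_pos; [lra|now apply local_const_pos]. }
  apply Rmult_le_compat; auto; [left; apply exp_pos|].
  apply exp_le_compat, Rmult_le_compat_l; auto.
  generalize (stab_const_pos s R). lra.
Qed.

(** Bootstrap: the error bound at step [n] places the numerical solution in the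
    ball of radius [R], and this allows the next step. *)
Lemma method_prefix_error T s g h A R u0 u U n :
  1 / 2 < s -> 0 < g <= 1 -> h <= 1 -> 0 <= A -> A + 1 <= R -> small_step s h R ->
  (forall m, h * INR m <= T -> error_bound s g h A R m <= 1) ->
  (forall t, 0 <= t <= T -> in_Hs s (u t)) -> (forall x, u 0 x = u0 x) ->
  (forall t0, 0 <= t0 -> t0 + h <= T ->
     flow (s + g) h A (fun t => fcoef (u (t0 + t)))) ->
  (forall t, 0 <= t <= T -> hle s (fcoef (u t)) A) ->
  method_prefix s h n u0 U -> h * INR n <= T ->
  in_Hs s (U n) /\ hle s (fcoef (U n)) R /\
  hle s (fun k => fcoef (U n) k - fcoef (u (h * INR n)%R) k)%C (error_bound s g h A R n).
Proof.
  intros Hs Hg Hh1 HA HAR Hsm Heb Hin Hu0 Hflow HuA.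
  assert (Hh : 0 < h) by apply Hsm.
  assert (Hball : forall V t e, 0 <= t <= T -> e <= 1 ->
    hle s (fun k => fcoef V k - fcoef (u t) k)%C e -> hle s (fcoef V) R).
  { intros V t e Ht He HV.
    eapply hle_le; [eapply hle_ext; [|exact (hle_plus s _ _ _ _ HV (HuA t Ht))]|lra].
    intros k. cbv beta. ring. }
  assert (Hpos : forall m, 0 <= h * INR m)
    by (intros; apply Rmult_le_pos; auto using pos_INR; lra).
  induction n as [|n IH]; intros [HU0 HU] HT.
  - assert (Ht0 : 0 <= 0 <= T).
    { generalize (Hpos 0%nat). simpl in HT. simpl. lra. }
    assert (E : U 0%nat = u 0).
    { apply functional_extensionality. intros x. now rewrite HU0, Hu0. }
    rewrite E. simpl INR. rewrite Rmult_0_r.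
    split; [now apply Hin|]. split.
    + apply hle_le with A; [now apply HuA|lra].
    + apply hle_le with 0; [apply hle_zero; intros; ring|].
      apply error_bound_pos; lra.
  - assert (HTn : h * INR n + h <= T) by (rewrite S_INR in HT; lra).
    destruct IH as [IH1 [IH2 IH3]].
    + split; [exact HU0|]. intros m Hm. apply HU. lia.
    + lra.
    + assert (Hf := Hflow (h * INR n) (Hpos n) HTn).
      assert (E0 : hle s (fun k => fcoef (U n) k -
        (fun t => fcoef (u (h * INR n + t)%R)) 0%R k)%C (error_bound s g h A R n)).
      { cbv beta. rewrite Rplus_0_r. exact IH3. }
      destruct (one_step_error s g h A R (U n) (U (S n)) _ _ Hs Hg Hh1 ltac:(lra) Hsm
        IH1 IH2 (HU n (Nat.lt_succ_diag_r n)) Hf E0) as [H1 H2].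
      cbv beta in H2.
      replace (h * INR n + h) with (h * INR (S n)) in H2 by (rewrite S_INR; ring).
      assert (H3 := hle_le _ _ _ _ H2 (error_bound_S s g h A R n HA ltac:(lra))).
      split; [exact H1|]. split; [|exact H3].
      apply (Hball _ _ _ (conj (Hpos (S n)) HT) (Heb (S n) HT) H3).
Qed.

Lemma floor_time T h m : 0 < h -> (Z.of_nat m <= Int_part (T / h))%Z -> h * INR m <= T.
Proof.
  intros Hh Hm. apply IZR_le in Hm. rewrite <- INR_IZR_INZ in Hm.
  destruct (base_Int_part (T / h)) as [H1 _].
  replace T with (h * (T / h)) by (field; lra).
  apply Rmult_le_compat_l; lra.
Qed.

(* [Int_part] is the floor function. *)
Theorem theorem4p1 :
  forall T s gamma : R,
  0 < T -> 1 / 2 < s -> 0 < gamma <= 1 ->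
  forall M : R,
  exists C h0 : R, 0 < C /\ 0 < h0 /\
  forall (u0 : R -> Complex.C) (u : R -> R -> Complex.C),
  C0_Hs T (s + gamma) u ->
  NLS_solution T u0 u ->
  is_sup_Hs T (s + gamma) u M ->
  forall h : R, 0 < h < h0 ->
  (exists U : nat -> R -> Complex.C,
     method_seq s h (Int_part (T / h)) u0 U) /\
  (forall U : nat -> R -> Complex.C,
     method_seq s h (Int_part (T / h)) u0 U ->
     forall m : nat, (0 <= Z.of_nat m <= Int_part (T / h))%Z ->
       in_Hs s (fsub (U m) (u (h * INR m))) /\
       Hs_norm s (fsub (U m) (u (h * INR m))) <= C * Rpower h gamma).
Proof.
  intros T s g HT Hs Hg M.
  set (A := Rabs M). set (R := A + 1).
  assert (HA : 0 <= A) by apply Rabs_pos.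
  set (C0 := exp (4 * stab_const s R * T) * T * (2 * local_const s g A)).
  assert (HC0 : 0 <= C0).
  { unfold C0. apply Rmult_le_pos.
    - apply Rmult_le_pos; [left; apply exp_pos|lra].
    - apply Rmult_le_pos; [lra|now apply local_const_pos]. }
  set (q := 6 * convK s ^ 2 * R ^ 2).
  assert (Hq : 0 <= q).
  { unfold q. generalize (pow2_ge_0 (convK s)), (pow2_ge_0 R). intros.
    apply Rmult_le_pos; [apply Rmult_le_pos|]; lra. }
  set (h1 := Rpower (/ (C0 + 1)) (/ g)).
  exists (C0 + 1), (Rmin (Rmin 1 (/ (q + 1))) h1).
  assert (Hh1 : 0 < h1) by apply exp_pos.
  assert (Hq1 : 0 < / (q + 1)) by (apply Rinv_0_lt_compat; lra).
  split; [lra|]. split; [repeat apply Rmin_pos; lra|].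
  intros u0 u HC Hnls Hsup h [Hh Hhlt].
  assert (Ha : h <= 1 /\ h <= / (q + 1) /\ h <= h1).
  { generalize (Rmin_l (Rmin 1 (/ (q + 1))) h1), (Rmin_r (Rmin 1 (/ (q + 1))) h1),
      (Rmin_l 1 (/ (q + 1))), (Rmin_r 1 (/ (q + 1))). lra. }
  destruct Ha as [Ha [Hb Hc]].
  assert (Hsm : small_step s h R).
  { split; [exact Hh|].
    replace (6 * h * convK s ^ 2 * R ^ 2) with (h * q) by (unfold q; ring).
    apply Rle_trans with (/ (q + 1) * (q + 1)).
    - apply Rmult_le_compat; lra.
    - rewrite Rinv_l; lra. }
  assert (Hhg : (C0 + 1) * Rpower h g <= 1).
  { assert (Hi : 0 < / (C0 + 1)) by (apply Rinv_0_lt_compat; lra).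
    apply Rle_trans with ((C0 + 1) * Rpower h1 g).
    - apply Rmult_le_compat_l; [lra|]. apply Rle_Rpower_l; lra.
    - unfold h1. rewrite Rpower_mult, Rinv_l, Rpower_1, Rinv_r by lra. lra. }
  assert (Hpg : 0 < Rpower h g) by apply exp_pos.
  assert (HinT : forall t, 0 <= t <= T -> in_Hs (s + g) (u t)) by apply HC.
  assert (Hin : forall t, 0 <= t <= T -> in_Hs s (u t)).
  { intros t Ht. apply in_Hs_weak with (s + g); [lra|now apply HinT]. }
  assert (HuA : forall t, 0 <= t <= T -> hle (s + g) (fcoef (u t)) A).
  { intros t Ht. apply hle_le with (Hs_norm (s + g) (u t)).
    - now apply in_Hs_hle, HinT.
    - apply Rle_trans with M; [|apply Rle_abs].
      apply (proj1 Hsup). now exists t. }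
  assert (HuAs : forall t, 0 <= t <= T -> hle s (fcoef (u t)) A).
  { intros t Ht. apply hle_weak with (s + g); [lra|now apply HuA]. }
  assert (Hflow : forall t0, 0 <= t0 -> t0 + h <= T ->
    flow (s + g) h A (fun t => fcoef (u (t0 + t)))).
  { intros t0 Ht0 Ht. apply (NLS_flow T (s + g) u0); auto; lra. }
  assert (Heb : forall m, h * INR m <= T ->
    error_bound s g h A R m <= (C0 + 1) * Rpower h g).
  { intros m Hm. eapply Rle_trans; [apply (error_bound_le s g h A R m T); lra|].
    fold C0. lra. }
  assert (Herr : forall U n, method_prefix s h n u0 U -> h * INR n <= T ->
    in_Hs s (U n) /\ hle s (fcoef (U n)) R /\
    hle s (fun k => fcoef (U n) k - fcoef (u (h * INR n)%R) k)%C
      (error_bound s g h A R n)).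
  { intros U n HU Hn. apply (method_prefix_error T s g h A R u0 u U n); auto.
    - unfold R. lra.
    - intros m Hm. generalize (Heb m Hm). lra.
    - apply Hnls. }
  split.
  - assert (Hex : forall n, h * INR n <= T -> exists U, method_prefix s h n u0 U).
    { induction n as [|n IH]; intros Hn.
      - exists (fun _ => u0). split; [reflexivity|]. intros m Hm. lia.
      - assert (Hn' : h * INR n <= T) by (rewrite S_INR in Hn; lra).
        destruct (IH Hn') as [U HU].
        destruct (Herr U n HU Hn') as [H1 [H2 _]].
        destruct (method_step_exists s h (U n) R Hs Hsm H1 H2) as [v' Hv'].
        exists (fun m => if Nat.leb m n then U m else v').
        split; [apply HU|]. intros m Hm.
        destruct (Nat.eq_dec m n) as [-> | Hmn].
        + rewrite Nat.leb_refl.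
          replace (Nat.leb (S n) n) with false; [exact Hv'|].
          symmetry. apply Nat.leb_gt. lia.
        + replace (Nat.leb m n) with true by (symmetry; apply Nat.leb_le; lia).
          replace (Nat.leb (S m) n) with true by (symmetry; apply Nat.leb_le; lia).
          apply HU. lia. }
    destruct (Hex (Z.to_nat (Int_part (T / h)))) as [U [HU0 HU]].
    { destruct (Z_le_gt_dec 0 (Int_part (T / h))) as [L | L].
      - apply floor_time; [exact Hh|]. rewrite Z2Nat.id; lia.
      - replace (Z.to_nat (Int_part (T / h))) with 0%nat by lia. simpl. lra. }
    exists U. split; [exact HU0|]. intros m Hm. apply HU. lia.
  - intros U [HU0 HU] m [_ Hm].
    assert (HmT := floor_time T h m Hh Hm).
    assert (Hpre : method_prefix s h m u0 U).
    { split; [exact HU0|]. intros i Hi. apply HU. lia. }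
    destruct (Herr U m Hpre HmT) as [H1 [_ H3]].
    assert (Ht : 0 <= h * INR m <= T).
    { split; [apply Rmult_le_pos; [lra|apply pos_INR]|exact HmT]. }
    split; [exact (in_Hs_fsub s _ _ H1 (Hin _ Ht))|].
    apply Rle_trans with (error_bound s g h A R m); [|now apply Heb].
    apply Hs_norm_le. eapply hle_ext; [|exact H3].
    intros k. cbv beta. symmetry. exact (fcoef_fsub s _ _ k H1 (Hin _ Ht)).
Qed.
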